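(* Let $N=2M\geq8$ be even and not a multiple of $3$, and let $k_{\max}=\lfloor N/6\rfloor$. If $\gamma=0$, then the families $B_k$ satisfy a metastable order given by $$B_0\prec B_1\prec\dots\prec B_{k_{\max}}.$$ Furthermore, for each $k\in\{1,\dots,k_{\max}\}$, any minimal path from $B_k$ to $B_{k-1}$ reaches communication height only on saddles in $C_k$. The hierarchy $B_0\prec B_1\prec\dots\prec B_{k_{\max}}$ still applies for sufficiently small positive $\gamma$, the only difference being that all points inside a given $B_k$ do not necessarily have the same potential value.
   Context: For $\gamma\geq0$ let $V_\gamma(x)=\sum_{i=1}^N\bigl(\tfrac14x_i^4-\tfrac12x_i^2\bigr)+\frac\gamma4\sum_{i=1}^N(x_{i+1}-x_i)^2$ on $\mathbb{R}^N$, with $x_{N+1}=x_1$, and let $S=\{x\in\mathbb{R}^N:\sum_ix_i=0\}$. Everything refers to the potential restricted to $S$: stationary points are critical points of $V_\gamma|_S$, local minima are those of index $0$ and $1$-saddles those of index $1$ (index = number of negative eigenvalues of the Hessian of $V_\gamma|_S$). For $\gamma=0$, the coordinates of a stationary point are among the three distinct real roots $\alpha_0,\alpha_1,\alpha_2$ of $\xi^3-\xi-\lambda$ for some $|\lambda|<\frac2{3\sqrt3}$; if $a_j$ is the number of coordinates equal to $\alpha_j$, with numbering such that $a_0\leq a_1\leq a_2$, the triple of the point is $(a_0,a_1,a_2)$. For $\gamma=0$, $B_k$ ($0\leq k\leq k_{\max}$) is the set of all local minima with triple $(0,M-k,M+k)$, and $C_k$ ($1\leq k\leq k_{\max}$)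 is the set of all $1$-saddles with triple $(1,M-k,M+k-1)$; the sets $B_0,\dots,B_{k_{\max}}$ partition the set of local minima. For small $\gamma>0$ (all stationary points being nondegenerate at $\gamma=0$) $B_k$ denotes the set of continuations $x^\star(\gamma)$ of the points of $B_k$. Communication height: for a local minimum $x^\star$ and a set $A\subset S$, $$H(x^\star,A)=\inf_{\Gamma:x^\star\to A}\ \sup_{t\in[0,1]}V_\gamma(\Gamma(t))-V_\gamma(x^\star),$$ where the infimum runs over continuous paths $\Gamma:[0,1]\to S$ with $\Gamma(0)=x^\star$ and $\Gamma(1)\in A$; a path realising the infimum is called a minimal path from $x^\star$ to $A$. Metastable hierarchy: a partition $P_1\cup\dots\cup P_m$ (disjoint union) of the set of local minima forms a metastable hierarchy (or metastable order), written $P_1\prec P_2\prec\dots\prec P_m$, if there is a constant $\theta>0$ such that for all $k\in\{2,\dots,m\}$, $$H\Bigl(x^\star,\bigcup_{i=1}^{k-1}P_i\Bigr)\leq\min_{y^\star\in P_\ell}H\Bigl(y^\star,\bigcup_{i=1}^kP_i\setminus P_\ell\Bigr)-\theta$$ for all $x^\star\in P_k$ and all $\ell\in\{1,\dots,k-1\}$.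
   Formalization: Literally false for minimal paths with a detour up to a non-stationary point at the same height; formalized as: every minimal path reaches communication height at some saddle in C_k, and every 1-saddle at which it reaches that height lies in C_k. *)

(* Defs.v *)
From HB Require Import structures.
From mathcomp Require Import all_boot all_order all_algebra.
From mathcomp Require Import polyrcf.
From mathcomp Require Import all_classical all_reals all_analysis.

Set Implicit Arguments.
Unset Strict Implicit.
Unset Printing Implicit Defensive.

Import Order.TTheory GRing.Theory Num.Theory.
Import numFieldNormedType.Exports.

Local Open Scope classical_set_scope.
Local Open Scope ring_scope.

Section Potential.
Variables (R : realType) (N : nat).
Implicit Types (gamma : R) (x y v : 'rV[R]_N) (A : set 'rV[R]_N).

(* [ordS] is the cyclic successor on 'I_N, so that x_{N+1} = x_1. *)
Definition potential gamma x : R :=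
  \sum_(i < N) (4^-1 * x ord0 i ^+ 4 - 2^-1 * x ord0 i ^+ 2)
  + gamma / 4 * \sum_(i < N) (x ord0 (ordS i) - x ord0 i) ^+ 2.

Definition zero_sum : set 'rV[R]_N := [set x | \sum_(i < N) x ord0 i = 0].

(* A critical point of the potential restricted to the hyperplane: the
   derivative vanishes along all tangent directions of the hyperplane. *)
Definition stationary gamma x : Prop :=
  zero_sum x /\ forall v, zero_sum v -> 'D_v (potential gamma) x = 0.

Definition hessian gamma x : 'M[R]_N :=
  \matrix_(i, j) 'D_(delta_mx ord0 i) ('D_(delta_mx ord0 j) (potential gamma)) x.

(* Orthogonal projection of R^N onto the zero-sum hyperplane. *)
Definition zero_sum_proj : 'M[R]_N := 1%:M - N%:R^-1 *: const_mx 1.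

(* The Hessian of the restricted potential is the compression of [hessian] to
   the hyperplane.  As an operator on the whole space, this product has the
   eigenvalues of the restricted Hessian and one additional eigenvalue 0, with
   eigenvector (1, ..., 1), which does not affect the index. *)
Definition restricted_hessian gamma x : 'M[R]_N :=
  zero_sum_proj *m hessian gamma x *m zero_sum_proj.

(* Negative eigenvalues are counted with multiplicity; the matrix being
   symmetric, the multiplicity is the dimension of the eigenspace.  [rootsR p]
   lists the distinct real roots of p. *)
Definition morse_index gamma x : nat :=
  let A := restricted_hessian gamma x in
  \sum_(a <- rootsR (char_poly A) | a < 0) \rank (eigenspace A a).

Definition local_minimum gamma : set 'rV[R]_N :=
  [set x | stationary gamma x /\ morse_index gamma x = 0%N].

Definition one_saddle gamma : set 'rV[R]_N :=
  [set x | stationary gamma x /\ morse_index gamma x = 1%N].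

Definition has_triple x (a0 a1 a2 : nat) : Prop :=
  exists lambda alpha0 alpha1 alpha2 : R,
    [/\ `|lambda| < 2 / (3 * Num.sqrt 3),
        uniq [:: alpha0; alpha1; alpha2]
          /\ all (root ('X^3 - 'X - lambda%:P)) [:: alpha0; alpha1; alpha2],
        forall i, x ord0 i \in [:: alpha0; alpha1; alpha2],
        [/\ #|[pred i | x ord0 i == alpha0]| = a0,
            #|[pred i | x ord0 i == alpha1]| = a1 &
            #|[pred i | x ord0 i == alpha2]| = a2] &
        (a0 <= a1 <= a2)%N].

Definition B0 (M k : nat) : set 'rV[R]_N :=
  [set x | local_minimum 0 x /\ has_triple x 0 (M - k) (M + k)].

Definition C0 (M k : nat) : set 'rV[R]_N :=
  [set x | one_saddle 0 x /\ has_triple x 1 (M - k) (M + k - 1)].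

(* [y] is reached from the stationary point [x] of the uncoupled potential by
   following a continuous curve of stationary points while the coupling
   increases from 0 to gamma.  As long as the stationary point stays
   nondegenerate, there is exactly one such [y], by the implicit function
   theorem. *)
Definition continuation gamma x y : Prop :=
  exists c : R -> 'rV[R]_N,
    [/\ {within `[0, gamma], continuous c}, c 0 = x, c gamma = y &
        forall g, g \in `[0, gamma] -> stationary g (c g)].

Definition B (M : nat) gamma (k : nat) : set 'rV[R]_N :=
  [set y | exists2 x, B0 M k x & continuation gamma x y].

Definition path_from_to x A : set (R -> 'rV[R]_N) :=
  [set Gamma | [/\ {within `[0 : R, 1], continuous Gamma},
                   forall t : R, t \in `[0, 1] -> zero_sum (Gamma t),
                   Gamma 0 = x & A (Gamma 1)]].

Local Open Scope ereal_scope.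

Definition path_height gamma x (Gamma : R -> 'rV[R]_N) : \bar R :=
  ereal_sup [set (potential gamma (Gamma t))%:E | t in `[0%R, 1%R]]
  - (potential gamma x)%:E.

Definition comm_height gamma x A : \bar R :=
  ereal_inf [set path_height gamma x Gamma | Gamma in path_from_to x A].

Definition minimal_path gamma x A : set (R -> 'rV[R]_N) :=
  [set Gamma | path_from_to x A Gamma
               /\ path_height gamma x Gamma = comm_height gamma x A].

(* The hierarchy P 0 < ... < P (m - 1): classes are numbered from 0.  The
   minimum over the finite class P l is written as an infimum. *)
Definition metastable_order gamma (m : nat) (P : nat -> set 'rV[R]_N) : Prop :=
  partition `I_m P (local_minimum gamma) /\
  exists2 theta : R, (0 < theta)%R &
    forall k, (1 <= k < m)%N -> forall x, P k x -> forall l, (l < k)%N ->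
      comm_height gamma x (\bigcup_(i in `I_k) P i) <=
      ereal_inf [set comm_height gamma y ((\bigcup_(i in `I_k.+1) P i) `\` P l)
                | y in P l] - theta%:E.

Definition at_comm_height gamma x A (z : 'rV[R]_N) : Prop :=
  (potential gamma z - potential gamma x)%:E = comm_height gamma x A.

End Potential.

(* Main.v *)
Require Import Defs.
From mathcomp Require Import all_boot all_order all_algebra.
From mathcomp Require Import ring lra zify.
From mathcomp Require Import polyrcf.
From mathcomp Require Import all_classical all_reals all_analysis.

(** Without coupling the potential is a sum of double wells r^4/4 - r^2/2, and at a
    stationary point on the zero-sum hyperplane all coordinates are roots
    r1 < r2 < r3 of one cubic r^3 - r - l; a double root would force 3 to divide N.
    The curvature of the well is positive at r1 and r3 and negative at r2, so that
    the number of coordinates at r2 governs the index: local minima have none of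
    them ([index0_middle]) and 1-saddles exactly one ([index1_middle]). A local
    minimum is therefore given by its pattern P of positive coordinates
    ([two_well], [local_minimum0P]), and |P| = M + k or M - k says that it belongs
    to B_k. The potentials of minima and of saddles in C_k are explicit rational
    functions of M and k, and the barrier between B_k and C_k decreases in k
    ([barrier_step]).

    Heights are bounded from above by an explicit path: from a pattern with M + k
    positive coordinates, flip one of them while staying at the lowest point of
    each ray; the highest point of this path lies in C_k ([saddle_path]).

    They are bounded from below by a calibration. Since the coordinates sum to zero,
    the well may be replaced by the tilted well r^4/4 - r^2/2 - l r for any l. For
    the l of a saddle in C_k, a path leaving a pattern must put some coordinate at
    the local maximum of the tilted well, and each of the other coordinates has at
    least the energy of the minimum on its side. This gives the energy of the
    saddle, with equality only at saddles ([face_bound], [exit_majority]). For k = 0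
    the tilt breaks the symmetry between the two sides, and the region that a path
    has to leave is cut out by both thresholds and by comparisons between the two
    sides ([exit_balanced]).

    The hierarchy follows because from class k one climbs the barrier of k, while
    leaving any class l < k costs at least the barrier of l, respectively of 1 if
    l = 0. The equality case locates the saddles on minimal paths.

    Weak coupling adds a nonnegative convex energy. On the region where all
    coordinates lie beyond a threshold on the sides given by P, the coupled potential
    is strongly convex, so that the region of a local minimum contains exactly one stationary point,
    which depends on the coupling in a Lipschitz way and is the continuation of
    [two_well P] ([branch_lipschitz], [continuation_branch]). A compactness argument
    excludes local minima outside of these regions ([local_minimum_region]). All
    heights change by an amount of order gamma, which the uniform gap of the uncoupled
    hierarchy absorbs ([metastable_families]). The coupling also splits the energies in
    B_0: a block of positive coordinates has fewer sign changes around the circle than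
    an alternating pattern ([patterns_differ]). *)

Set Implicit Arguments.
Unset Strict Implicit.
Unset Printing Implicit Defensive.

Import Order.TTheory GRing.Theory Num.Theory.
Import numFieldNormedType.Exports.

Local Open Scope classical_set_scope.
Local Open Scope ring_scope.

(** * Continuity and compactness in coordinates *)

Section ContinuousFunctions.
Variables (R : realType) (T : topologicalType).
Implicit Types (f h : T -> R).

Lemma ctsD f h : continuous f -> continuous h -> continuous (fun x => f x + h x).
Proof. by move=> fc hc x; apply: cvgD; [exact: fc|exact: hc]. Qed.

Lemma ctsN f : continuous f -> continuous (fun x => - f x).
Proof. by move=> fc x; apply: cvgN; exact: fc. Qed.

Lemma ctsB f h : continuous f -> continuous h -> continuous (fun x => f x - h x).
Proof. by move=> fc hc; apply: ctsD => //; exact: ctsN. Qed.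

Lemma ctsM f h : continuous f -> continuous h -> continuous (fun x => f x * h x).
Proof. by move=> fc hc x; apply: cvgM; [exact: fc|exact: hc]. Qed.

Lemma ctsC (c : R) : continuous (fun _ : T => c).
Proof. by move=> x; exact: cvg_cst. Qed.

Lemma ctsI : continuous (fun x : T => x).
Proof. by move=> x; exact: cvg_id. Qed.

Lemma ctsX f k : continuous f -> continuous (fun x => f x ^+ k).
Proof.
move=> fc; elim: k => [|k IH].
  by under eq_fun do rewrite expr0; exact: ctsC.
by under eq_fun do rewrite exprS; exact: ctsM.
Qed.

Lemma cts_abs f : continuous f -> continuous (fun x => `|f x|).
Proof. by move=> fc x; apply: cvg_norm; exact: fc. Qed.

Lemma cts_sum (I : Type) (r : seq I) (P : pred I) (F : I -> T -> R) :
  (forall i, P i -> continuous (F i)) -> continuous (fun x => \sum_(i <- r | P i) F i x).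
Proof. by move=> Fc; apply: continuous_big => //; exact: add_continuous. Qed.

Lemma closed_fun_ge f (b : R) : continuous f -> closed [set x | b <= f x].
Proof.
by move=> fc; apply: (@closed_comp _ _ f [set y | b <= y]) => [x _|]; [exact: fc|exact: closed_ge].
Qed.

Lemma closed_fun_eq f (b : R) : continuous f -> closed [set x | f x = b].
Proof.
by move=> fc; apply: (@closed_comp _ _ f [set y | y = b]) => [x _|]; [exact: fc|exact: closed_eq].
Qed.

Lemma closed_forall (I : Type) (F : I -> set T) :
  (forall i, closed (F i)) -> closed [set x | forall i, F i x].
Proof.
move=> Fc; rewrite (_ : [set x | _] = \bigcap_i F i); first exact: closed_bigI.
by apply/seteqP; split=> x H i; [move=> _; exact: H|exact: H].
Qed.

End ContinuousFunctions.

Lemma cts_coord (R : realType) n (i : 'I_n) : continuous (fun x : 'rV[R]_n => x ord0 i).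
Proof. exact: coord_continuous. Qed.

(** Compactness of boxes, in the form in which every minimisation below uses it. *)
Lemma box_closed_min (R : realType) n (f : 'rV[R]_n -> R) (K : set 'rV[R]_n) (b : R) :
  K !=set0 -> closed K -> (forall x i, K x -> `|x ord0 i| <= b) -> continuous f ->
  exists2 c, K c & forall x, K x -> f c <= f x.
Proof.
move=> K0 Kcl Kb fc.
have boxc : compact [set v : 'rV[R]_n | forall i, v ord0 i \in `[(- b), b]].
  apply: (@rV_compact _ _ (fun=> `[(- b), b]%classic)).
  by move=> _; apply: segment_compact.
have Kc : compact K.
  by apply: subclosed_compact Kcl boxc _ => v /Kb vb i; rewrite in_itv /= -ler_norml.
have [c cK cmin] := @EVT_min_rV R n f K K0 Kc (continuous_subspaceT fc).
exists c; first by rewrite inE in cK.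
by move=> x Kx; apply: cmin; rewrite inE.
Qed.

(** * Derivatives of the potential *)

Section Derivatives.
Variables (R : realType) (N : nat).
Implicit Types (g : R) (x v u : 'rV[R]_N) (i j : 'I_N).

(** Along a line the potential and its gradient are polynomials in the
    parameter, so that derivatives are read off from an exact Taylor expansion. *)
Lemma derive_quartic (f : 'rV[R]_N -> R) x v (d a b c : R) :
  (forall h : R, f (x + h *: v) = f x + h * d + h ^+ 2 * a + h ^+ 3 * b + h ^+ 4 * c) ->
  'D_v f x = d.
Proof.
move=> fE; rewrite /derive.
have cv : (fun h : R => d + h * (a + h * (b + h * c))) @ 0^' --> d.
  have h0 : (fun h : R => h) @ 0^' --> (0 : R) by apply: cvg_within_filter.
  rewrite [X in _ --> X](_ : d = d + 0 * (a + 0 * (b + 0 * c))); last by rewrite mul0r addr0.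
  do 3![apply: cvgD; [exact: cvg_cst|apply: cvgM => //]].
  exact: cvg_cst.
apply/cvg_lim => //.
apply: cvg_trans cv; apply: near_eq_cvg.
near=> h; have h0 : h != 0 by near: h; exact: nbhs_dnbhs_neq.
rewrite /= [h *: v + x]addrC fE /GRing.scale /=; field.
exact: h0.
Unshelve. all: by end_near. Qed.

Definition grad_along g v x : R :=
  \sum_(i < N) (x ord0 i ^+ 3 - x ord0 i) * v ord0 i
  + g / 2 * \sum_(i < N) (x ord0 (ordS i) - x ord0 i) * (v ord0 (ordS i) - v ord0 i).

Definition hess_form g x u v : R :=
  \sum_(i < N) (3 * x ord0 i ^+ 2 - 1) * u ord0 i * v ord0 i
  + g / 2 * \sum_(i < N) (u ord0 (ordS i) - u ord0 i) * (v ord0 (ordS i) - v ord0 i).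

Lemma potential_taylor g x v (h : R) : potential g (x + h *: v) =
  potential g x + h * grad_along g v x + h ^+ 2 * (hess_form g x v v / 2)
  + h ^+ 3 * (\sum_(i < N) x ord0 i * v ord0 i ^+ 3)
  + h ^+ 4 * (\sum_(i < N) v ord0 i ^+ 4 / 4).
Proof.
rewrite /potential /grad_along /hess_form.
rewrite !(mulrDr, mulrDl) !(mulr_sumr, mulr_suml).
rewrite -![in RHS]addrA.
rewrite [RHS](_ : _ = \sum_(i < N) (4^-1 * x ord0 i ^+ 4 - 2^-1 * x ord0 i ^+ 2
  + h * ((x ord0 i ^+ 3 - x ord0 i) * v ord0 i)
  + h ^+ 2 * ((3 * x ord0 i ^+ 2 - 1) * v ord0 i * v ord0 i / 2)
  + h ^+ 3 * (x ord0 i * v ord0 i ^+ 3) + h ^+ 4 * (v ord0 i ^+ 4 / 4)) +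
  \sum_(i < N) (g / 4 * (x ord0 (ordS i) - x ord0 i) ^+ 2
   + h * (g / 2 * ((x ord0 (ordS i) - x ord0 i) * (v ord0 (ordS i) - v ord0 i)))
   + h ^+ 2 * (g / 2 * ((v ord0 (ordS i) - v ord0 i) * (v ord0 (ordS i) - v ord0 i)) / 2))).
  by congr (_ + _); apply: eq_bigr => i _; rewrite !mxE; field.
rewrite !big_split /=.
ring.
Qed.

Lemma grad_along_taylor g x u v (h : R) :
  grad_along g u (x + h *: v) = grad_along g u x + h * hess_form g x u v
   + h ^+ 2 * (\sum_(i < N) 3 * x ord0 i * v ord0 i ^+ 2 * u ord0 i)
   + h ^+ 3 * (\sum_(i < N) v ord0 i ^+ 3 * u ord0 i).
Proof.
rewrite /grad_along /hess_form.
rewrite !(mulrDr, mulrDl) !(mulr_sumr, mulr_suml) -![in RHS]addrA.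
rewrite [RHS](_ : _ = \sum_(i < N) ((x ord0 i ^+ 3 - x ord0 i) * u ord0 i
  + h * ((3 * x ord0 i ^+ 2 - 1) * u ord0 i * v ord0 i)
  + h ^+ 2 * (3 * x ord0 i * v ord0 i ^+ 2 * u ord0 i)
  + h ^+ 3 * (v ord0 i ^+ 3 * u ord0 i)) +
  \sum_(i < N) (g / 2 * ((x ord0 (ordS i) - x ord0 i) * (u ord0 (ordS i) - u ord0 i))
   + h * (g / 2 * ((u ord0 (ordS i) - u ord0 i) * (v ord0 (ordS i) - v ord0 i))))).
  by congr (_ + _); apply: eq_bigr => i _; rewrite !mxE; field.
rewrite !big_split /=.
ring.
Qed.

Lemma derive_potential g x v : 'D_v (potential g) x = grad_along g v x.
Proof. exact: derive_quartic (potential_taylor g x v). Qed.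

Lemma hessianE g x i j :
  hessian g x i j = hess_form g x (delta_mx ord0 j) (delta_mx ord0 i).
Proof.
rewrite mxE (_ : 'D_(delta_mx ord0 j) (potential g) = grad_along g (delta_mx ord0 j)).
  by apply: (@derive_quartic _ _ _ _ _ _ 0) => h; rewrite grad_along_taylor mulr0 addr0.
by apply/funext => y; rewrite derive_potential.
Qed.

Lemma hess_formC g x u v : hess_form g x u v = hess_form g x v u.
Proof.
by rewrite /hess_form; congr (_ + _ * _); apply: eq_bigr => i _; ring.
Qed.

Lemma hess_formDl g x u w v : hess_form g x (u + w) v = hess_form g x u v + hess_form g x w v.
Proof.
rewrite /hess_form !mulr_sumr -!big_split /=.
by apply: eq_bigr => i _; rewrite !mxE; ring.
Qed.

Lemma hess_formZl g x (a : R) u v : hess_form g x (a *: u) v = a * hess_form g x u v.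
Proof.
rewrite /hess_form mulrDr !mulr_sumr; congr (_ + _).
  by apply: eq_bigr => i _; rewrite !mxE; ring.
by apply: eq_bigr => i _; rewrite !mxE; ring.
Qed.

Lemma hess_form_suml g x (I : finType) (F : I -> 'rV[R]_N) v :
  hess_form g x (\sum_i F i) v = \sum_i hess_form g x (F i) v.
Proof.
elim/big_rec2: _ => [|i y1 y2 _ <-]; last by rewrite hess_formDl.
by rewrite -(scale0r 0) hess_formZl mul0r.
Qed.

Lemma hess_form_mx g x u v :
  (u *m hessian g x *m v^T) ord0 ord0 = hess_form g x u v.
Proof.
rewrite [in RHS](row_sum_delta u) hess_form_suml -mulmxA mxE.
apply: eq_bigr => i _; rewrite hess_formZl; congr (_ * _).
rewrite hess_formC [in RHS](row_sum_delta v) hess_form_suml mxE.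
by apply: eq_bigr => j _; rewrite hess_formZl hessianE mxE mulrC.
Qed.

Lemma hessian_sym g x : (hessian g x)^T = hessian g x.
Proof. by apply/matrixP => i j; rewrite mxE !hessianE hess_formC. Qed.

(** Orthogonal projection onto the zero-sum hyperplane. The restricted Hessian
    is the Hessian form composed with it. *)
Definition recenter v : 'rV[R]_N := v *m zero_sum_proj R N.

Lemma zero_sum_proj_sym : (zero_sum_proj R N)^T = zero_sum_proj R N.
Proof. by rewrite /zero_sum_proj linearB linearZ /= tr_scalar_mx trmx_const. Qed.

Lemma restricted_form g x u v :
  (u *m restricted_hessian g x *m v^T) ord0 ord0 = hess_form g x (recenter u) (recenter v).
Proof.
by rewrite -hess_form_mx /recenter trmx_mul zero_sum_proj_sym !mulmxA.
Qed.

Lemma restricted_hessian_sym g x : (restricted_hessian g x)^T = restricted_hessian g x.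
Proof.
by rewrite /restricted_hessian !trmx_mul zero_sum_proj_sym hessian_sym mulmxA.
Qed.

Lemma recenterE v i : recenter v ord0 i = v ord0 i - N%:R^-1 * \sum_(j < N) v ord0 j.
Proof.
rewrite /recenter /zero_sum_proj mulmxBr mulmx1 !mxE; congr (_ - _).
by rewrite mulr_sumr; apply: eq_bigr => j _; rewrite !mxE mulr1 mulrC.
Qed.

Lemma recenter_zero_sum v : zero_sum (recenter v).
Proof.
rewrite /zero_sum /=; under eq_bigr do rewrite recenterE.
rewrite big_split /= sumrN sumr_const card_ord -[_ *+ N]mulr_natl mulrA.
case: (posnP N) => [N0|N0]; last by rewrite mulfV ?mul1r ?subrr // pnatr_eq0 -lt0n.
rewrite big1 ?add0r ?N0 ?mulr0n ?mul0r ?oppr0 ?mulr0 ?subr0 // => i _; case: i => i; lia.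
Qed.

Lemma recenter_id v : zero_sum v -> recenter v = v.
Proof.
by move=> v0; apply/rowP => i; rewrite recenterE v0 mulr0 subr0.
Qed.

Lemma stationaryE g x : stationary g x <->
  zero_sum x /\ forall v, zero_sum v -> grad_along g v x = 0.
Proof.
by split=> -[x0 H]; split=> // v v0; have := H v v0; rewrite derive_potential.
Qed.

End Derivatives.

(** * Counting negative eigenvalues of a symmetric matrix *)

Section SymmetricIndex.
Variables (R : realType) (n : nat).
Implicit Types (A : 'M[R]_n) (u v w : 'rV[R]_n).

Definition mxform A u v : R := (u *m A *m v^T) ord0 ord0.
Definition dotmx u v : R := (u *m v^T) ord0 ord0.

Lemma mxformDl A u w v : mxform A (u + w) v = mxform A u v + mxform A w v.
Proof. by rewrite /mxform !mulmxDl mxE. Qed.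
Lemma mxformDr A u w v : mxform A v (u + w) = mxform A v u + mxform A v w.
Proof. by rewrite /mxform linearD mulmxDr mxE. Qed.
Lemma mxformZl A (a : R) u v : mxform A (a *: u) v = a * mxform A u v.
Proof. by rewrite /mxform -!scalemxAl mxE. Qed.
Lemma mxformZr A (a : R) u v : mxform A u (a *: v) = a * mxform A u v.
Proof. by rewrite /mxform linearZ /= -scalemxAr mxE. Qed.

Lemma mxformC A u v : A^T = A -> mxform A u v = mxform A v u.
Proof.
move=> As; rewrite /mxform.
have -> : u *m A *m v^T = (v *m A *m u^T)^T by rewrite !trmx_mul trmxK As mulmxA.
by rewrite mxE.
Qed.

Lemma mxform1 u v : mxform 1%:M u v = dotmx u v.
Proof. by rewrite /mxform mulmx1. Qed.

Lemma dotmxE u v : dotmx u v = \sum_i u ord0 i * v ord0 i.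
Proof. by rewrite /dotmx mxE; apply: eq_bigr => i _; rewrite mxE. Qed.

Lemma dotmx_ge0 v : 0 <= dotmx v v.
Proof. by rewrite dotmxE sumr_ge0 // => i _; rewrite -expr2 sqr_ge0. Qed.

Lemma dotmx_eq0 v : dotmx v v = 0 -> v = 0.
Proof.
rewrite dotmxE => /eqP; rewrite psumr_eq0; last by move=> i _; rewrite -expr2 sqr_ge0.
by move=> /allP v0; apply/rowP => i; have := v0 i (mem_index_enum i);
   rewrite /= mulf_eq0 orbb mxE => /eqP.
Qed.

Lemma dotmxZ (a b : R) u v : dotmx (a *: u) (b *: v) = a * b * dotmx u v.
Proof. by rewrite -!mxform1 mxformZl mxformZr mulrA. Qed.

Lemma dotmx_gt0 v : v != 0 -> 0 < dotmx v v.
Proof. by move=> v0; rewrite lt_neqAle dotmx_ge0 andbT eq_sym; apply/eqP => /dotmx_eq0/eqP; apply/negP. Qed.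

(** First-order condition of a minimisation, without derivatives. *)
Lemma linear_term_eq0 (b c : R) : (forall t : R, 0 <= t * b + t ^+ 2 * c) -> b = 0.
Proof.
move=> H; apply/eqP; apply: contraT => b0.
have c1 : 0 < 1 + c ^+ 2 by rewrite ltr_wpDr // sqr_ge0.
have := H (- b / (1 + c ^+ 2)).
rewrite (_ : _ + _ = - (b ^+ 2 / (1 + c ^+ 2)) * (1 - c / (1 + c ^+ 2))); last by field; rewrite gt_eqF.
rewrite mulNr oppr_ge0 leNgt mulr_gt0 //; first by rewrite divr_gt0 // exprn_even_gt0.
by rewrite subr_gt0 ltr_pdivrMr // mul1r; nra.
Qed.

Lemma continuous_mxform A : continuous (fun v => mxform A v v).
Proof.
rewrite (_ : (fun v => _) = (fun v : 'rV[R]_n => \sum_j (\sum_i v ord0 i * A i j) * v ord0 j)).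
  apply: cts_sum => j _; apply: ctsM; last exact: cts_coord.
  by apply: cts_sum => i _; apply: ctsM; [exact: cts_coord|exact: ctsC].
apply/funext => v; rewrite /mxform mxE.
by apply: eq_bigr => j _; rewrite !mxE.
Qed.

Lemma dotmxDl u w v : dotmx (u + w) v = dotmx u v + dotmx w v.
Proof. by rewrite -!mxform1 mxformDl. Qed.

Lemma dotmxC u v : dotmx u v = dotmx v u.
Proof. by rewrite -!mxform1 mxformC ?trmx1. Qed.

Lemma mxform_eigen A u v (a : R) : u *m A = a *: u -> mxform A u v = a * dotmx u v.
Proof. by rewrite /mxform => ->; rewrite -scalemxAl mxE. Qed.

Definition neg_index A : nat :=
  \sum_(a <- rootsR (char_poly A) | a < 0) \rank (eigenspace A a).

Definition neg_eigenvalues A : seq R := [seq a <- rootsR (char_poly A) | a < 0].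

(** The span of all eigenvectors with negative eigenvalue: its dimension is the
    index. *)
Definition neg_space A : 'M[R]_n :=
  (\sum_(i < size (neg_eigenvalues A)) eigenspace A (neg_eigenvalues A)`_i)%MS.

Lemma neg_eigenvaluesP A a : a < 0 -> eigenvalue A a -> a \in neg_eigenvalues A.
Proof.
move=> a0; rewrite eigenvalue_root_char => ra; rewrite mem_filter a0 /=.
have cp0 : char_poly A != 0 by rewrite monic_neq0 // char_poly_monic.
by rewrite -(roots_on_rootsR cp0) ra in_itv.
Qed.

Lemma mxrank_neg_space A : \rank (neg_space A) = neg_index A.
Proof.
have us : uniq (neg_eigenvalues A) by rewrite filter_uniq // uniq_roots.
have /mxdirectP /= -> : mxdirect (neg_space A).
  apply: mxdirect_sum_eigenspace => i j _ _ /eqP.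
  by rewrite nth_uniq // => /eqP /val_inj.
by rewrite /neg_index -[RHS]big_filter [RHS](big_nth 0) big_mkord.
Qed.

Lemma neg_space_stable A : exists X, neg_space A *m A = X *m neg_space A.
Proof.
apply/submxP; have := submx_refl (neg_space A).
rewrite {2}/neg_space => /sub_sumsmxP[u uE]; rewrite {1}uE mulmx_suml.
apply: summx_sub => i _; apply: (sumsmx_sup i) => //; rewrite -mulmxA.
have /eigenspaceP -> := submx_refl (eigenspace A (neg_eigenvalues A)`_i).
by rewrite -scalemxAr scalemx_sub // submxMl.
Qed.

(** Eigenvectors of a symmetric matrix for distinct eigenvalues are orthogonal,
    so that the form is a weighted sum of squared norms with negative weights. *)
Lemma neg_space_form A v : A^T = A -> (v <= neg_space A)%MS -> v != 0 -> mxform A v v < 0.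
Proof.
move=> As /sub_sumsmxP[u vE] v0.
set s := neg_eigenvalues A in u vE.
pose w i := u i *m eigenspace A s`_i.
have wA i : w i *m A = s`_i *: w i by apply/eigenspaceP; exact: submxMl.
have s0 (i : 'I_(size s)) : s`_i < 0.
  by have := mem_nth 0 (ltn_ord i); rewrite mem_filter => /andP[].
have us : uniq s by rewrite filter_uniq // uniq_roots.
have wo i j : i != j -> dotmx (w i) (w j) = 0.
  move=> ij.
  have : mxform A (w i) (w j) = mxform A (w j) (w i) by rewrite mxformC.
  rewrite !(mxform_eigen _ (wA _)).
  rewrite (dotmxC (w j)) => /eqP.
  by rewrite -subr_eq0 -mulrBl mulf_eq0 subr_eq0 nth_uniq // val_eqE (negPf ij) => /eqP.
have vw : v = \sum_i w i by [].
have sumr F : dotmx (\sum_(i < size s) F i) v = \sum_i dotmx (F i) v.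
  by rewrite /dotmx mulmx_suml summxE.
have wv i : dotmx (w i) v = dotmx (w i) (w i).
  rewrite {1}vw /dotmx linear_sum mulmx_sumr summxE (bigD1 i) //= big1 ?addr0 // => j ji.
  by apply: (wo i j); rewrite eq_sym.
have -> : mxform A v v = \sum_(i < size s) s`_i * dotmx (w i) (w i).
  rewrite /mxform -[X in X = _]/(dotmx (v *m A) v) {1}vw mulmx_suml sumr.
  by apply: eq_bigr => i _; rewrite wA -[v]scale1r dotmxZ mulr1 wv.
rewrite lt_neqAle; apply/andP; split; last first.
  by apply: sumr_le0 => i _; rewrite mulr_le0_ge0 ?dotmx_ge0 // ltW.
apply: contra v0 => /eqP H0.
have H : \sum_(i < size s) (- s`_i) * dotmx (w i) (w i) == 0.
  by under eq_bigr do rewrite mulNr; rewrite sumrN H0 oppr0.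
move: H; rewrite psumr_eq0 => [/allP H|i _]; last by rewrite mulr_ge0 ?dotmx_ge0 // oppr_ge0 ltW.
rewrite vw big1 // => i _; apply: dotmx_eq0; apply/eqP.
by have := H i (mem_index_enum i); rewrite /= mulf_eq0 oppr_eq0 lt_eqF.
Qed.

(** Otherwise the form would have a negative minimum on the unit sphere of the
    orthogonal complement. A minimiser would be an eigenvector with negative
    eigenvalue, hence would lie in the negative space and be orthogonal to itself.
    This replaces the spectral theorem. *)
Lemma neg_space_compl A v : A^T = A -> v *m (neg_space A)^T = 0 -> 0 <= mxform A v v.
Proof.
move=> As vE; rewrite leNgt; apply/negP => qv.
set E := neg_space A in vE.
have v0 : v != 0 by apply: contraTneq qv => ->; rewrite /mxform !mul0mx mxE ltxx.
pose K := [set x : 'rV[R]_n | dotmx x x = 1] `&` [set x : 'rV[R]_n | forall j, (x *m E^T) ord0 j = 0].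
have sc (x : 'rV[R]_n) : x *m E^T = 0 -> x != 0 -> exists2 c : R, c ^+ 2 = dotmx x x & 0 < c /\ K (c^-1 *: x).
  move=> xE x0; have dx := dotmx_gt0 x0.
  have sx : 0 < Num.sqrt (dotmx x x) by rewrite sqrtr_gt0.
  exists (Num.sqrt (dotmx x x)); first by rewrite sqr_sqrtr // ltW.
  split => //; split => /=.
    by rewrite dotmxZ -{3}[dotmx x x]sqr_sqrtr ?ltW //; field; rewrite gt_eqF.
  by move=> j; rewrite -scalemxAl xE scaler0 mxE.
have [c0 _ [_ Kv]] := sc _ vE v0.
have dotc : continuous (fun x => dotmx x x).
  rewrite (_ : (fun x => _) = (fun x => mxform 1%:M x x)); first exact: continuous_mxform.
  by apply/funext => x; rewrite mxform1.
have Kcl : closed K.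
  apply: closedI; first exact: closed_fun_eq.
  apply: closed_forall => j; apply: closed_fun_eq.
  rewrite (_ : (fun v => _) = (fun x : 'rV[R]_n => \sum_i x ord0 i * E^T i j)).
    by apply: cts_sum => i _; apply: ctsM; [exact: cts_coord|exact: ctsC].
  by apply/funext => x; rewrite mxE.
have Kb x i : K x -> `|x ord0 i| <= 1.
  move=> [/= x1 _]; rewrite -(@ler_pXn2r _ 2) ?nnegrE // expr1n real_normK ?num_real // -x1.
  by rewrite dotmxE (bigD1 i) //= expr2 lerDl sumr_ge0 // => j _; rewrite -expr2 sqr_ge0.
have [v1 [/= v11 v1E'] v1min] := box_closed_min (ex_intro _ _ Kv) Kcl Kb (@continuous_mxform A).
have {v1E'} v1E : v1 *m E^T = 0 by apply/rowP => j; rewrite v1E' mxE.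
pose mu := mxform A v1 v1.
have form_ge x : x *m E^T = 0 -> mu * dotmx x x <= mxform A x x.
  move=> xE; have [->|x0] := eqVneq x 0.
    by rewrite /dotmx /mxform !mul0mx mxE mulr0.
  have [c cE [cp Kx]] := sc _ xE x0.
  have := v1min _ Kx; rewrite mxformZl mxformZr mulrA -expr2 exprVn cE mulrC ler_pdivlMr ?dotmx_gt0 //.
have mu0 : mu < 0.
  apply: contraTT qv; rewrite -!leNgt => mu0; apply: le_trans (form_ge _ vE).
  by rewrite mulr_ge0 // dotmx_ge0.
have [r rdef] : exists r, r = v1 *m A - mu *: v1 by eexists.
have rE : r *m E^T = 0.
  rewrite rdef mulmxBl -scalemxAl v1E scaler0 subr0.
  have [X XE] := neg_space_stable A.
  rewrite -mulmxA (_ : A *m E^T = (E *m A)^T); last by rewrite trmx_mul As.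
  by rewrite [E *m A]XE trmx_mul mulmxA v1E mul0mx.
have r0 : r = 0.
  apply: dotmx_eq0; apply: (@linear_term_eq0 _ ((mxform A r r - mu * dotmx r r) / 2)) => t.
  suff : 0 <= t * dotmx r r * 2 + t ^+ 2 * (mxform A r r - mu * dotmx r r) by lra.
  have := form_ge (v1 + t *: r).
  rewrite mulmxDl v1E -scalemxAl rE scaler0 addr0 => /(_ erefl).
  rewrite -mxform1 !(mxformDl, mxformDr, mxformZl, mxformZr) !mxform1 v11.
  rewrite (mxformC r v1 As) -/mu (dotmxC r v1).
  have -> : mxform A v1 r = dotmx r r + mu * dotmx v1 r.
    rewrite -[mxform A v1 r]/(dotmx (v1 *m A) r).
    have -> : v1 *m A = r + mu *: v1 by rewrite rdef subrK.
    by rewrite dotmxDl -[in X in _ + X](scale1r r) dotmxZ mulr1.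
  by rewrite -/mu => H; lra.
have ev : (v1 <= eigenspace A mu)%MS.
  by apply/eigenspaceP; apply/eqP; rewrite -subr_eq0 -rdef r0.
have v10 : v1 != 0.
  by apply: contraTneq (@oner_neq0 R) => v10; rewrite -v11 v10 /dotmx mul0mx mxE eqxx.
have mus : mu \in neg_eigenvalues A.
  by apply: neg_eigenvaluesP => //; apply/eigenvalueP; exists v1 => //; exact/eigenspaceP.
have v1S : (v1 <= E)%MS.
  have is_lt : (index mu (neg_eigenvalues A) < size (neg_eigenvalues A))%N by rewrite index_mem.
  apply: submx_trans ev _.
  by have := sumsmx_sup (P := predT) (Ordinal is_lt) (B_ := fun i : 'I_(size (neg_eigenvalues A)) => eigenspace A (neg_eigenvalues A)`_i) (A := eigenspace A mu); apply; rewrite //= nth_index.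
have /submxP[D DE] := v1S.
by move/eqP: v11; rewrite /dotmx {2}DE trmx_mul mulmxA v1E mul0mx mxE eq_sym oner_eq0.
Qed.

Lemma neg_index0P A : A^T = A -> neg_index A = 0%N <-> forall v, 0 <= mxform A v v.
Proof.
move=> As; rewrite -mxrank_neg_space; split=> [/eqP|H].
  by rewrite mxrank_eq0 => /eqP E0 v; apply: neg_space_compl => //; rewrite E0 trmx0 mulmx0.
apply/eqP; rewrite mxrank_eq0; apply/rowV0P => v vE; apply/eqP; apply: contraT => v0.
by have := neg_space_form As vE v0; rewrite ltNge H.
Qed.

(** The negative space meets the hyperplane orthogonal to h only in 0, so it has
    dimension at most one; it is not 0 because of v. *)
Lemma neg_index1_intro A v (h : 'cV[R]_n) : A^T = A -> mxform A v v < 0 ->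
  (forall u, u *m h = 0 -> 0 <= mxform A u u) -> neg_index A = 1%N.
Proof.
move=> As qv qh; apply/eqP; rewrite -mxrank_neg_space eqn_leq; apply/andP; split; last first.
  rewrite lt0n mxrank_eq0; apply: contraTneq qv => E0; rewrite -leNgt.
  by apply: neg_space_compl => //; rewrite E0 trmx0 mulmx0.
have : (neg_space A :&: kermx h)%MS = 0.
  apply/eqP/rowV0P => u; rewrite sub_capmx => /andP[uE /sub_kermxP uh].
  apply/eqP; apply: contraT => u0.
  by have := neg_space_form As uE u0; rewrite ltNge qh.
move/mxrank_disjoint_sum => rk.
have := rank_leq_col (neg_space A + kermx h)%MS; rewrite rk mxrank_ker.
have := rank_leq_row h; have := rank_leq_col h; lia.
Qed.

(** If the negative space is a line, some nonzero vector of the plane spanned by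
    u and v is orthogonal to it, and the form is nonnegative there. *)
Lemma neg_index1_elim A u v : A^T = A -> neg_index A = 1%N ->
  (forall a b : R, (a != 0) || (b != 0) -> mxform A (a *: u + b *: v) (a *: u + b *: v) < 0) -> False.
Proof.
move=> As; rewrite -mxrank_neg_space => E1 H.
have [a [b [ab abE]]] : exists a b : R, ((a != 0) || (b != 0)) /\ (a *: u + b *: v) *m (neg_space A)^T = 0.
  have : (\rank (col_mx (u *m (neg_space A)^T) (v *m (neg_space A)^T)) <= 1)%N.
    by rewrite -mul_col_mx; apply: leq_trans (mxrankM_maxr _ _) _; rewrite mxrank_tr E1.
  rewrite -ltnS -[2%N]/(1 + 1)%N => rk2.
  have /rowV0Pn[w wk w0] : kermx (col_mx (u *m (neg_space A)^T) (v *m (neg_space A)^T)) != 0.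
    by rewrite -mxrank_eq0 mxrank_ker -lt0n subn_gt0.
  move/sub_kermxP: wk; rewrite -[w]hsubmxK mul_row_col => wk.
  exists (lsubmx w ord0 ord0), (rsubmx w ord0 ord0); split.
    apply: contraNT w0; rewrite negb_or !negbK => /andP[/eqP l0 /eqP r0].
    have lw : lsubmx w = 0 by apply/matrixP => i j; rewrite !ord1 l0 mxE.
    have rw : rsubmx w = 0 by apply/matrixP => i j; rewrite !ord1 r0 mxE.
    by rewrite -[w]hsubmxK lw rw row_mx0.
  by rewrite mulmxDl -!scalemxAl -!mul_scalar_mx -!mx11_scalar.
by have := H a b ab; rewrite ltNge neg_space_compl.
Qed.

End SymmetricIndex.

(** * Stationary points without coupling *)

Section UncoupledStationary.
Variables (R : realType) (N : nat).
Implicit Types (x v u : 'rV[R]_N) (i j : 'I_N) (P : {set 'I_N}) (r : R).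

Definition well r : R := 4^-1 * r ^+ 4 - 2^-1 * r ^+ 2.

Lemma potential0E x : potential 0 x = \sum_i well (x ord0 i).
Proof. by rewrite /potential !mul0r addr0. Qed.

Lemma grad_along0E v x : grad_along 0 v x = \sum_i (x ord0 i ^+ 3 - x ord0 i) * v ord0 i.
Proof. by rewrite /grad_along !mul0r addr0. Qed.

Lemma hess_form0E x u v : hess_form 0 x u v = \sum_i (3 * x ord0 i ^+ 2 - 1) * u ord0 i * v ord0 i.
Proof. by rewrite /hess_form !mul0r addr0. Qed.

(** These vectors span the zero-sum hyperplane and turn stationarity into the
    equality of all entries of the gradient. *)
Definition swap_vec i j : 'rV[R]_N := delta_mx ord0 i - delta_mx ord0 j.

Lemma swap_vecE i j k : swap_vec i j ord0 k = (k == i)%:R - (k == j)%:R.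
Proof. by rewrite !mxE. Qed.

Lemma sum_swap_vec (F : 'I_N -> R) i j : \sum_k F k * swap_vec i j ord0 k = F i - F j.
Proof.
under eq_bigr do rewrite swap_vecE mulrBr; rewrite sumrB; congr (_ - _).
  by rewrite (bigD1 i) //= eqxx mulr1 big1 ?addr0 // => k /negPf ->; rewrite mulr0.
by rewrite (bigD1 j) //= eqxx mulr1 big1 ?addr0 // => k /negPf ->; rewrite mulr0.
Qed.

Lemma swap_vec_zero_sum i j : zero_sum (swap_vec i j).
Proof.
have := sum_swap_vec (fun=> 1) i j; rewrite subrr => E.
by rewrite /zero_sum /= -[RHS]E; apply: eq_bigr => k _; rewrite mul1r.
Qed.

Lemma stationary0P x : stationary 0 x <->
  zero_sum x /\ forall i j, x ord0 i ^+ 3 - x ord0 i = x ord0 j ^+ 3 - x ord0 j.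
Proof.
rewrite stationaryE; split=> -[x0 H]; split=> //.
  move=> i j; have := H _ (swap_vec_zero_sum i j).
  by rewrite grad_along0E (sum_swap_vec (fun i => x ord0 i ^+ 3 - x ord0 i)) => /eqP; rewrite subr_eq0 => /eqP.
move=> v v0; rewrite grad_along0E.
case: (pickP (fun i : 'I_N => true)) => [i0 _|no]; last first.
  by rewrite big1 // => i; have := no i.
by under eq_bigr do rewrite (H _ i0); rewrite -mulr_sumr v0 mulr0.
Qed.

Definition count_eq x r : nat := #|[pred i | x ord0 i == r]|.

Lemma sum_indicator (p : pred 'I_N) : \sum_i (p i)%:R = #|[pred i | p i]|%:R :> R.
Proof.
rewrite -sum1_card natr_sum [RHS]big_mkcond /=; apply: eq_bigr => i _.
by rewrite inE; case: (p i).
Qed.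

(** The shape of all uncoupled stationary points. The two equations say, with
    Vieta, that r1, r2, r3 are the roots of a cubic r^3 - r - l. *)
Definition three_valued x r1 r2 r3 : Prop :=
  [/\ r1 < r2, r2 < r3, r1 + r2 + r3 = 0, r1 ^+ 2 + r1 * r3 + r3 ^+ 2 = 1 &
      zero_sum x /\ forall i, [\/ x ord0 i = r1, x ord0 i = r2 | x ord0 i = r3]].

Lemma three_valued_sum x r1 r2 r3 (F : R -> R) : three_valued x r1 r2 r3 ->
  \sum_i F (x ord0 i) =
    (count_eq x r1)%:R * F r1 + (count_eq x r2)%:R * F r2 + (count_eq x r3)%:R * F r3.
Proof.
move=> [r12 r23 _ _ [_ xr]].
rewrite /count_eq -!sum_indicator !mulr_suml -!big_split /=; apply: eq_bigr => i _.
have r13 := lt_trans r12 r23.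
case: (xr i) => ->; rewrite eqxx ?(lt_eqF r12) ?(gt_eqF r12) ?(lt_eqF r23) ?(gt_eqF r23)
  ?(lt_eqF r13) ?(gt_eqF r13) /=; ring.
Qed.

Lemma three_valued_count x r1 r2 r3 : three_valued x r1 r2 r3 ->
  (count_eq x r1 + count_eq x r2 + count_eq x r3)%N = N.
Proof.
move=> /(three_valued_sum (fun=> 1)); rewrite !mulr1 sumr_const card_ord => /esym.
by rewrite -!natrD => /eqP; rewrite eqr_nat => /eqP.
Qed.

Lemma three_valued_balance x r1 r2 r3 : three_valued x r1 r2 r3 ->
  (count_eq x r1)%:R * r1 + (count_eq x r2)%:R * r2 + (count_eq x r3)%:R * r3 = 0.
Proof. by move=> tv; rewrite -(three_valued_sum id tv); case: tv => _ _ _ _ []. Qed.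

(** The cubic r^3 - r takes equal values at distinct a and b: divide by a - b. *)
Lemma cubic_collision (a b : R) : a != b -> a ^+ 3 - a = b ^+ 3 - b -> a ^+ 2 + a * b + b ^+ 2 = 1.
Proof.
move=> ab E; apply: (mulfI (_ : a - b != 0)); first by rewrite subr_eq0.
by apply/eqP; rewrite -subr_eq0; apply/eqP; lra.
Qed.

(** Two different coordinates a, b determine the third root - (a + b) of the
    cubic. A double root would leave only two values in ratio - 2, and the zero
    sum would then force 3 to divide N. At the origin, the roots - 1, 0, 1 of the
    same cubic serve. *)
Lemma three_valued_stationary x : ~~ (3 %| N)%N -> stationary 0 x ->
  exists r1 r2 r3, three_valued x r1 r2 r3.
Proof.
move=> N3 /stationary0P[x0 H].
have N0 : (0 < N)%N by case: (N) N3.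
pose i0 := Ordinal N0; pose a := x ord0 i0.
have [/existsP[j xj]|/existsPn xa] := boolP [exists j, x ord0 j != a]; last first.
  have {}xa j : x ord0 j = a by apply/eqP; rewrite -[_ == _]negbK xa.
  have a0 : a = 0.
    have : N%:R * a = 0 by rewrite -x0 (eq_bigr (fun=> a)) // sumr_const card_ord mulr_natl.
    by move/eqP; rewrite mulf_eq0 pnatr_eq0 (gtn_eqF N0) => /eqP.
  exists (-1), 0, 1; split; [by lra|by lra|by lra|by lra|split=> // j].
  by constructor 2; rewrite xa.
pose b := x ord0 j; pose c := - (a + b).
have ab1 : a ^+ 2 + a * b + b ^+ 2 = 1 by apply: cubic_collision; [rewrite eq_sym|exact: H].
have xabc k : [\/ x ord0 k = a, x ord0 k = b | x ord0 k = c].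
  have : (x ord0 k - a) * ((x ord0 k - b) * (x ord0 k - c)) = 0.
    rewrite (_ : _ * _ = (x ord0 k ^+ 3 - x ord0 k) - (a ^+ 3 - a) +
      (1 - (a ^+ 2 + a * b + b ^+ 2)) * (x ord0 k - a)); last by rewrite /c; ring.
    by rewrite ab1 (H k i0) !subrr mul0r addr0.
  move/eqP; rewrite !mulf_eq0 !subr_eq0 => /or3P[] /eqP ->; [constructor 1|constructor 2|constructor 3] => //.
(* If p is a double root, the other value is - 2 p; dividing the coordinates
   by p leaves summands 1 and - 2 = 1 - 3. *)
have not_double (p q : R) : (forall k, x ord0 k = p \/ x ord0 k = q) -> q = - 2 * p ->
    p ^+ 2 + p * q + q ^+ 2 = 1 -> False.
  move=> xpq qE pq1.
  have p0 : p != 0 by apply/eqP => p0; move: pq1; rewrite qE p0; lra.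
  have : \sum_k x ord0 k / p = 0 by rewrite -mulr_suml x0 mul0r.
  have qp : q / p = -2 by rewrite qE; field.
  have -> : \sum_k x ord0 k / p = \sum_k (1 - 3 * (x ord0 k == q)%:R).
    apply: eq_bigr => k _; case: (xpq k) => ->.
      rewrite divff // (_ : (p == q) = false) ?mulr0 ?subr0 //.
      by apply/eqP => pq; move: p0; rewrite (_ : p = 0) ?eqxx //; lra.
    by rewrite eqxx qp /=; ring.
  rewrite sumrB sumr_const card_ord -mulr_sumr sum_indicator.
  move/eqP; rewrite subr_eq0 -natrM eqr_nat => /eqP E; move: N3; rewrite E dvdn_mulr //.
have ca : c != a.
  apply/eqP => ca; apply: (not_double a b) => //; last by move: ca; rewrite /c; lra.
  by move=> k; case: (xabc k) => ->; [left|right|left].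
have cb : c != b.
  apply/eqP => cb; apply: (not_double b a); [|by move: cb; rewrite /c; lra|by lra].
  by move=> k; case: (xabc k) => ->; [right|left|left].
have sum0 : a + b + c = 0 by rewrite /c; lra.
have key (p q : R) : p < q -> p + q + c = 0 -> p ^+ 2 + p * q + q ^+ 2 = 1 -> c != p -> c != q ->
   (forall k, [\/ x ord0 k = p, x ord0 k = q | x ord0 k = c]) ->
   exists r1 r2 r3, three_valued x r1 r2 r3.
  move=> pq s0 pq1 cp cq xpqc.
  have cE : c = - (p + q) by lra.
  case: (ltgtP c p) cp => // cp _.
    exists c, p, q; split => //; rewrite ?cE; try lra; split=> // k; rewrite -?cE.
    by case: (xpqc k) => ->; [constructor 2|constructor 3|constructor 1].
  case: (ltgtP c q) cq => // cq _.
    exists p, c, q; split => //; rewrite ?cE; try lra; split=> // k; rewrite -?cE.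
    by case: (xpqc k) => ->; [constructor 1|constructor 3|constructor 2].
  exists p, q, c; split => //; rewrite ?cE; try lra; split=> // k; rewrite -?cE.
case: (ltgtP a b) xj => [ab _|ba _|E]; last by [].
  exact: (key a b).
apply: (key b a) => //; [lra|lra|].
by move=> k; case: (xabc k) => ->; [constructor 2|constructor 1|constructor 3].
Qed.

Lemma stationary_three_valued x r1 r2 r3 : three_valued x r1 r2 r3 -> stationary 0 x.
Proof.
move=> [_ _ s0 q1 [x0 xr]]; apply/stationary0P; split=> //.
have E k : x ord0 k ^+ 3 - x ord0 k = r1 ^+ 3 - r1.
  have r2E : r2 = - (r1 + r3) by lra.
  case: (xr k) => -> //.
    rewrite r2E; apply/eqP; rewrite -subr_eq0; apply/eqP.
    rewrite (_ : _ - _ = (r1 + (r1 + r3)) * (1 - (r1 ^+ 2 + r1 * r3 + r3 ^+ 2))); last by ring.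
    by rewrite q1 subrr mulr0.
  apply/eqP; rewrite -subr_eq0; apply/eqP.
  rewrite (_ : _ - _ = (r3 - r1) * (r1 ^+ 2 + r1 * r3 + r3 ^+ 2 - 1)); last by ring.
  by rewrite q1 subrr mulr0.
by move=> i j; rewrite !E.
Qed.

(** Sign of the Hessian form on [middle_vec] for one coordinate at the middle
    root; T is the dimension and p the product of the two excess counts of
    [few_middle]. The left side decreases in p, and at the smallest possible p
    it is a polynomial of T which is negative from T = 8 on. *)
Lemma one_middle_value (T p : R) : 8 <= T -> T - 3 * 1 - 1 <= p ->
  1 * (T - 3 * 1) * (2 * p + T * (T - 3 * 1)) - 3 * (T - 1) ^+ 2 * p < 0.
Proof.
move=> T8 Tp; have [S [S0 TS]] : exists S, 0 <= S /\ T = 8 + S.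
  by exists (T - 8); rewrite subr_ge0 addrC subrK.
have S2 : 0 <= S ^+ 2 by rewrite sqr_ge0.
have S3 : 0 <= S ^+ 3 by rewrite exprn_ge0.
have : 0 <= (p - (T - 4)) * (3 * (T - 1) ^+ 2 - 2 * (T - 3)).
  by apply: mulr_ge0; [lra|rewrite TS; lra].
by rewrite TS; lra.
Qed.

(** The same sign for two coordinates at the middle root. *)
Lemma two_middle_value (T p : R) : 8 <= T -> T - 3 * 2 - 1 <= p ->
  2 * (T - 3 * 2) * (2 * p + T * (T - 3 * 2)) - 3 * (T - 2) ^+ 2 * p < 0.
Proof.
move=> T8 Tp; have [S [S0 TS]] : exists S, 0 <= S /\ T = 8 + S.
  by exists (T - 8); rewrite subr_ge0 addrC subrK.
have S2 : 0 <= S ^+ 2 by rewrite sqr_ge0.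
have S3 : 0 <= S ^+ 3 by rewrite exprn_ge0.
have : 0 <= (p - (T - 7)) * (3 * (T - 2) ^+ 2 - 4 * (T - 6)).
  by apply: mulr_ge0; [lra|rewrite TS; lra].
by rewrite TS; lra.
Qed.

Section Curvature.
Variables (x : 'rV[R]_N) (r1 r2 r3 : R).
Hypothesis tv : three_valued x r1 r2 r3.

Lemma curvature1 : 3 * r1 ^+ 2 - 1 = (r2 - r1) * (r3 - r1).
Proof. by case: tv => _ _ s0 q1 _; rewrite (_ : r2 = - (r1 + r3)); lra. Qed.
Lemma curvature2 : 3 * r2 ^+ 2 - 1 = - ((r2 - r1) * (r3 - r2)).
Proof. by case: tv => _ _ s0 q1 _; rewrite (_ : r2 = - (r1 + r3)); lra. Qed.
Lemma curvature3 : 3 * r3 ^+ 2 - 1 = (r3 - r1) * (r3 - r2).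
Proof. by case: tv => _ _ s0 q1 _; rewrite (_ : r2 = - (r1 + r3)); lra. Qed.

Lemma curvature_signs : [/\ 0 < 3 * r1 ^+ 2 - 1, 3 * r2 ^+ 2 - 1 < 0 & 0 < 3 * r3 ^+ 2 - 1].
Proof.
case: (tv) => r12 r23 _ _ _; have r13 := lt_trans r12 r23.
rewrite curvature1 curvature2 curvature3 oppr_lt0.
by split; rewrite mulr_gt0 ?subr_gt0.
Qed.

Lemma outer_signs : r1 < 0 /\ 0 < r3.
Proof. by case: tv => r12 r23 s0 _ _; split; lra. Qed.

Lemma outer_curvature k : x ord0 k != r2 -> 0 < 3 * x ord0 k ^+ 2 - 1.
Proof.
have [d1 _ d3] := curvature_signs.
by case: (tv) => _ _ _ _ [_ /(_ k)] [] -> //; rewrite eqxx.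
Qed.

(** The zero-sum direction that separates the coordinates at the middle root
    from all others; it is a direction of descent as long as there are at most
    two such coordinates. *)
Definition middle_vec : 'rV[R]_N :=
  \row_i (if x ord0 i == r2 then (N - count_eq x r2)%:R else - (count_eq x r2)%:R).

Lemma middle_vec_zero_sum : zero_sum middle_vec.
Proof.
rewrite /zero_sum /=.
pose F r : R := if r == r2 then (N - count_eq x r2)%:R else - (count_eq x r2)%:R.
have -> : \sum_(i < N) middle_vec ord0 i = \sum_i F (x ord0 i).
  by apply: eq_bigr => i _; rewrite mxE.
rewrite (three_valued_sum _ tv) /F eqxx.
case: (tv) => r12 r23 _ _ _; rewrite (lt_eqF r12) (gt_eqF r23).
have := three_valued_count tv.
set n1 := count_eq x r1; set m := count_eq x r2; set n3 := count_eq x r3 => nE.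
have -> : (N - m = n1 + n3)%N by lia.
rewrite natrD; ring.
Qed.

Lemma middle_vec_form :
  let m := (count_eq x r2)%:R in
  hess_form 0 x middle_vec middle_vec =
    m * ((N%:R - m) ^+ 2 * (3 * r2 ^+ 2 - 1) +
      m * ((count_eq x r1)%:R * (3 * r1 ^+ 2 - 1) + (count_eq x r3)%:R * (3 * r3 ^+ 2 - 1))).
Proof.
rewrite hess_form0E /=.
pose F r : R := (3 * r ^+ 2 - 1) *
  (if r == r2 then (N - count_eq x r2)%:R else - (count_eq x r2)%:R) ^+ 2.
rewrite (eq_bigr (fun i => F (x ord0 i))); last by move=> i _; rewrite mxE -mulrA -expr2.
rewrite (three_valued_sum _ tv) /F eqxx.
case: (tv) => r12 r23 _ _ _; rewrite (lt_eqF r12) (gt_eqF r23).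
rewrite natrB; first by ring.
by rewrite -(three_valued_count tv) addnAC leq_addl.
Qed.

(** Let n1, m, n3 be the numbers of coordinates equal to r1, r2, r3. The zero
    sum makes the outer roots proportional to n3 - m and n1 - m, with opposite
    signs. With b1 = 3 n1 - N and b3 = 3 n3 - N, the gaps r3 - r2, r2 - r1 and
    r3 - r1 are then proportional to b1, b3 and b1 + b3 = N - 3 m, and so are
    their products, the curvatures. As b1 and b3 are positive integers, their
    product is at least N - 3 m - 1, which makes the form negative. *)
Lemma few_middle : (8 <= N)%N -> (1 <= count_eq x r2 <= 2)%N ->
  [/\ (N < 3 * count_eq x r1)%N, (N < 3 * count_eq x r3)%N & hess_form 0 x middle_vec middle_vec < 0].
Proof.
move=> N8 m12; rewrite middle_vec_form /=.
have := three_valued_count tv; have := three_valued_balance tv.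
have d1 := curvature1; have d2 := curvature2; have d3 := curvature3.
set n1 := count_eq x r1; set m := count_eq x r2 in m12 *; set n3 := count_eq x r3 => bal nE.
have [r1n r3p] := outer_signs.
case: (tv) => r12 r23 s0 _ _.
have bal' : (n3%:R - m%:R) * r3 = (n1%:R - m%:R) * (- r1) :> R.
  by move: bal; rewrite (_ : r2 = - (r1 + r3)); lra.
have n1m : (m < n1)%N.
  rewrite ltnNge; apply/negP => n1m.
  have : (n3%:R - m%:R) * r3 <= 0 by rewrite bal' mulr_le0_ge0 ?subr_le0 ?ler_nat ?oppr_ge0 ?(ltW r1n).
  rewrite pmulr_lle0 // subr_le0 ler_nat; lia.
have n1mR : 0 < n1%:R - m%:R :> R by rewrite subr_gt0 ltr_nat.
have [c c0 r3E] : exists2 c : R, 0 < c & r3 = c * (n1%:R - m%:R).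
  by exists (r3 / (n1%:R - m%:R)); [rewrite divr_gt0|field; rewrite gt_eqF].
have r1E : r1 = - c * (n3%:R - m%:R).
  apply: (mulfI (_ : n1%:R - m%:R != 0)); first by rewrite gt_eqF.
  by apply: oppr_inj; rewrite -mulrN -bal' r3E; ring.
have r2E : r2 = c * (n3%:R - n1%:R).
  by rewrite (_ : r2 = - r1 - r3); [rewrite r1E r3E; ring|lra].
have NE : N%:R = n1%:R + m%:R + n3%:R :> R by rewrite -nE !natrD.
have e1 : r2 - r1 = c * (3 * n3%:R - N%:R) by rewrite r2E r1E NE; ring.
have e3 : r3 - r2 = c * (3 * n1%:R - N%:R) by rewrite r2E r3E NE; ring.
have e13 : r3 - r1 = c * (N%:R - 3 * m%:R) by rewrite r1E r3E NE; ring.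
have b3 : 0 < 3 * n3%:R - N%:R :> R by rewrite -(pmulr_rgt0 _ c0) -e1 subr_gt0.
have b1 : 0 < 3 * n1%:R - N%:R :> R by rewrite -(pmulr_rgt0 _ c0) -e3 subr_gt0.
have b1N : (N < 3 * n1)%N by rewrite -(ltr_nat R) natrM -subr_gt0.
have b3N : (N < 3 * n3)%N by rewrite -(ltr_nat R) natrM -subr_gt0.
split=> //.
have m0 : 0 < m%:R :> R by rewrite ltr0n; case/andP: m12.
rewrite pmulr_rlt0 // d1 d2 d3 e1 e3 e13.
have b1' : 1 <= 3 * n1%:R - N%:R :> R by rewrite lerBrDr nat1r -natrM ler_nat.
have b3' : 1 <= 3 * n3%:R - N%:R :> R by rewrite lerBrDr nat1r -natrM ler_nat.
have [b1v b1vE] : exists b1v : R, b1v = 3 * n1%:R - N%:R by eexists.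
have [b3v b3vE] : exists b3v : R, b3v = 3 * n3%:R - N%:R by eexists.
rewrite -b1vE -b3vE in b1' b3' *.
have -> : n1%:R = (b1v + N%:R) / 3 :> R by rewrite b1vE; field.
have -> : n3%:R = (b3v + N%:R) / 3 :> R by rewrite b3vE; field.
have bs : b1v + b3v = N%:R - 3 * m%:R by rewrite b1vE b3vE NE; ring.
have [T TE] : exists T : R, T = N%:R by eexists.
have T8 : 8 <= T by rewrite TE ler_nat.
rewrite -TE in bs *.
have -> : (T - m%:R) ^+ 2 * - (c * b3v * (c * b1v)) + m%:R *
   ((b1v + T) / 3 * (c * b3v * (c * (T - 3 * m%:R))) + (b3v + T) / 3 * (c * (T - 3 * m%:R) * (c * b1v)))
  = c ^+ 2 / 3 * (m%:R * (T - 3 * m%:R) * (2 * (b1v * b3v) + T * (b1v + b3v)) - 3 * (T - m%:R) ^+ 2 * (b1v * b3v)).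
  by field.
rewrite pmulr_rlt0 ?divr_gt0 ?exprn_gt0 // bs.
have [p pE] : exists p : R, p = b1v * b3v by eexists.
have pge : b1v + b3v - 1 <= p by rewrite pE; nra.
rewrite -pE; rewrite bs in pge.
have [mE|mE] : m = 1%N \/ m = 2%N.
  by move: m12; case: (m) => [|[|[|]]] // _; [left|right].
  by rewrite mE; apply: (one_middle_value T8); rewrite mE in pge.
by rewrite mE; apply: (two_middle_value T8); rewrite mE in pge.
Qed.

End Curvature.
End UncoupledStationary.

(** * The index counts the coordinates at the middle root *)

Section Index.
Variables (R : realType) (N : nat).
Implicit Types (x v u : 'rV[R]_N) (i j : 'I_N) (g : R).

Lemma morse_index_neg g x : morse_index g x = neg_index (restricted_hessian g x).
Proof. by []. Qed.

Lemma restricted_mxform g x u v :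
  mxform (restricted_hessian g x) u v = hess_form g x (recenter u) (recenter v).
Proof. exact: restricted_form. Qed.

Lemma morse_index0P g x :
  morse_index g x = 0%N <-> forall v, zero_sum v -> 0 <= hess_form g x v v.
Proof.
rewrite morse_index_neg (neg_index0P (restricted_hessian_sym g x)); split=> H v.
  by move=> v0; have := H v; rewrite restricted_mxform recenter_id.
by rewrite restricted_mxform H //; exact: recenter_zero_sum.
Qed.

Lemma hess_form_comb g x u v (a b : R) :
  hess_form g x (a *: u + b *: v) (a *: u + b *: v) =
  a ^+ 2 * hess_form g x u u + 2 * a * b * hess_form g x u v + b ^+ 2 * hess_form g x v v.
Proof.
rewrite hess_formDl !hess_formZl ![hess_form g x _ (_ + _)]hess_formC !hess_formDl !hess_formZl.
rewrite [hess_form g x v u]hess_formC; ring.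
Qed.

(** A symmetric form with negative diagonal entries and positive determinant on
    a plane is negative definite there, which is too much for index one. *)
Lemma morse_index1_elim g x u v : morse_index g x = 1%N -> zero_sum u -> zero_sum v ->
  hess_form g x u v = 0 \/ hess_form g x u v ^+ 2 < hess_form g x u u * hess_form g x v v ->
  hess_form g x u u < 0 -> hess_form g x v v < 0 -> False.
Proof.
move=> I1 u0 v0 uv uu vv; apply: (neg_index1_elim (restricted_hessian_sym g x) I1 (u := u) (v := v)).
move=> a b ab; rewrite restricted_mxform /recenter mulmxDl -!scalemxAl.
rewrite -!/(recenter _) !recenter_id // hess_form_comb.
move: uv uu vv; set p := hess_form g x u u; set q := hess_form g x u v; set r := hess_form g x v v.
move=> uv p0 r0.
have qpr : q ^+ 2 < p * r by case: uv => // ->; rewrite expr0n nmulr_rgt0.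
rewrite -(nmulr_rgt0 _ p0).
have -> : p * (a ^+ 2 * p + 2 * a * b * q + b ^+ 2 * r) =
  (a * p + b * q) ^+ 2 + b ^+ 2 * (p * r - q ^+ 2) by ring.
have [b0|b0] := eqVneq b 0.
  move: ab; rewrite b0 eqxx orbF => a0.
  by rewrite mul0r addr0 expr0n mul0r addr0 exprn_even_gt0 //= mulf_neq0 // lt_eqF.
by rewrite ltr_wpDl ?sqr_ge0 // mulr_gt0 ?exprn_even_gt0 ?subr_gt0.
Qed.

Lemma swap_vec_form x i j k : i != j -> i != k ->
  hess_form 0 x (swap_vec R i j) (swap_vec R i k) =
   (3 * x ord0 i ^+ 2 - 1) + (j == k)%:R * (3 * x ord0 j ^+ 2 - 1).
Proof.
move=> ij ik; rewrite hess_form0E.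
rewrite (eq_bigr (fun l => ((3 * x ord0 l ^+ 2 - 1) * swap_vec R i j ord0 l) * swap_vec R i k ord0 l)) //.
rewrite (sum_swap_vec (fun l => (3 * x ord0 l ^+ 2 - 1) * swap_vec R i j ord0 l)).
rewrite !swap_vecE eqxx (negPf ij) (eq_sym k i) (negPf ik) (eq_sym k j).
by have [->|_] := eqVneq j k; rewrite /=; ring.
Qed.

Lemma count_gt1 (p : pred 'I_N) : (1 < #|[pred i | p i]|)%N -> exists i j, [/\ p i, p j & i != j].
Proof.
move/card_gt1P => [i [j [pi pj ij]]]; exists i, j.
by move: pi pj; rewrite !inE.
Qed.

Lemma count_gt2 (p : pred 'I_N) : (2 < #|[pred i | p i]|)%N ->
  exists i j k, [/\ p i, p j & p k] /\ [/\ i != j, i != k & j != k].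
Proof.
move/card_gt2P => [i [j [k [[pi pj pk] [ij jk ki]]]]]; exists i, j, k.
by move: pi pj pk; rewrite !inE eq_sym in ki *.
Qed.

Section ThreeValued.
Variables (x : 'rV[R]_N) (r1 r2 r3 : R).
Hypothesis (tv : three_valued x r1 r2 r3).

(** All curvatures at the outer roots are positive. Two coordinates at the
    middle root give a descent direction that raises one and lowers the other; a
    single one gives a descent direction by [few_middle]. *)
Lemma index0_middle : (8 <= N)%N -> morse_index 0 x = 0%N <-> count_eq x r2 = 0%N.
Proof.
move=> N8; rewrite morse_index0P; split=> H; last first.
  move=> v _; rewrite hess_form0E sumr_ge0 // => i _; rewrite -mulrA -expr2 mulr_ge0 ?sqr_ge0 //.
  apply/ltW/(outer_curvature tv).
  by have := card0_eq H i; rewrite !inE => ->.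
have [_ d2 _] := curvature_signs tv.
have [//|/count_gt1[i [j [/eqP xi /eqP xj ij]]]|m1] := ltngtP (count_eq x r2) 1.
- by case: (count_eq x r2).
- have := H _ (swap_vec_zero_sum R i j).
  rewrite swap_vec_form // eqxx xi xj /= mul1r => h; exfalso; lra.
have m12 : (1 <= count_eq x r2 <= 2)%N by rewrite m1.
have [_ _] := few_middle tv N8 m12.
by rewrite ltNge H //; exact: (middle_vec_zero_sum tv).
Qed.

(** With two coordinates at the middle root, the direction exchanging them and
    [middle_vec] span a negative plane; with three, two exchange directions do.
    With one, the form is nonnegative on the vectors that do not move it. *)
Lemma index1_middle : (8 <= N)%N -> morse_index 0 x = 1%N <-> count_eq x r2 = 1%N.
Proof.
move=> N8; have [_ d2 _] := curvature_signs tv; split=> [I1|m1].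
  have := leqnn (count_eq x r2); case mE: {2}(count_eq x r2) => [|[|[|m]]] _ //.
  - by move/(index0_middle N8): mE; rewrite I1.
  - have m12 : (1 <= count_eq x r2 <= 2)%N by rewrite mE.
    have [_ _ uu] := few_middle tv N8 m12.
    have /count_gt1[i [j [/eqP xi /eqP xj ij]]] : (1 < count_eq x r2)%N by rewrite mE.
    exfalso; apply: (morse_index1_elim I1 (middle_vec_zero_sum tv) (swap_vec_zero_sum R i j)).
    + left; rewrite hess_form0E.
      rewrite (sum_swap_vec (fun l => (3 * x ord0 l ^+ 2 - 1) * middle_vec x r2 ord0 l)).
      by rewrite !mxE xi xj eqxx subrr.
    + exact: uu.
    + by rewrite swap_vec_form // eqxx xi xj /= mul1r; lra.
  - have /count_gt2[i [j [k [[/eqP xi /eqP xj /eqP xk] [ij ik jk]]]]] : (2 < count_eq x r2)%N by rewrite mE.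
    exfalso; apply: (morse_index1_elim I1 (swap_vec_zero_sum R i j) (swap_vec_zero_sum R i k)).
    + by right; rewrite !swap_vec_form // !eqxx (negPf jk) xi xj xk /= mul1r mul0r; nra.
    + by rewrite swap_vec_form // eqxx xi xj /= mul1r; lra.
    + by rewrite swap_vec_form // eqxx xi xk /= mul1r; lra.
have m12 : (1 <= count_eq x r2 <= 2)%N by rewrite m1.
have [_ _ uu] := few_middle tv N8 m12.
have /card_gt0P[i0] : (0 < count_eq x r2)%N by rewrite m1.
rewrite inE => /eqP xi0.
rewrite morse_index_neg.
apply: (@neg_index1_intro _ _ _ (middle_vec x r2) (zero_sum_proj R N *m delta_mx i0 ord0)).
- exact: restricted_hessian_sym.
- by rewrite restricted_mxform recenter_id ?uu //; exact: (middle_vec_zero_sum tv).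
move=> u; rewrite mulmxA -colE => /matrixP/(_ ord0 ord0); rewrite mxE [RHS]mxE => ui0.
rewrite restricted_mxform hess_form0E sumr_ge0 // => i _; rewrite -mulrA -expr2.
have [xi|xi] := eqVneq (x ord0 i) r2; last by rewrite mulr_ge0 ?sqr_ge0 // ltW // (outer_curvature tv).
have -> : i = i0.
  apply/eqP; apply: contraTT isT => ii0.
  suff : (1 < count_eq x r2)%N by rewrite m1.
  by apply/card_gt1P; exists i, i0; rewrite !inE xi xi0.
by rewrite /recenter ui0 expr0n mulr0.
Qed.

End ThreeValued.

End Index.

(** * Local minima and sign patterns *)

Section Minima.
Variables (R : realType) (N : nat).
Implicit Types (x : 'rV[R]_N) (P : {set 'I_N}).

(** The patterns P for which both |P| and its complement exceed a third of N:
    exactly these carry a local minimum. *)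
Definition balanced P := (N < 3 * #|P| < 2 * N)%N.

Definition pattern_norm (p q : R) : R := Num.sqrt (p ^+ 2 - p * q + q ^+ 2).

Lemma pattern_norm_gt0 (p q : R) : 0 < p -> 0 < pattern_norm p q.
Proof.
move=> p0; rewrite sqrtr_gt0.
by have := sqr_ge0 (p / 2 - q); have : 0 < p ^+ 2 by [exact: exprn_gt0]; lra.
Qed.

Lemma pattern_norm_sqr (p q : R) : pattern_norm p q ^+ 2 = p ^+ 2 - p * q + q ^+ 2.
Proof.
rewrite sqr_sqrtr //.
by have := sqr_ge0 (p / 2 - q); have := sqr_ge0 p; lra.
Qed.

(** The local minimum with positive coordinates on P. The values q / s and - p / s
    have zero sum, and s normalises them to roots of a common cubic. *)
Definition two_well P : 'rV[R]_N :=
  let p := #|P|%:R in let q := #|~: P|%:R in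
  \row_i ((if i \in P then q else - p) / pattern_norm p q).

Lemma card_compl P : (#|P| + #|~: P| = N)%N.
Proof. by rewrite cardsC card_ord. Qed.

Lemma balanced_card P : balanced P ->
  [/\ 0 < #|P|, 0 < #|~: P|, #|P| < 2 * #|~: P| & #|~: P| < 2 * #|P|]%N.
Proof. by rewrite /balanced; have := card_compl P => h1 h2; split; lia. Qed.

Lemma two_well_three_valued P : balanced P ->
  let p := #|P|%:R in let q := #|~: P|%:R in let s := pattern_norm p q in
  [/\ three_valued (two_well P) (- p / s) ((p - q) / s) (q / s),
      count_eq (two_well P) (- p / s) = #|~: P|,
      count_eq (two_well P) ((p - q) / s) = 0%N &
      count_eq (two_well P) (q / s) = #|P|].
Proof.
move=> bP p q s; have [np nq npq nqp] := balanced_card bP.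
have p0 : 0 < p by rewrite ltr0n.
have q0 : 0 < q by rewrite ltr0n.
have pq : p < 2 * q by rewrite -natrM ltr_nat.
have qp : q < 2 * p by rewrite -natrM ltr_nat.
have s0 : 0 < s by exact: pattern_norm_gt0.
have s2 : s ^+ 2 = p ^+ 2 - p * q + q ^+ 2 by exact: pattern_norm_sqr.
have r12 : - p / s < (p - q) / s by rewrite ltr_pM2r ?invr_gt0 //; lra.
have r23 : (p - q) / s < q / s by rewrite ltr_pM2r ?invr_gt0 //; lra.
have r13 := lt_trans r12 r23.
have xE i : two_well P ord0 i = if i \in P then q / s else - p / s.
  by rewrite mxE -/p -/q -/s; case: ifP.
have c3 : count_eq (two_well P) (q / s) = #|P|.
  apply: eq_card => i; rewrite !inE xE; case: ifP => _; first by rewrite eqxx.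
  by rewrite lt_eqF.
have c1 : count_eq (two_well P) (- p / s) = #|~: P|.
  apply: eq_card => i; rewrite !inE xE; case: ifP => _; last by rewrite eqxx.
  by rewrite gt_eqF.
have c2 : count_eq (two_well P) ((p - q) / s) = 0%N.
  apply: eq_card0 => i; rewrite !inE xE; case: ifP => _; first by rewrite gt_eqF.
  by rewrite lt_eqF.
split => //; split => //.
- by field; rewrite gt_eqF.
- rewrite (_ : _ + _ = (p ^+ 2 - p * q + q ^+ 2) / s ^+ 2); last by field; rewrite gt_eqF.
  by rewrite -s2 divff // expf_neq0 // gt_eqF.
- split; last by move=> i; rewrite xE; case: ifP => _; [constructor 3|constructor 1].
  rewrite /zero_sum /= (eq_bigr (fun i => (i \in P)%:R * (q / s) + (i \in ~: P)%:R * (- p / s))).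
    rewrite big_split /= -!mulr_suml !(@sum_indicator R).
    rewrite (_ : #|[pred i | i \in P]| = #|P|); last by apply: eq_card => i; rewrite !inE.
    rewrite (_ : #|[pred i | i \in ~: P]| = #|~: P|); last by apply: eq_card => i; rewrite !inE.
    by rewrite -/p -/q; field; rewrite gt_eqF.
  by move=> i _; rewrite xE inE; case: ifP => _; rewrite /= ?mul1r ?mul0r ?addr0 ?add0r.
Qed.

Lemma two_well_zero_sum P : balanced P -> zero_sum (two_well P).
Proof. by move=> /two_well_three_valued [[_ _ _ _ []]]. Qed.

(** Without coordinates at the middle root, the zero sum fixes the ratio of the
    outer roots and the cubic fixes their size. That the middle root lies between
    the outer ones says that the pattern is balanced. *)
Lemma three_valued_two_well x r1 r2 r3 : (0 < N)%N -> three_valued x r1 r2 r3 -> count_eq x r2 = 0%N ->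
  let P := [set i | x ord0 i == r3]%SET in balanced P /\ x = two_well P.
Proof.
move=> N0 tv c2 P; have pqN := card_compl P.
have [r1n r3p] := outer_signs tv.
have xi i : x ord0 i = if i \in P then r3 else r1.
  rewrite inE; case: ifP => [/eqP//|/eqP xi3].
  have := card0_eq c2 i; rewrite !inE => /eqP xi2.
  by case: tv => _ _ _ _ [_ /(_ i)] [].
have c3 : count_eq x r3 = #|P| by apply: eq_card => i; rewrite !inE.
have cN := three_valued_count tv.
have c1 : count_eq x r1 = #|~: P|.
  by move: cN; rewrite c2 c3 -[in RHS]pqN addn0 addnC => /addnI.
have := three_valued_balance tv; rewrite c1 c2 c3 mul0r addr0.
case: (tv) => r12 r23 s0 q1 [x0 _].
set p := #|P|%:R; set q := #|~: P|%:R => bal.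
have p0 : 0 < p.
  rewrite lt0r pnatr_eq0 ler0n andbT; apply/eqP => P0.
  have : q * r1 = 0 by rewrite -bal /p P0 mul0r addr0.
  move/eqP; rewrite mulf_eq0 (lt_eqF r1n) orbF pnatr_eq0; lia.
have q0 : 0 < q.
  rewrite lt0r pnatr_eq0 ler0n andbT; apply/eqP => Q0.
  have : p * r3 = 0 by rewrite -bal /q Q0 mul0r add0r.
  move/eqP; rewrite mulf_eq0 (gt_eqF r3p) orbF pnatr_eq0; lia.
have r1E : r1 = - p * (r3 / q).
  apply: (mulfI (lt0r_neq0 q0)); apply/eqP; rewrite -subr_eq0; apply/eqP; rewrite -bal; field.
  exact: lt0r_neq0.
have r3E : r3 = q * (r3 / q) by field; exact: lt0r_neq0.
have [c cE] : exists c, c = r3 / q by eexists.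
have c0 : 0 < c by rewrite cE divr_gt0.
rewrite -cE in r1E r3E.
have sc : c = (pattern_norm p q)^-1.
  have n0 := pattern_norm_gt0 q p0.
  apply: (mulIf (lt0r_neq0 n0)); rewrite mulVf ?lt0r_neq0 //.
  apply/eqP; rewrite -(@eqrXn2 _ 2) ?mulr_ge0 ?ltW // exprMn pattern_norm_sqr expr1n.
  by apply/eqP; rewrite -q1 r1E r3E; ring.
split; last by apply/rowP => i; rewrite mxE xi -/p -/q -sc; case: ifP => _; rewrite ?r3E ?r1E; ring.
have : q < 2 * p.
  rewrite -(ltr_pM2r c0); move: r12; rewrite (_ : r2 = - (r1 + r3)); last by lra.
  by rewrite r1E r3E; lra.
have : p < 2 * q.
  rewrite -(ltr_pM2r c0); move: r23; rewrite (_ : r2 = - (r1 + r3)); last by lra.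
  by rewrite r1E r3E; lra.
rewrite -!natrM !ltr_nat /balanced; move: #|P| #|~: P| pqN => a b;
lia.
Qed.

(** At a root r of the cubic with constant term l, r^4 = r^2 + l r, and the terms
    linear in r add up to zero. *)
Lemma three_valued_energy x r1 r2 r3 : three_valued x r1 r2 r3 ->
  potential 0 x = - 4^-1 * ((count_eq x r1)%:R * r1 ^+ 2 + (count_eq x r2)%:R * r2 ^+ 2
    + (count_eq x r3)%:R * r3 ^+ 2).
Proof.
move=> tv; rewrite potential0E (three_valued_sum _ tv).
have := three_valued_balance tv; case: (tv) => _ _ s0 q1 _ bal.
have r2E : r2 = - (r1 + r3) by lra.
have E (r : R) : r ^+ 3 = r + (r1 ^+ 3 - r1) -> well r = - 4^-1 * r ^+ 2 + (r1 ^+ 3 - r1) / 4 * r.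
  by rewrite /well => E; rewrite exprS E; field.
have E3 : r3 ^+ 3 = r3 + (r1 ^+ 3 - r1).
  apply/eqP; rewrite -subr_eq0; apply/eqP.
  rewrite (_ : _ - _ = (r3 - r1) * (r1 ^+ 2 + r1 * r3 + r3 ^+ 2 - 1)); last by ring.
  by rewrite q1 subrr mulr0.
have E2 : r2 ^+ 3 = r2 + (r1 ^+ 3 - r1).
  apply/eqP; rewrite -subr_eq0 r2E; apply/eqP.
  rewrite (_ : _ - _ = (- (r1 + r3) - r1) * (r1 ^+ 2 + r1 * r3 + r3 ^+ 2 - 1)); last by ring.
  by rewrite q1 subrr mulr0.
have E1 : r1 ^+ 3 = r1 + (r1 ^+ 3 - r1) by rewrite addrC subrK.
rewrite !E //.
rewrite [LHS](_ : _ = - 4^-1 * ((count_eq x r1)%:R * r1 ^+ 2 + (count_eq x r2)%:R * r2 ^+ 2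
    + (count_eq x r3)%:R * r3 ^+ 2) + (r1 ^+ 3 - r1) / 4 * ((count_eq x r1)%:R * r1 + (count_eq x r2)%:R * r2
    + (count_eq x r3)%:R * r3)); last by field.
by rewrite bal mulr0 addr0.
Qed.

Lemma two_well_energy P : balanced P ->
  potential 0 (two_well P) = - 4^-1 * (N%:R * (#|P|%:R * #|~: P|%:R)
    / (#|P|%:R ^+ 2 - #|P|%:R * #|~: P|%:R + #|~: P|%:R ^+ 2)).
Proof.
move=> bP; have [tv c1 c2 c3] := two_well_three_valued bP.
rewrite (three_valued_energy tv) c1 c2 c3 mul0r addr0.
have [P0 _ _ _] := balanced_card bP.
have p0 : 0 < #|P|%:R :> R by rewrite ltr0n.
have -> : N%:R = #|P|%:R + #|~: P|%:R :> R by rewrite -natrD card_compl.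
set p := #|P|%:R in p0 *; set q := #|~: P|%:R.
have n0 := pattern_norm_gt0 q p0.
rewrite -pattern_norm_sqr; field.
exact: lt0r_neq0.
Qed.

(** Three distinct real roots make the discriminant 4 - 27 l^2 positive, which
    is the bound on l required of a triple. *)
Lemma three_valued_triple x r1 r2 r3 a1 a2 : three_valued x r1 r2 r3 ->
  (count_eq x r2 <= a1 <= a2)%N ->
  (count_eq x r1 = a1 /\ count_eq x r3 = a2) \/ (count_eq x r1 = a2 /\ count_eq x r3 = a1) ->
  has_triple x (count_eq x r2) a1 a2.
Proof.
move=> tv le cE; case: (tv) => r12 r23 s0 q1 [_ xr]; have r13 := lt_trans r12 r23.
have r2E : r2 = - (r1 + r3) by lra.
pose l := r1 ^+ 3 - r1.
have rt1 : root ('X^3 - 'X - l%:P) r1 by rewrite rootE !hornerE subrr.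
have rt2 : root ('X^3 - 'X - l%:P) r2.
  rewrite rootE !hornerE; apply/eqP; rewrite r2E /l.
  rewrite (_ : _ - _ = (- (r1 + r3) - r1) * (r1 ^+ 2 + r1 * r3 + r3 ^+ 2 - 1)); last by ring.
  by rewrite q1 subrr mulr0.
have rt3 : root ('X^3 - 'X - l%:P) r3.
  rewrite rootE !hornerE; apply/eqP; rewrite /l.
  rewrite (_ : _ - _ = (r3 - r1) * (r1 ^+ 2 + r1 * r3 + r3 ^+ 2 - 1)); last by ring.
  by rewrite q1 subrr mulr0.
have ll : `|l| < 2 / (3 * Num.sqrt 3).
  have s3 : 0 < Num.sqrt 3 :> R by rewrite sqrtr_gt0.
  rewrite -(@ltr_pXn2r _ 2) ?nnegrE ?divr_ge0 ?mulr_ge0 ?(ltW s3) //.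
  rewrite real_normK ?num_real // expr_div_n exprMn sqr_sqrtr ?ler0n //.
  have : 0 < ((r2 - r1) * (r3 - r2) * (r3 - r1)) ^+ 2.
    by rewrite exprn_gt0 // !mulr_gt0 // subr_gt0.
  rewrite (_ : (_ * _) ^+ 2 = 4 - 27 * l ^+ 2); first by lra.
  have c1 := curvature1 tv; have c2 := curvature2 tv; have c3 := curvature3 tv.
  have -> : ((r2 - r1) * (r3 - r2) * (r3 - r1)) ^+ 2 =
    - (((r2 - r1) * (r3 - r1)) * (- ((r2 - r1) * (r3 - r2))) * ((r3 - r1) * (r3 - r2))) by ring.
  rewrite -c1 -c2 -c3.
  have [s sE] : exists s, s = r1 * r3 by eexists.
  have lE : l = - s * (r1 + r3).
    rewrite /l sE; apply/eqP; rewrite -subr_eq0; apply/eqP.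
    rewrite (_ : _ - _ = r1 * (r1 ^+ 2 + r1 * r3 + r3 ^+ 2 - 1)); last by ring.
    by rewrite q1 subrr mulr0.
  have -> : l ^+ 2 = s ^+ 2 * (1 + s).
    by rewrite lE exprMn sqrrN; congr (_ * _); rewrite sE; lra.
  have -> : 3 * r2 ^+ 2 - 1 = 3 * s + 2 by rewrite r2E sE; lra.
  rewrite mulrAC (_ : (3 * r1 ^+ 2 - 1) * (3 * r3 ^+ 2 - 1) = 9 * s ^+ 2 + 3 * s - 2); first by ring.
  have rr : r1 ^+ 2 + r3 ^+ 2 = 1 - s by rewrite sE; lra.
  rewrite (_ : _ * _ = 9 * (r1 * r3) ^+ 2 - 3 * (r1 ^+ 2 + r3 ^+ 2) + 1); last by ring.
  by rewrite rr -sE; ring.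
rewrite /has_triple; exists l; exists r2.
case: cE => -[c1 c3]; [exists r1, r3|exists r3, r1]; split=> //.
- by rewrite /= !inE (gt_eqF r12) (lt_eqF r23) (lt_eqF r13) rt1 rt2 rt3.
- by move=> i; rewrite !inE; case: (xr i) => ->; rewrite eqxx ?orbT.
- by rewrite /= !inE (gt_eqF r12) (lt_eqF r23) (gt_eqF r13) rt1 rt2 rt3.
- by move=> i; rewrite !inE; case: (xr i) => ->; rewrite eqxx ?orbT.
Qed.

End Minima.

(** * Energies of minima and saddles *)

Ltac nonneg_poly := repeat match goal with
  | |- _ => assumption
  | |- is_true (0 <= _ + _) => apply: addr_ge0
  | |- is_true (0 <= _ * _) => apply: mulr_ge0
  | |- is_true (0 <= _ ^+ _) => apply: exprn_ge0
  | |- is_true (0 <= _%:R) => exact: ler0n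
  end.

Section Families.
Variables (R : realType) (N M : nat).
Hypotheses (NM : N = (2 * M)%N) (N8 : (8 <= N)%N) (N3 : ~~ (3 %| N)%N).
Implicit Types (x : 'rV[R]_N) (P : {set 'I_N}) (k : nat).

(** A pattern and its complement belong to the same class, because the potential
    is invariant under x |-> - x. *)
Definition size_class k P := (#|P| == M + k)%N || (#|P| + k == M)%N.

Lemma kmax_lt k : (k <= N %/ 6)%N = (3 * k < M)%N.
Proof. by have := N3; have := N8; rewrite NM; lia. Qed.

Lemma M_ge4n : (4 <= M)%N.
Proof using NM N8. by have := N8; rewrite NM; clear; lia. Qed.

Lemma size_class_balanced k P : (k <= N %/ 6)%N -> size_class k P -> balanced P.
Proof.
rewrite /size_class /balanced; move: #|P| => p; have := N8; have := N3; rewrite NM; lia.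
Qed.

Lemma balanced_size_class P : balanced P -> exists2 k, (k <= N %/ 6)%N & size_class k P.
Proof.
rewrite /size_class /balanced; move: #|P| => p; have := N8; rewrite NM => m8 h.
have [pM|pM] := leqP M p.
  by exists (p - M)%N; lia.
by exists (M - p)%N; lia.
Qed.

Lemma size_class_inj k l P : size_class k P -> size_class l P -> k = l.
Proof. rewrite /size_class; move: #|P| => p; clear; lia. Qed.

Lemma N_gt0 : (0 < N)%N. Proof using N8. exact: leq_trans N8. Qed.

Lemma local_minimum0P x : local_minimum 0 x <-> exists2 P, balanced P & x = two_well R P.
Proof.
split=> [[st i0]|[P bP ->]].
  have [r1 [r2 [r3 tv]]] := three_valued_stationary N3 st.
  have /(index0_middle tv N8) c2 := i0.
  by have [bP xE] := three_valued_two_well N_gt0 tv c2; eexists; [exact: bP|].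
have [tv _ c2 _] := two_well_three_valued R bP.
split; first exact: stationary_three_valued tv.
exact/(index0_middle tv N8).
Qed.

Lemma B0P k x : (k <= N %/ 6)%N ->
  B0 M k x <-> exists2 P, size_class k P & x = two_well R P.
Proof.
move=> kN; split=> [[/local_minimum0P[P bP xE] tr]|[P cP ->]].
  exists P => //.
  case: tr => l [a0 [a1 [a2 [_ [ua _] xin [c0 c1 c2] _]]]].
  have [p0 q0 _ _] := balanced_card bP.
  have [tv _ _ cP] := two_well_three_valued R bP.
  set s := pattern_norm _ _ in tv cP.
  have [i iP] := card_gt0P p0.
  have xi : x ord0 i = #|~: P|%:R / s by rewrite xE mxE iP.
  rewrite -xE in cP; rewrite /size_class -cP.
  have := xin i; rewrite xi !inE => /or3P[] /eqP E.
  - by have := card0_eq c0 i; rewrite !inE xi E eqxx.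
  - rewrite /count_eq E c1; move: kN N8; rewrite NM; lia.
  - by rewrite /count_eq E c2 eqxx.
have bP := size_class_balanced kN cP.
split; first by apply/local_minimum0P; exists P.
have [tv c1 c2 c3] := two_well_three_valued R bP.
rewrite -[in has_triple _ 0]c2; apply: (three_valued_triple tv); rewrite ?c2 ?c1 ?c3.
  by move: kN N8; rewrite NM; lia.
have := card_compl P; move: cP kN N8; rewrite /size_class; move: #|P| #|~: P| => p q.
by rewrite NM; lia.
Qed.

(** The common potential of all local minima in the class k. *)
Definition well_energy k : R := (2 * M%:R - 8 * M%:R ^+ 3 / (M%:R ^+ 2 + 3 * k%:R ^+ 2)) / 12.

(** This is p^2 - p q + q^2 for p = M + k - 2 and q = M - k - 1, the squared
    normalisation of the saddles in C_k. *)
Definition saddle_den k : R := M%:R ^+ 2 - 3 * M%:R + 3 + 3 * k%:R ^+ 2 - 3 * k%:R.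

(** The common potential of all saddles in C_k. *)
Definition saddle_energy k : R := (2 * M%:R - 9 - (2 * M%:R - 3) ^+ 3 / saddle_den k) / 12.

Lemma M_ge4 : 4 <= M%:R :> R.
Proof using NM N8. by rewrite ler_nat; exact: M_ge4n. Qed.

Lemma saddle_den_gt0 k : 0 < saddle_den k.
Proof using NM N8.
have m4 := M_ge4; rewrite /saddle_den.
have := sqr_ge0 (k%:R - 1 / 2 : R); have : 0 <= (M%:R - 4 : R) ^+ 2 by rewrite sqr_ge0.
lra.
Qed.

Lemma size_class_energy k P : (k <= N %/ 6)%N -> size_class k P ->
  potential 0 (two_well R P) = well_energy k.
Proof.
move=> kN cP; have bP := size_class_balanced kN cP.
rewrite (two_well_energy R bP) /well_energy.
have m4 := M_ge4.
have -> : N%:R = 2 * M%:R :> R by rewrite NM natrM.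
have den0 : M%:R ^+ 2 + 3 * k%:R ^+ 2 != 0 :> R.
  by rewrite gt_eqF // ltr_pwDl ?mulr_ge0 ?exprn_ge0 // exprn_gt0 //; lra.
have : (#|P|%:R = M%:R + k%:R :> R /\ #|~: P|%:R = M%:R - k%:R :> R) \/
       (#|P|%:R = M%:R - k%:R :> R /\ #|~: P|%:R = M%:R + k%:R :> R).
  have := card_compl P; move: cP kN; rewrite /size_class; move: #|P| #|~: P| => p q.
  rewrite NM => /orP[/eqP-> kN pq|/eqP<- kN pq].
    left; rewrite natrD; split=> //; apply/eqP; rewrite eq_sym subr_eq -natrD eqr_nat; lia.
  right; rewrite natrD addrK; split=> //; rewrite -!natrD; congr (_%:R); lia.
case=> -[-> ->].
  rewrite (_ : (M%:R + k%:R) ^+ 2 - _ + _ = M%:R ^+ 2 + 3 * k%:R ^+ 2); last by ring.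
  by field.
rewrite (_ : (M%:R - k%:R) ^+ 2 - _ + _ = M%:R ^+ 2 + 3 * k%:R ^+ 2); last by ring.
by field.
Qed.

Lemma saddle_family x r1 r2 r3 k : three_valued x r1 r2 r3 -> (1 <= k <= N %/ 6)%N ->
  count_eq x r2 = 1%N -> (count_eq x r3 = M - k \/ count_eq x r3 = M + k - 1)%N ->
  C0 M k x.
Proof.
move=> tv kN c2 c3; split.
  split; first exact: stationary_three_valued tv.
  exact/(index1_middle tv N8).
have cN := etrans (three_valued_count tv) NM; rewrite kmax_lt in kN.
rewrite -[in has_triple _ 1]c2; apply: (three_valued_triple tv); rewrite ?c2.
  by clear -kN; lia.
move: c2 c3 cN; move: (count_eq x r1) (count_eq x r2) (count_eq x r3) => a b c; clear -kN.
by lia.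
Qed.

(** The zero sum makes the outer roots proportional to the counts minus one; the
    cubic then fixes the factor. *)
Lemma saddle_family_energy x r1 r2 r3 k : three_valued x r1 r2 r3 -> (1 <= k <= N %/ 6)%N ->
  count_eq x r2 = 1%N -> (count_eq x r3 = M - k \/ count_eq x r3 = M + k - 1)%N ->
  potential 0 x = saddle_energy k.
Proof.
move=> tv kN c2 c3; rewrite (three_valued_energy tv) c2.
have := three_valued_balance tv; have cN := etrans (three_valued_count tv) NM; rewrite c2 in cN *.
rewrite kmax_lt in kN; have m4 := M_ge4n.
case: tv => r12 r23 s0 q1 _; rewrite mul1r => bal.
have r2E : r2 = - (r1 + r3) by lra.
have c0 : (0 < count_eq x r3 - 1)%N.
  by move: c3; move: (count_eq x r3) => b; clear -kN m4; lia.
(* The middle root occurs once and equals - (r1 + r3): the zero sum becomes a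
   relation between the outer roots with both counts lowered by one. *)
have [a aE] : exists a : R, a = (count_eq x r1)%:R - 1 by eexists.
have [b bE] : exists b : R, b = (count_eq x r3)%:R - 1 by eexists.
have a1 : (count_eq x r1)%:R = a + 1 by rewrite aE subrK.
have b1 : (count_eq x r3)%:R = b + 1 by rewrite bE subrK.
have b0 : 0 < b by rewrite bE subr_gt0 ltr1n; move: c0; clear; move: (count_eq x r3) => b'; lia.
rewrite a1 b1 in bal *.
have bal' : b * r3 = - a * r1 by move: bal; rewrite r2E; lra.
have ab : (a = M%:R - k%:R - 1 /\ b = M%:R + k%:R - 2) \/ (b = M%:R - k%:R - 1 /\ a = M%:R + k%:R - 2).
  have E : (count_eq x r3 + k = M /\ count_eq x r1 + 1 = M + k \/
      count_eq x r1 + k = M /\ count_eq x r3 + 1 = M + k)%N by move: c3 cN; move: (count_eq x r1) (count_eq x r3) => a' b'; clear -kN; lia.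
  rewrite aE bE; case: E => -[E1 E3].
    right; rewrite -E1 natrD addrK; split=> //.
    have := congr1 (fun n => n%:R : R) E3; rewrite !natrD -E1 natrD; lra.
  left; rewrite -E1 natrD addrK; split=> //.
  have := congr1 (fun n => n%:R : R) E3; rewrite !natrD -E1 natrD; lra.
have a0 : 0 < a.
  rewrite aE subr_gt0 ltr1n; move: c3 cN; move: (count_eq x r1) (count_eq x r3) => a' b'; clear -kN m4; lia.
have r1E : r1 = - b * (r3 / a).
  apply: (mulfI (lt0r_neq0 a0)); apply: oppr_inj; rewrite -mulNr -bal'; field.
  exact: lt0r_neq0.
have r3E : r3 = a * (r3 / a) by field; exact: lt0r_neq0.
have [c cE] : exists c, c = r3 / a by eexists.
rewrite -cE in r1E r3E.
have q1c : c ^+ 2 * (a ^+ 2 - a * b + b ^+ 2) = 1 by rewrite -q1 r1E r3E; ring.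
have den : a ^+ 2 - a * b + b ^+ 2 = saddle_den k.
  by rewrite /saddle_den; case: ab => -[-> ->]; ring.
have dp := saddle_den_gt0 k.
have c2E : c ^+ 2 = (saddle_den k)^-1.
  by apply: (mulIf (lt0r_neq0 dp)); rewrite mulVf ?lt0r_neq0 // -den.
rewrite r2E (_ : _ * _ = - 4^-1 * (c ^+ 2 * ((a + 1) * b ^+ 2 + (a - b) ^+ 2 + (b + 1) * a ^+ 2))).
  rewrite c2E /saddle_energy.
  case: ab => -[-> ->].
    have -> : saddle_den k = M%:R ^+ 2 - 3 * M%:R + 3 + 3 * k%:R ^+ 2 - 3 * k%:R by [].
    by field; exact: lt0r_neq0.
  have -> : saddle_den k = M%:R ^+ 2 - 3 * M%:R + 3 + 3 * k%:R ^+ 2 - 3 * k%:R by [].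
  by field; exact: lt0r_neq0.
by rewrite r1E r3E; ring.
Qed.

(** The counts of [few_middle] leave only the families C_k. *)
Lemma one_saddle_family x : one_saddle 0 x ->
  exists k, [/\ (1 <= k <= N %/ 6)%N, C0 M k x & potential 0 x = saddle_energy k].
Proof.
move=> [st i1]; have [r1 [r2 [r3 tv]]] := three_valued_stationary N3 st.
have /(index1_middle tv N8) c2 := i1.
have m12 : (1 <= count_eq x r2 <= 2)%N by rewrite c2.
have [n1 n3 _] := few_middle tv N8 m12.
have cN := etrans (three_valued_count tv) NM.
have [k kN c3] : exists2 k, (1 <= k <= N %/ 6)%N & (count_eq x r3 = M - k \/ count_eq x r3 = M + k - 1)%N.
  rewrite c2 in cN; move: (count_eq x r1) (count_eq x r3) n1 n3 cN => a b n1 n3 cN.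
  have {}n1 : (2 * M < 3 * a)%N by rewrite -NM.
  have {}n3 : (2 * M < 3 * b)%N by rewrite -NM.
  have [bM|bM] := ltnP b M.
    by exists (M - b)%N; rewrite ?kmax_lt; clear -n1 n3 cN bM; lia.
  by exists (b - M + 1)%N; rewrite ?kmax_lt; clear -n1 n3 cN bM; lia.
exists k; split=> //; first exact: saddle_family tv kN c2 c3.
exact: saddle_family_energy tv kN c2 c3.
Qed.

Lemma saddle_energy_lt k l : (1 <= k < l)%N -> saddle_energy k < saddle_energy l.
Proof using NM N8.
move=> /andP[k1 kl]; rewrite /saddle_energy ltr_pM2r ?invr_gt0 ?ltr0n // ltrD2l ltrN2.
have m4 := M_ge4.
rewrite ltr_pM2l ?exprn_gt0 //; last by lra.
rewrite ltf_pV2 ?posrE ?saddle_den_gt0 // /saddle_den.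
have k1' : 1 <= k%:R :> R by rewrite ler1n.
have kl' : k%:R + 1 <= l%:R :> R by rewrite natr1 ler_nat.
nra.
Qed.

Lemma saddle_energy_inj k l : (1 <= k)%N -> (1 <= l)%N -> saddle_energy k = saddle_energy l -> k = l.
Proof using NM N8.
move=> k1 l1 E; case: (ltngtP k l) => // kl.
  by have := @saddle_energy_lt k l; rewrite E ltxx k1 kl => /(_ isT).
by have := @saddle_energy_lt l k; rewrite E ltxx l1 kl => /(_ isT).
Qed.

(** The height to climb from a minimum of class k to a saddle in C_k. *)
Definition barrier k : R := saddle_energy k - well_energy k.

(** The larger k, the shallower the valley: this inequality is what orders the
    hierarchy. After clearing denominators it is a polynomial inequality in M and
    k under the constraint 3 (k + 1) < M. *)
Lemma barrier_step k : (1 <= k)%N -> (k.+1 <= N %/ 6)%N -> barrier k.+1 < barrier k.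
Proof.
move=> k1 kN; rewrite -subr_gt0.
have dk := saddle_den_gt0 k; have dk1 := saddle_den_gt0 k.+1.
have m4 := M_ge4.
have den k' : 0 < M%:R ^+ 2 + 3 * k'%:R ^+ 2 :> R.
  by rewrite ltr_pwDl ?mulr_ge0 ?exprn_ge0 // exprn_gt0 //; lra.
have ek := den k; have ek1 := den k.+1.
have -> : barrier k - barrier k.+1 =
  (8 * M%:R ^+ 3 * (2 * k%:R + 1) * (saddle_den k * saddle_den k.+1) -
   (2 * M%:R - 3) ^+ 3 * (2 * k%:R) * ((M%:R ^+ 2 + 3 * k%:R ^+ 2) * (M%:R ^+ 2 + 3 * k.+1%:R ^+ 2)))
  / 4 / (saddle_den k * saddle_den k.+1 * ((M%:R ^+ 2 + 3 * k%:R ^+ 2) * (M%:R ^+ 2 + 3 * k.+1%:R ^+ 2))).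
  rewrite /barrier /saddle_energy /well_energy.
  have -> : 2 * k%:R = (saddle_den k.+1 - saddle_den k) / 3 by rewrite /saddle_den -[k.+1%:R]natr1; field.
  have -> : (saddle_den k.+1 - saddle_den k) / 3 + 1 =
      ((M%:R ^+ 2 + 3 * k.+1%:R ^+ 2) - (M%:R ^+ 2 + 3 * k%:R ^+ 2)) / 3.
    by rewrite /saddle_den -[k.+1%:R]natr1; field.
  move: (lt0r_neq0 dk) (lt0r_neq0 dk1) (lt0r_neq0 ek) (lt0r_neq0 ek1).
  move: (saddle_den k) (saddle_den k.+1) (M%:R ^+ 2 + 3 * k%:R ^+ 2) (M%:R ^+ 2 + 3 * k.+1%:R ^+ 2).
  by move=> d d' e e' d0 d'0 e0 e'0; field; rewrite d0 d'0 e0 e'0.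
rewrite divr_gt0 ?mulr_gt0 // subr_gt0.
(* The slacks m and j make all coefficients of the polynomial nonnegative. Its
   coefficients are written in base 100, which keeps the unary numerals small. *)
have [m [m0 mE]] : exists m : R, 0 <= m /\ M%:R = 3 * (k%:R + 1) + 1 + m.
  exists (M%:R - (3 * (k%:R + 1) + 1)); split; last by ring.
  rewrite subr_ge0 !natr1 -natrM natr1 ler_nat; move: kN N3; rewrite NM; lia.
have [j [j0 jE]] : exists j : R, 0 <= j /\ k%:R = 1 + j.
  by exists (k%:R - 1); rewrite subr_ge0 ler1n addrC subrK.
rewrite /saddle_den -[k.+1%:R]natr1 mE jE -subr_gt0.
rewrite [ltRHS](_ : _ =
  ((99 * 100 + 82) * 100 + 40) + ((((2 * 100 + 58) * 100 + 73) * 100 + 44) * j + (((1 * 100 +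
  38) * 100 + 71) * 100 + 24) * m + (((3 * 100 + 23) * 100 + 50) * 100 + 80) * j * m + (((2 *
  100 + 67) * 100 + 50) * 100 + 40) * j ^+ 2 + ((81 * 100 + 58) * 100 + 50) * m ^+ 2 + (((1 *
  100 + 65) * 100 + 80) * 100 + 58) * j * m ^+ 2 + (((2 * 100 + 97) * 100 + 77) * 100 + 16) *
  j ^+ 2 * m + (((1 * 100 + 37) * 100 + 88) * 100) * j ^+ 3 + ((26 * 100 + 8) * 100 + 12) * m
  ^+ 3 + ((43 * 100 + 92) * 100 + 60) * j * m ^+ 3 + (((1 * 100 + 29) * 100 + 98) * 100 + 40)
  * j ^+ 2 * m ^+ 2 + (((1 * 100 + 34) * 100 + 85) * 100 + 60) * j ^+ 3 * m + ((35 * 100 + 42)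
  * 100 + 40) * j ^+ 4 + ((4 * 100 + 88) * 100 + 50) * m ^+ 4 + ((6 * 100 + 33) * 100 + 90) *
  j * m ^+ 4 + ((27 * 100 + 7) * 100 + 44) * j ^+ 2 * m ^+ 3 + ((48 * 100 + 51) * 100 + 36) *
  j ^+ 3 * m ^+ 2 + ((29 * 100 + 93) * 100 + 76) * j ^+ 4 * m + ((3 * 100 + 62) * 100 + 88) *
  j ^+ 5 + (53 * 100 + 64) * m ^+ 5 + (47 * 100 + 40) * j * m ^+ 5 + ((2 * 100 + 69) * 100 +
  40) * j ^+ 2 * m ^+ 4 + ((7 * 100 + 20) * 100) * j ^+ 3 * m ^+ 3 + ((8 * 100 + 42) * 100 +
  40) * j ^+ 4 * m ^+ 2 + ((2 * 100 + 59) * 100 + 20) * j ^+ 5 * m + (3 * 100 + 20) * m ^+ 6 +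
  (1 * 100 + 44) * j * m ^+ 6 + (10 * 100 + 32) * j ^+ 2 * m ^+ 5 + (37 * 100 + 44) * j ^+ 3 *
  m ^+ 4 + (69 * 100 + 12) * j ^+ 4 * m ^+ 3 + (51 * 100 + 84) * j ^+ 5 * m ^+ 2 + 8 * m ^+ 7)); last by ring.
apply: ltr_pwDl; first by lra.
by nonneg_poly.
Qed.

End Families.

(** * Lower bounds on the boundary of a region *)

Section Crossing.
Variable R : realType.

Lemma cts_min (T : topologicalType) (f h : T -> R) :
  continuous f -> continuous h -> continuous (fun x => Num.min (f x) (h x)).
Proof.
move=> fc hc.
have -> : (fun x => Num.min (f x) (h x)) = (fun x => (f x + h x - `|f x - h x|) * 2^-1).
  by apply/funext => x; rewrite minr_absE.
apply: ctsM; last exact: ctsC.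
by apply: ctsB; [exact: ctsD|apply: cts_abs; exact: ctsB].
Qed.

Lemma cts_bigmin (T : topologicalType) (I : finType) (F : I -> T -> R) :
  (forall i, continuous (F i)) -> continuous (fun x => \big[Num.min/1]_i F i x).
Proof.
move=> Fc; elim: (index_enum I) => [|i r IH].
  by under eq_fun do rewrite big_nil; exact: ctsC.
by under eq_fun do rewrite big_cons; exact: cts_min.
Qed.

(** Intermediate value theorem for the smallest of finitely many functions: when
    it first vanishes, all are still nonnegative. *)
Lemma first_exit (I : finType) (F : I -> R -> R) (b : R) : 0 <= b ->
  (forall i, {within `[0, b], continuous (F i)}) ->
  (forall i, 0 < F i 0) -> (exists i, F i b <= 0) ->
  exists2 t, t \in `[0, b] & (forall i, 0 <= F i t) /\ exists i, F i t = 0.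
Proof.
move=> b0 Fc F0 [i1 Fi1].
pose m t := \big[Num.min/1]_i F i t.
have mc : {within `[0, b], continuous m} by apply: cts_bigmin => i; exact: Fc.
have m0 : 0 < m 0 by apply/bigmin_gtP; split => // i _; exact: F0.
have m1 : m b <= 0 by apply: le_trans Fi1; exact: bigmin_le_cond.
have [|t tI mt] := @IVT R m 0 b 0 b0 mc.
  by rewrite ge_min m1 orbT le_max (ltW m0).
exists t => //.
have F_ge i : 0 <= F i t by rewrite -mt; exact: bigmin_le_cond.
split=> //; apply: contrapT => no.
have : 0 < m t.
  apply/bigmin_gtP; split => // i _; rewrite lt_neqAle F_ge andbT eq_sym.
  by apply/eqP => E; apply: no; exists i.
by rewrite mt ltxx.
Qed.

End Crossing.

Section TangentBounds.
Variables (R : realType).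
Implicit Types (a b w r x l : R).

(** Subtracting l r from the well does not change the total energy, since the
    coordinates sum to zero. When l is the multiplier of a saddle, all coordinates
    of that saddle become critical points of the tilted well. *)
Definition tilt l r : R := well r - l * r.

(** The tilted well minus its value at the critical point a has a double zero at
    a; w is another critical point. *)
Lemma tilt_tangent w a x : w ^+ 2 + w * a + a ^+ 2 = 1 ->
  tilt (a ^+ 3 - a) x - tilt (a ^+ 3 - a) a =
    4^-1 * (x - a) ^+ 2 * ((x - w) * (x + w + 2 * a) + (a ^+ 2 - w ^+ 2)).
Proof.
move=> q.
rewrite (_ : (x - w) * _ + _ = x ^+ 2 + 2 * a * x + 3 * a ^+ 2 - 2 * (w ^+ 2 + w * a + a ^+ 2)); last by ring.
by rewrite q /tilt /well; field.
Qed.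

(** Beyond the local maximum w of the tilted well, the right minimum a is the
    strict minimum. *)
Lemma tilt_above w a x : w ^+ 2 + w * a + a ^+ 2 = 1 -> - a < w -> w < a -> w <= x ->
  tilt (a ^+ 3 - a) a <= tilt (a ^+ 3 - a) x /\
  (tilt (a ^+ 3 - a) a = tilt (a ^+ 3 - a) x -> x = a).
Proof.
move=> q aw wa wx; have E := tilt_tangent x q.
have pos : 0 < (x - w) * (x + w + 2 * a) + (a ^+ 2 - w ^+ 2).
  apply: ltr_wpDl; first by rewrite mulr_ge0 ?subr_ge0 //; lra.
  by rewrite subr_sqr mulr_gt0; lra.
split; first by rewrite -subr_ge0 E mulr_ge0 ?(ltW pos) // mulr_ge0 ?sqr_ge0.
move=> te; move: E; rewrite -te subrr => /esym/eqP.
by rewrite !mulf_eq0 invr_eq0 (gt_eqF pos) orbF pnatr_eq0 /= orbb subr_eq0 => /eqP.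
Qed.

Lemma well_opp r : well (- r) = well r.
Proof. by rewrite /well; ring. Qed.

Lemma tilt_opp l r : tilt (- l) (- r) = tilt l r.
Proof. by rewrite /tilt well_opp mulrNN. Qed.

(** The mirror image of [tilt_above]. *)
Lemma tilt_below w b x : w ^+ 2 + w * b + b ^+ 2 = 1 -> w < - b -> b < w -> x <= w ->
  tilt (b ^+ 3 - b) b <= tilt (b ^+ 3 - b) x /\
  (tilt (b ^+ 3 - b) b = tilt (b ^+ 3 - b) x -> x = b).
Proof.
move=> q wb bw xw.
have E : (- b) ^+ 3 - - b = - (b ^+ 3 - b) by ring.
have := @tilt_above (- w) (- b) (- x); rewrite E !tilt_opp => H.
have [||||H1 H2] := H; [by rewrite -q; ring|by rewrite opprK; lra|by rewrite ltrN2|by rewrite lerN2|].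
by split=> // /H2 /oppr_inj.
Qed.

Lemma tilt_root l r : r ^+ 3 - r = l -> tilt l r = - r ^+ 2 / 4 - 3 / 4 * l * r.
Proof.
move=> E; have r3 : r ^+ 3 = r + l by rewrite -E addrC subrK.
by rewrite /tilt /well exprS r3; field.
Qed.

End TangentBounds.

Section FaceBound.
Variables (R : realType) (N : nat).
Implicit Types (x : 'rV[R]_N) (Q : {set 'I_N}).

Lemma tilt_sum x (l : R) : zero_sum x -> potential 0 x = \sum_i tilt l (x ord0 i).
Proof.
move=> x0; rewrite potential0E /tilt [RHS]sumrB.
by rewrite -[X in _ = _ - X]mulr_sumr x0 mulr0 subr0.
Qed.

(** A coordinatewise bound by the tilted well becomes a bound of the potential,
    with equality only at the target point. *)
Lemma tilt_sum_le x (l : R) (tgt : 'I_N -> R) : zero_sum x ->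
  (forall i, tilt l (tgt i) <= tilt l (x ord0 i) /\ (tilt l (tgt i) = tilt l (x ord0 i) -> x ord0 i = tgt i)) ->
  \sum_i tilt l (tgt i) <= potential 0 x /\
  (potential 0 x = \sum_i tilt l (tgt i) -> forall i, x ord0 i = tgt i).
Proof.
move=> x0 H; rewrite (tilt_sum l x0); split; first by apply: ler_sum => i _; have [] := H i.
move=> E i; have [Hi Hi'] := H i; apply: Hi'.
have : \sum_i (tilt l (x ord0 i) - tilt l (tgt i)) == 0 by rewrite sumrB E subrr.
rewrite psumr_eq0; last by move=> j _; rewrite subr_ge0; have [] := H j.
by move/allP/(_ i (mem_index_enum i)); rewrite /= subr_eq0 => /eqP.
Qed.

Lemma sum_targets Q (i0 : 'I_N) (F : R -> R) (w a b : R) : i0 \notin Q ->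
  \sum_i F (if i == i0 then w else if i \in Q then a else b) =
  F w + #|Q|%:R * F a + (#|~: Q|%:R - 1) * F b.
Proof.
move=> i0Q; rewrite (bigD1 i0) //= eqxx -addrA; congr (_ + _).
rewrite (bigID (fun i => i \in Q)) /=; congr (_ + _).
  rewrite (eq_bigr (fun=> F a)); last by move=> i /andP[/negPf-> ->].
  rewrite (eq_bigl (fun i => i \in Q)); last first.
    by move=> i; case: eqP => [->|//]; rewrite (negPf i0Q).
  by rewrite sumr_const mulr_natl.
rewrite (eq_bigr (fun=> F b)); last by move=> i /andP[/negPf-> /negPf->].
rewrite (eq_bigl (fun i => i \in (~: Q) :\ i0)%SET); last by move=> i; rewrite !inE.
rewrite sumr_const -[LHS]mulr_natl; congr (_ * _).
by rewrite (cardsD1 i0 (~: Q)) inE i0Q natrD addrAC subrr add0r.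
Qed.

(** On the face where one coordinate sits at the local maximum w of the tilted
    well and all others stay on their sides of w, moving each of these to the
    bottom of its side only lowers the energy. The saddle is the point so reached. *)
Lemma face_bound x Q (i0 : 'I_N) (w a b : R) :
  b < w -> w < a -> a + b + w = 0 -> w ^+ 2 + w * a + a ^+ 2 = 1 ->
  zero_sum x -> i0 \notin Q -> x ord0 i0 = w ->
  (forall i, i \in Q -> w <= x ord0 i) -> (forall i, i \notin Q -> x ord0 i <= w) ->
  let l := a ^+ 3 - a in
  let e := tilt l w + #|Q|%:R * tilt l a + (#|~: Q|%:R - 1) * tilt l b in
  e <= potential 0 x /\
  (potential 0 x = e -> forall i, x ord0 i = if i == i0 then w else if i \in Q then a else b).
Proof.
move=> bw wa s0 q x0 i0Q xw xQ xQ' l e.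
have lb : l = b ^+ 3 - b.
  apply/eqP; rewrite -subr_eq0 /l (_ : b = - (a + w)); last by lra.
  apply/eqP; rewrite (_ : _ - _ = (2 * a + w) * (w ^+ 2 + w * a + a ^+ 2 - 1)); last by ring.
  by rewrite q subrr mulr0.
have qb : w ^+ 2 + w * b + b ^+ 2 = 1.
  by rewrite -q (_ : b = - (a + w)); [ring|lra].
rewrite /e -(sum_targets (tilt l) w a b i0Q); apply: tilt_sum_le => // i.
case: eqP => [->|_]; first by rewrite xw.
case: ifP => iQ.
  by apply: (tilt_above q) => //; [lra|exact: xQ].
rewrite lb; apply: (tilt_below qb) => //; [lra|].
by apply: xQ'; rewrite iQ.
Qed.

(** When two coordinates from opposite sides meet at u, the same argument applies
    with the well tilted so that u is its local maximum. The two sides have the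
    same size, so that the resulting bound is an explicit function of u. *)
Lemma pair_bound x Q (i j : 'I_N) (u : R) :
  u ^+ 2 < 1 / 3 -> zero_sum x -> i \in Q -> j \notin Q -> x ord0 i = u -> x ord0 j = u ->
  #|Q| = #|~: Q| ->
  (forall k, k \in Q -> u <= x ord0 k) -> (forall k, k \notin Q -> x ord0 k <= u) ->
  (#|Q|%:R - 3) * (3 / 4 * u ^+ 4 - u ^+ 2 / 2) - (#|Q|%:R - 1) / 2 <= potential 0 x.
Proof.
move=> u3 x0 iQ jQ xi xj cQ xQ xQ'.
(* The roots other than u of the cubic through u solve a^2 + u a + u^2 = 1. *)
pose s := Num.sqrt (4 - 3 * u ^+ 2).
have s2 : s ^+ 2 = 4 - 3 * u ^+ 2 by rewrite sqr_sqrtr //; lra.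
have s0 : 0 < s by rewrite sqrtr_gt0; lra.
have su1 : 3 * u < s.
  have [u0|u0] := lerP u 0; first by lra.
  by rewrite -(@ltr_pXn2r _ 2) ?nnegrE ?mulr_ge0 ?(ltW u0) ?(ltW s0) // exprMn s2; lra.
have su2 : - (3 * u) < s.
  have [u0|u0] := lerP 0 u; first by lra.
  rewrite -(@ltr_pXn2r _ 2) ?nnegrE ?(ltW s0) //; last by lra.
  by rewrite sqrrN exprMn s2; lra.
pose a := (s - u) / 2; pose b := - (s + u) / 2.
have q : u ^+ 2 + u * a + a ^+ 2 = 1 by rewrite /a; lra.
have qb : u ^+ 2 + u * b + b ^+ 2 = 1 by rewrite /b; lra.
have [l lE] : exists l, l = u ^+ 3 - u by eexists.
have cub (c : R) : u ^+ 2 + u * c + c ^+ 2 = 1 -> c ^+ 3 - c = l.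
  move=> qc; apply/eqP; rewrite -subr_eq0 lE; apply/eqP.
  rewrite (_ : _ - _ = (c - u) * (u ^+ 2 + u * c + c ^+ 2 - 1)); last by ring.
  by rewrite qc subrr mulr0.
have la := cub a q; have lb := cub b qb.
pose tgt k := if k == i then u else if k == j then u else if k \in Q then a else b.
have [H _] : \sum_k tilt l (tgt k) <= potential 0 x /\
  (potential 0 x = \sum_k tilt l (tgt k) -> forall k, x ord0 k = tgt k).
  apply: tilt_sum_le => // k; rewrite /tgt.
  case: eqP => [->|_]; first by rewrite xi.
  case: eqP => [->|_]; first by rewrite xj.
  case: ifP => kQ; first by rewrite -la; apply: (tilt_above q); rewrite /a; [lra|lra|exact: xQ].
  by rewrite -lb; apply: (tilt_below qb); rewrite /b; [lra|lra|apply: xQ'; rewrite kQ].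
apply: le_trans H.
have ij : i != j by apply: contraTneq iQ => ->.
have -> : \sum_k tilt l (tgt k) = \sum_k tilt l (if k == j then u else if k \in Q then a else b) + tilt l u - tilt l a.
  rewrite (bigD1 i) // [in RHS](bigD1 i) //= {1}/tgt eqxx (negPf ij) iQ.
  have -> : \sum_(k | k != i) tilt l (tgt k) =
      \sum_(k | k != i) tilt l (if k == j then u else if k \in Q then a else b).
    by apply: eq_bigr => k /negPf ki; rewrite /tgt ki.
  by ring.
rewrite (sum_targets (tilt l)) // -cQ.
rewrite !tilt_root // /a /b; set m := #|Q|%:R.
have -> : l = u ^+ 3 - u by [].
rewrite le_eqVlt; apply/orP; left; apply/eqP.
rewrite [RHS](_ : _ = (- (2 * u ^+ 2 + (m - 1) * ((s ^+ 2 + u ^+ 2) / 2)) / 4 - 3 / 4 * (u ^+ 3 - u) * (2 * u + (m - 1) * (- u)))); last by field.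
by rewrite s2; field.
Qed.

End FaceBound.

(** * Every path leaving a pattern climbs to a saddle *)

Section Barriers.
Variables (R : realType) (N M : nat).
Hypotheses (NM : N = (2 * M)%N) (N8 : (8 <= N)%N) (N3 : ~~ (3 %| N)%N).
Implicit Types (x : 'rV[R]_N) (P : {set 'I_N}) (k : nat).

(** The coordinates w (once), a (M + k - 1 times) and b (M - k times) of a saddle
    in C_k. As w > 0, the tilted well is deeper on the negative side, so it is
    cheaper to have fewer coordinates at a. *)
Lemma saddle_values k : (1 <= k)%N -> (3 * k < M)%N -> exists w a b : R,
  [/\ b < w, w < a, a + b + w = 0, w ^+ 2 + w * a + a ^+ 2 = 1 & 0 < w] /\
  [/\ w ^+ 2 = (2 * k%:R - 1) ^+ 2 / saddle_den R M k, w ^+ 2 < 1 / 3,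
   tilt (a ^+ 3 - a) w + (M%:R + k%:R - 1) * tilt (a ^+ 3 - a) a
     + (M%:R - k%:R) * tilt (a ^+ 3 - a) b = saddle_energy R M k &
   tilt (a ^+ 3 - a) b < tilt (a ^+ 3 - a) a].
Proof.
move=> k1 kM.
have dp := @saddle_den_gt0 R N M NM N8 k.
have [s [s0 sE]] : exists s : R, 0 < s /\ s ^+ 2 = saddle_den R M k.
  by exists (Num.sqrt (saddle_den R M k)); rewrite sqrtr_gt0 sqr_sqrtr ?ltW.
have k1' : 1 <= k%:R :> R by rewrite ler1n.
have kM' : 3 * k%:R + 1 <= M%:R :> R by rewrite -natrM natr1 ler_nat.
have [c [c0 cE]] : exists c : R, 0 < c /\ c ^+ 2 = (saddle_den R M k)^-1.
  by exists s^-1; rewrite invr_gt0 exprVn sE.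
have c2 : c ^+ 2 * saddle_den R M k = 1 by rewrite cE mulVf // lt0r_neq0.
pose w : R := c * (2 * k%:R - 1); pose a := c * (M%:R - k%:R - 1); pose b := - (c * (M%:R + k%:R - 2)).
have bw : b < w by rewrite /b /w -mulrN ltr_pM2l //; lra.
have wa : w < a by rewrite /a /w ltr_pM2l //; lra.
have s0' : a + b + w = 0 by rewrite /a /b /w; ring.
have q : w ^+ 2 + w * a + a ^+ 2 = 1 by rewrite -c2 /w /a /saddle_den; ring.
have w0 : 0 < w by rewrite mulr_gt0 //; lra.
exists w, a, b; split; first by split.
have [l lE] : exists l, l = a ^+ 3 - a by eexists.
have E (r : R) : w ^+ 2 + w * a + a ^+ 2 - 1 = 0 -> r = w \/ r = b -> r ^+ 3 - r = l.
  move=> q0 rE; apply/eqP; rewrite -subr_eq0 lE; apply/eqP.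
  have bE : b = - (a + w) by lra.
  case: rE => ->.
    rewrite (_ : _ - _ = (w - a) * (w ^+ 2 + w * a + a ^+ 2 - 1)); last by ring.
    by rewrite q0 mulr0.
  rewrite bE (_ : _ - _ = - (2 * a + w) * (w ^+ 2 + w * a + a ^+ 2 - 1)); last by ring.
  by rewrite q0 mulr0.
have q0 : w ^+ 2 + w * a + a ^+ 2 - 1 = 0 by rewrite q subrr.
have lw := E w q0 (or_introl erefl); have lb := E b q0 (or_intror erefl).
have llw : l = w * a * b.
  rewrite lE (_ : b = - (a + w)); last by lra.
  apply/eqP; rewrite -subr_eq0; apply/eqP.
  rewrite (_ : _ - _ = a * (w ^+ 2 + w * a + a ^+ 2 - 1)); last by ring.
  by rewrite q0 mulr0.
rewrite -!lE; split.
- by rewrite /w exprMn cE mulrC.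
- have : 0 < (w - b) * (a - w) by rewrite mulr_gt0 // subr_gt0.
  rewrite (_ : b = - (a + w)); lra.
- rewrite [LHS](_ : _ = well w + (M%:R + k%:R - 1) * well a + (M%:R - k%:R) * well b
     - l * (w + (M%:R + k%:R - 1) * a + (M%:R - k%:R) * b)); last by rewrite /tilt; ring.
  rewrite (_ : w + _ + _ = 0); last by rewrite /w /a /b; ring.
  rewrite mulr0 subr0 /saddle_energy.
  have -> : well w + (M%:R + k%:R - 1) * well a + (M%:R - k%:R) * well b =
    4^-1 * (c ^+ 2) ^+ 2 * ((2 * k%:R - 1) ^+ 4 + (M%:R + k%:R - 1) * (M%:R - k%:R - 1) ^+ 4
      + (M%:R - k%:R) * (M%:R + k%:R - 2) ^+ 4) -
    2^-1 * c ^+ 2 * ((2 * k%:R - 1) ^+ 2 + (M%:R + k%:R - 1) * (M%:R - k%:R - 1) ^+ 2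
      + (M%:R - k%:R) * (M%:R + k%:R - 2) ^+ 2) by rewrite /well /w /a /b; ring.
  rewrite cE; have dn := lt0r_neq0 dp.
  move: dn; rewrite /saddle_den => dn; field.
  exact: dn.
- rewrite !tilt_root // -subr_gt0.
  have -> : - a ^+ 2 / 4 - 3 / 4 * l * a - (- b ^+ 2 / 4 - 3 / 4 * l * b) =
     (a - b) / 4 * (- (a + b) - 3 * l) by field.
  rewrite (_ : - (a + b) = w); last by lra.
  have -> : w - 3 * l = w * (1 + 3 * a * (- b)) by rewrite llw; ring.
  have a0 : 0 < a by apply: lt_trans wa.
  have b0 : 0 < - b by lra.
  rewrite mulr_gt0 ?divr_gt0 ?subr_gt0 //; first exact: lt_trans wa.
  apply: mulr_gt0 => //; apply: addr_gt0; first exact: ltr01.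
  by apply: mulr_gt0 => //; apply: mulr_gt0.
Qed.

(** Every coordinate lies beyond the inflection points of the double well, on
    the side given by P. Minima are separated, also under weak coupling, and the
    value w of a saddle lies between the inflection points, so that a path between
    two different patterns has to cross w in some coordinate. *)
Definition separated P x : Prop := forall i,
  1 / 3 < x ord0 i ^+ 2 /\ (if i \in P then 0 < x ord0 i else x ord0 i < 0).

Lemma separated_opp P x : separated P x -> separated (~: P) (- x).
Proof.
move=> sx i; have [xi h] := sx i; rewrite mxE inE sqrrN; split=> //.
by move: h; case: (i \in P) => /=; rewrite ?oppr_lt0 ?oppr_gt0.
Qed.

Lemma separated_inj P Q x : separated P x -> separated Q x -> P = Q.
Proof.
move=> sP sQ; apply/setP => i; have [_] := sP i; have [_] := sQ i.
by case: (i \in P); case: (i \in Q) => // h1 h2; have := lt_trans h1 h2; rewrite ltxx.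
Qed.

Lemma separated_gt P x i w : separated P x -> w ^+ 2 < 1 / 3 -> i \in P -> w < x ord0 i.
Proof.
move=> sP w3 iP; have [xi] := sP i; rewrite iP => x0.
have [w0|w0] := lerP w 0; first exact: le_lt_trans w0 x0.
by rewrite -(@ltr_pXn2r _ 2) ?nnegrE ?ltW // (lt_trans w3).
Qed.

Lemma separated_lt P x i w : separated P x -> w ^+ 2 < 1 / 3 -> i \notin P -> x ord0 i < w.
Proof.
move=> sP w3 iP; rewrite -ltrN2.
have := @separated_gt (~: P) (- x) i (- w) (separated_opp sP).
by rewrite sqrrN inE iP mxE => /(_ w3 isT).
Qed.

Lemma coord_path (b : R) (Gamma : R -> 'rV[R]_N) i : {within `[0, b], continuous Gamma} ->
  {within `[0, b], continuous (fun t => Gamma t ord0 i)}.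
Proof.
move=> Gc.
have : continuous ((fun x : 'rV[R]_N => x ord0 i) \o (Gamma : subspace `[0, b] -> 'rV[R]_N)).
  by move=> x; apply: continuous_comp; [exact: Gc|exact: cts_coord].
exact.
Qed.

Lemma three_valued_opp x r1 r2 r3 : three_valued x r1 r2 r3 -> three_valued (- x) (- r3) (- r2) (- r1).
Proof.
move=> [r12 r23 s0 q1 [x0 xr]]; split; rewrite ?ltrN2 //; try lra.
split=> [|i].
  by rewrite /zero_sum /=; under eq_bigr do rewrite mxE; rewrite sumrN x0 oppr0.
by rewrite mxE; case: (xr i) => ->; [constructor 3|constructor 2|constructor 1].
Qed.

Lemma count_eq_opp x (r : R) : count_eq (- x) (- r) = count_eq x r.
Proof. by apply: eq_card => i; rewrite !inE mxE eqr_opp. Qed.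

(** The two possibilities for the number of coordinates at the largest root
    correspond to each other under x |-> - x. *)
Definition exit_saddle k x := exists r1 r2 r3, [/\ three_valued x r1 r2 r3, count_eq x r2 = 1%N &
  (count_eq x r3 = M - k \/ count_eq x r3 = M + k - 1)%N].

Lemma exit_saddle_opp k x : (1 <= k)%N -> (3 * k < M)%N -> exit_saddle k x -> exit_saddle k (- x).
Proof.
move=> k1 kM [r1 [r2 [r3 [tv c2 c3]]]]; exists (- r3), (- r2), (- r1); rewrite !count_eq_opp.
split=> //; first exact: three_valued_opp.
have := etrans (three_valued_count tv) NM; move: c2 c3.
move: (count_eq x r1) (count_eq x r2) (count_eq x r3) => a b c; clear -k1 kM; lia.
Qed.

Lemma potential0_opp x : potential 0 (- x) = potential 0 x.
Proof. by rewrite !potential0E; apply: eq_bigr => i _; rewrite mxE well_opp. Qed.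

Definition admissible (Gamma : R -> 'rV[R]_N) : Prop :=
  {within `[0, 1], continuous Gamma} /\ forall t, t \in `[0, 1] -> zero_sum (Gamma t).

(** The path starts in the region where the coordinates in P lie above w and the
    others below. When it leaves, one coordinate equals w and [face_bound] applies.
    If that coordinate comes from P, the bound is the energy of a saddle in C_k; if
    it comes from the minority, one more coordinate remains at a, and the bound is
    strictly higher. *)
Lemma exit_majority k P Q Gamma : (1 <= k)%N -> (3 * k < M)%N -> #|P| = (M + k)%N -> Q != P ->
  admissible Gamma -> separated P (Gamma 0) -> separated Q (Gamma 1) ->
  exists2 t, t \in `[0, 1] & saddle_energy R M k <= potential 0 (Gamma t) /\
    (potential 0 (Gamma t) = saddle_energy R M k -> exit_saddle k (Gamma t)).
Proof.
move=> k1 kM cP QP [Gc G0] sP sQ.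
have [w [a [b [[bw wa s0 q w0] [_ w3 eE tba]]]]] := saddle_values k1 kM.
pose F i t := if i \in P then Gamma t ord0 i - w else w - Gamma t ord0 i.
have Fc i : {within `[0, 1], continuous (F i)}.
  rewrite /F; case: (i \in P); apply: ctsB; by [exact: coord_path|exact: ctsC].
have F0 i : 0 < F i 0.
  rewrite /F; case: ifP => iP; rewrite subr_gt0; first exact: separated_gt sP w3 iP.
  by apply: separated_lt sP w3 _; rewrite iP.
have F1 : exists i, F i 1 <= 0.
  apply: contrapT => no; move/eqP: QP; apply.
  apply: (separated_inj sQ) => i.
  have [xi3 _] := sQ i; split=> //.
  have : 0 < F i 1 by rewrite ltNge; apply/negP => Fi; apply: no; exists i.
  rewrite /F; case: (boolP (i \in P)) => iP; rewrite subr_gt0 => h; first exact: lt_trans h.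
  rewrite ltNge; apply/negP => x0; move: xi3.
  have : (Gamma 1 ord0 i) ^+ 2 < w ^+ 2 by rewrite ltr_pXn2r ?nnegrE ?(ltW w0).
  by move=> h1 h2; have := lt_trans h1 (lt_trans w3 h2); rewrite ltxx.
have [t tI [Ft [i0 Fi0]]] := first_exit ler01 Fc F0 F1.
exists t => //.
have xi0 : Gamma t ord0 i0 = w by move: Fi0; rewrite /F; case: ifP => _; lra.
have xP i : i \in P -> w <= Gamma t ord0 i by move=> iP; have := Ft i; rewrite /F iP subr_ge0.
have xP' i : i \notin P -> Gamma t ord0 i <= w by move=> /negPf iP; have := Ft i; rewrite /F iP subr_ge0.
have cPc : #|~: P|%:R = M%:R - k%:R :> R.
  have := etrans (card_compl P) NM; rewrite cP => /(congr1 (fun n => n%:R : R)).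
  by rewrite !(natrD, natrM); lra.
have [iP|iP] := boolP (i0 \in P); last first.
  have [le _] := face_bound bw wa s0 q (G0 t tI) iP xi0 xP xP'.
  have lt : saddle_energy R M k < potential 0 (Gamma t).
    apply: lt_le_trans le; rewrite -eE cPc cP natrD; lra.
  by split; [exact: ltW|move=> E; move: lt; rewrite E ltxx].
(* At the exit point, i0 counts as a coordinate on the lower side. *)
pose Q' := (P :\ i0)%SET.
have cQ : #|Q'|%:R = M%:R + k%:R - 1 :> R.
  by have := cardsD1 i0 P; rewrite iP cP /= => /(congr1 (fun n => n%:R : R)); rewrite !natrD -/Q'; lra.
have cQc : #|~: Q'|%:R = M%:R - k%:R + 1 :> R.
  have := etrans (card_compl Q') NM => /(congr1 (fun n => n%:R : R)).
  by rewrite !(natrD, natrM) cQ; lra.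
have iQ : i0 \notin Q' by rewrite !inE eqxx.
have [||le eq] := face_bound bw wa s0 q (G0 t tI) iQ xi0 (b := b).
- by move=> i; rewrite !inE => /andP[_]; exact: xP.
- by move=> i; rewrite !inE negb_and negbK => /orP[/eqP->|]; [rewrite xi0|exact: xP'].
rewrite cQ cQc addrK eE in le eq; split=> // /eq xE.
exists b, w, a; split.
- split=> //; [lra|rewrite -q; have -> : b = - (a + w) by [lra]; ring|split; first exact: G0].
  by move=> i; rewrite xE; case: eqP => _; [constructor 2|case: ifP => _; [constructor 3|constructor 1]].
- rewrite /count_eq -[RHS](card1 i0); apply: eq_card => i; rewrite !inE xE.
  have [_|_] := eqVneq i i0; first by rewrite eqxx.
  by case: ifP => _; rewrite ?(gt_eqF wa) ?(lt_eqF bw).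
right; have -> : count_eq (Gamma t) a = #|Q'|.
  apply: eq_card => i; rewrite inE xE; have [->|_] := eqVneq i i0; first by rewrite (lt_eqF wa) (negPf iQ).
  by case: (i \in Q'); rewrite ?eqxx ?(lt_eqF (lt_trans bw wa)).
have := cardsD1 i0 P; rewrite iP cP -/Q'; move: #|Q'| => q'; clear; lia.
Qed.

(** Compares the bound of [pair_bound], with v = u^2, to the saddle energy. It
    decreases in v on the given range, and at the largest v the difference is a rational function of
    M with a numerator that is nonnegative for M >= 4. *)
Lemma pair_level_above (v : R) : 0 <= v -> v <= (saddle_den R M 1)^-1 ->
  saddle_energy R M 1 <= (M%:R - 3) * (3 / 4 * v ^+ 2 - v / 2) - (M%:R - 1) / 2.
Proof.
have m4 := M_ge4 R NM N8.
have [D DE] : exists D : R, D = saddle_den R M 1 by eexists.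
have D0 : 0 < D by rewrite DE (saddle_den_gt0 R NM N8).
have DM : D = M%:R ^+ 2 - 3 * M%:R + 3 by rewrite DE /saddle_den; ring.
rewrite /saddle_energy -DE => v0 vD.
have D3 : D^-1 < 1 / 3.
  by rewrite mul1r ltf_pV2 ?posrE // DM; have := sqr_ge0 (M%:R - 4 : R); lra.
have step : (M%:R - 3) * (3 / 4 * D^-1 ^+ 2 - D^-1 / 2) <= (M%:R - 3) * (3 / 4 * v ^+ 2 - v / 2).
  rewrite ler_pM2l; last by lra.
  rewrite -subr_ge0 (_ : _ - _ = (D^-1 - v) * (1 / 2 - 3 / 4 * (D^-1 + v))); last by field; exact: lt0r_neq0.
  by apply: mulr_ge0; lra.
apply: le_trans (lerB step (lexx _)).
rewrite -subr_ge0.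
have -> : (M%:R - 3) * (3 / 4 * D^-1 ^+ 2 - D^-1 / 2) - (M%:R - 1) / 2 - (2 * M%:R - 9 - (2 * M%:R - 3) ^+ 3 / D) / 12 =
  ((M%:R - 3) * (9 - 6 * D) - 6 * (M%:R - 1) * D ^+ 2 - (2 * M%:R - 9) * D ^+ 2 + (2 * M%:R - 3) ^+ 3 * D) / (12 * D ^+ 2).
  by field; exact: lt0r_neq0.
apply: divr_ge0; last by rewrite mulr_ge0 ?sqr_ge0.
rewrite DM.
have [m [m0 mE]] : exists m : R, 0 <= m /\ M%:R = 4 + m by exists (M%:R - 4); rewrite subr_ge0 addrC subrK.
rewrite mE [leRHS](_ : _ = 9 + 30 * m + 36 * m ^+ 2 + 18 * m ^+ 3 + 3 * m ^+ 4); last by ring.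
by nonneg_poly.
Qed.

(** For a pattern with M coordinates on each side the region of [exit_majority]
    fails: a coordinate of P crossing w downwards would only need an energy below
    that of C_1. Each side is therefore allowed to move up to the far threshold, w
    for the complement and - w for P, but no coordinate of P may fall below one of
    the complement. The first kind of face leads to C_1 or to its mirror image, the
    second kind to [pair_bound]. *)
Lemma exit_balanced P Q Gamma : #|P| = M -> Q != P ->
  admissible Gamma -> separated P (Gamma 0) -> separated Q (Gamma 1) ->
  exists2 t, t \in `[0, 1] & saddle_energy R M 1 <= potential 0 (Gamma t).
Proof.
move=> cP QP [Gc G0] sP sQ.
have M4 := M_ge4n NM N8.
have m4 : 4 <= M%:R :> R by rewrite ler_nat.
have [//||w [a [b [[bw wa s0 q w0] [w2 w3 eE tba]]]]] := @saddle_values 1; first by clear -M4; lia.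
(* A pair stands for the face where a coordinate of P meets one of the
   complement, a single index for a face at a far threshold. *)
pose F (ij : 'I_N * 'I_N + 'I_N) t := match ij with
  | inl (i, j) => if (i \in P) && (j \notin P) then Gamma t ord0 i - Gamma t ord0 j else 1
  | inr i => if i \in P then Gamma t ord0 i + w else w - Gamma t ord0 i end.
have Fc i : {within `[0, 1], continuous (F i)}.
  case: i => [[i j]|i]; rewrite /F.
    case: ((i \in P) && (j \notin P)); last exact: ctsC.
    by apply: ctsB; exact: coord_path.
  by case: (i \in P); [apply: ctsD|apply: ctsB]; by [exact: coord_path|exact: ctsC].
have F0 i : 0 < F i 0.
  case: i => [[i j]|i]; rewrite /F; case: ifP => // iP.
  - case/andP: iP => iP jP; rewrite subr_gt0; apply: (lt_trans (y := w)).
      exact: separated_lt sP w3 jP.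
    exact: separated_gt sP w3 iP.
  - by rewrite -ltrBlDr sub0r; apply: separated_gt sP _ iP; rewrite sqrrN.
  - by rewrite subr_gt0; apply: separated_lt sP w3 _; rewrite iP.
have F1 : exists i, F i 1 <= 0.
  apply: contrapT => no; move/eqP: QP; apply.
  apply: (separated_inj sQ) => i.
  have [xi3 _] := sQ i; split=> //.
  have : 0 < F (inr i) 1 by rewrite ltNge; apply/negP => Fi; apply: no; exists (inr i).
  have sq : - w < Gamma 1 ord0 i -> Gamma 1 ord0 i < w -> False.
    move=> h1 h2; suff h : (Gamma 1 ord0 i) ^+ 2 < w ^+ 2.
      by have := lt_trans h (lt_trans w3 xi3); rewrite ltxx.
    by rewrite -subr_gt0 subr_sqr mulr_gt0 //; lra.
  rewrite /F; case: (boolP (i \in P)) => iP h; rewrite ltNge; apply/negP => x0; apply: sq; lra.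
have [t tI [Ft [i0 Fi0]]] := first_exit ler01 Fc F0 F1.
exists t => //.
have xP i j : i \in P -> j \notin P -> Gamma t ord0 j <= Gamma t ord0 i.
  by move=> iP jP; have := Ft (inl (i, j)); rewrite /F iP jP /= subr_ge0.
have xw i : i \in P -> - w <= Gamma t ord0 i.
  by move=> iP; have := Ft (inr i); rewrite /F iP; lra.
have xw' i : i \notin P -> Gamma t ord0 i <= w.
  by move=> /negPf iP; have := Ft (inr i); rewrite /F iP; lra.
have cPc : #|~: P| = M by have := etrans (card_compl P) NM; rewrite cP mul2n -addnn => /addnI.
have G0' : zero_sum (- Gamma t).
  by have := G0 t tI; rewrite /zero_sum /=; under [X in _ -> X = _]eq_bigr do rewrite mxE; rewrite sumrN => ->; rewrite oppr0.
case: i0 Fi0 => [[i j]|i]; rewrite /F; last first.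
  case: (boolP (i \in P)) => iP xi.
    rewrite -potential0_opp.
    have [||||le _] := @face_bound R N (- Gamma t) (~: P) i w a b bw wa s0 q G0'.
    - by rewrite inE negbK.
    - by rewrite mxE; lra.
    - by move=> j; rewrite inE mxE => jP; have := xP i j iP jP; lra.
    - by move=> j; rewrite inE negbK mxE => /xw; lra.
    move: le; rewrite finset.setCK cP cPc; apply: le_trans; rewrite -eE; lra.
  have [||||le _] := @face_bound R N (Gamma t) P i w a b bw wa s0 q (G0 t tI) => //.
  - by lra.
  - by move=> j jP; have := xP j i jP iP; lra.
  move: le; rewrite cP cPc; apply: le_trans; rewrite -eE; lra.
case: ifP => [/andP[iP jP]|_ /eqP]; last by rewrite oner_eq0.
move=> xij; have [u uE] : exists u, u = Gamma t ord0 i by eexists.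
have uj : Gamma t ord0 j = u by rewrite uE; lra.
have u2 : u ^+ 2 <= w ^+ 2.
  rewrite -subr_ge0 subr_sqr mulr_ge0 //; first by have := xw' j jP; rewrite uj; lra.
  by have := xw i iP; rewrite -uE; lra.
have u3 : u ^+ 2 < 1 / 3 by exact: le_lt_trans w3.
have cPP : #|P| = #|~: P| by rewrite cP cPc.
have uP i' : i' \in P -> u <= Gamma t ord0 i' by move=> i'P; rewrite -uj; exact: xP.
have uP' j' : j' \notin P -> Gamma t ord0 j' <= u by move=> j'P; rewrite uE; exact: xP.
apply: le_trans (pair_bound u3 (G0 t tI) iP jP (esym uE) uj cPP uP uP').
rewrite cP; have -> : u ^+ 4 = (u ^+ 2) ^+ 2 by rewrite -exprM.
have [D DE] : exists D : R, D = saddle_den R M 1 by eexists.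
have D0 : 0 < D by rewrite DE (saddle_den_gt0 R NM N8).
have wD : w ^+ 2 = D^-1 by rewrite w2 -DE mulr1 (_ : (2 - 1) = 1 :> R) ?expr1n ?mul1r //; lra.
have v2 : 0 <= u ^+ 2 by rewrite sqr_ge0.
rewrite wD DE in u2; apply: pair_level_above => //.
Qed.

End Barriers.

(** * An explicit path over a saddle *)

Section SaddlePath.
Variables (R : realType).

(** The left factor below is a square that vanishes at the parameter of the
    saddle. The remaining quadratic in t has the values q0 at t = 0 and q1 at t = 1
    and leading coefficient - q2, and all three are polynomials with nonnegative
    coefficients in the slacks d and e. *)
Lemma ray_poly_ge0 (d e t p q a b n : R) : 0 <= d -> 0 <= e -> 0 <= t -> t <= 1 ->
  p = 2 * d + e -> q = d + e -> a = p + 1 -> b = q + 1 -> n = a + b + 1 ->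
  0 <= (p ^+ 2 - p * q + q ^+ 2) * (n * ((n - 1) * t ^+ 2 - 2 * a * t + a * (b + 1))) ^+ 2
    - (a * q ^+ 2 + (p - q) ^+ 2 + b * p ^+ 2)
      * (((n - 1) * t - a) ^+ 4 + a * (b + 1 - t) ^+ 4 + b * (a + t) ^+ 4).
Proof.
move=> d0 e0 t0 t1 pE qE aE bE nE.
pose q0 : R :=
    18 * d + 6 * e + 84 * d * e + 81 * d ^+ 2 + 19 * e ^+ 2 + 128 * d * e ^+ 2 + 228 * d ^+ 2
    * e + 126 * d ^+ 3 + 22 * e ^+ 3 + 79 * d * e ^+ 3 + 200 * d ^+ 2 * e ^+ 2 + 213 * d ^+ 3
    * e + 81 * d ^+ 4 + 11 * e ^+ 4 + 17 * d * e ^+ 4 + 55 * d ^+ 2 * e ^+ 3 + 85 * d ^+ 3 * e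
    ^+ 2 + 63 * d ^+ 4 * e + 18 * d ^+ 5 + 2 * e ^+ 5.
pose q1 : R :=
    6 * e + 30 * d * e + 19 * e ^+ 2 + 70 * d * e ^+ 2 + 54 * d ^+ 2 * e + 22 * e ^+ 3 + 53 *
    d * e ^+ 3 + 83 * d ^+ 2 * e ^+ 2 + 42 * d ^+ 3 * e + 11 * e ^+ 4 + 13 * d * e ^+ 4 + 31 *
    d ^+ 2 * e ^+ 3 + 32 * d ^+ 3 * e ^+ 2 + 12 * d ^+ 4 * e + 2 * e ^+ 5.
pose q2 : R :=
    18 * d + 12 * e + 132 * d * e + 99 * d ^+ 2 + 44 * e ^+ 2 + 270 * d * e ^+ 2 + 402 * d ^+
    2 * e + 198 * d ^+ 3 + 60 * e ^+ 3 + 216 * d * e ^+ 3 + 481 * d ^+ 2 * e ^+ 2 + 471 * d ^+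
    3 * e + 171 * d ^+ 4 + 36 * e ^+ 4 + 60 * d * e ^+ 4 + 178 * d ^+ 2 * e ^+ 3 + 261 * d ^+
    3 * e ^+ 2 + 189 * d ^+ 4 * e + 54 * d ^+ 5 + 8 * e ^+ 5.
have q0_ge0 : 0 <= q0 by rewrite /q0; nonneg_poly.
have q1_ge0 : 0 <= q1 by rewrite /q1; nonneg_poly.
have q2_ge0 : 0 <= q2 by rewrite /q2; nonneg_poly.
have t1' : 0 <= 1 - t by rewrite subr_ge0.
rewrite [leRHS](_ : _ = ((p + q) * t - (2 * p - q)) ^+ 2
    * ((1 - t) * q0 + t * q1 + q2 * (t * (1 - t)))).
  apply: mulr_ge0; first exact: sqr_ge0.
  by nonneg_poly.
rewrite nE aE bE pE qE /q0 /q1 /q2; ring.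
Qed.

Lemma cts_row (T : topologicalType) n (F : 'I_n -> T -> R) :
  (forall i, continuous (F i)) -> continuous (fun t => \row_i F i t).
Proof.
move=> Fc t; apply/cvg_ballP => e e0.
have : \forall s \near t, forall i, ball (F i t) e (F i s).
  by apply: filter_forall => i; apply: (cvg_ball (Fc i t)).
apply: filterS => s H; split=> // i j.
by rewrite !mxE; exact: H.
Qed.

End SaddlePath.

Section SaddlePath.
Variables (R : realType) (N M : nat).
Hypotheses (NM : N = (2 * M)%N) (N8 : (8 <= N)%N) (N3 : ~~ (3 %| N)%N).
Implicit Types (x : 'rV[R]_N) (P : {set 'I_N}) (k : nat) (t : R).

Lemma potential0_scale (s : R) x : potential 0 (s *: x) =
  s ^+ 4 * (\sum_i x ord0 i ^+ 4) / 4 - s ^+ 2 * (\sum_i x ord0 i ^+ 2) / 2.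
Proof.
rewrite potential0E !mulr_sumr !mulr_suml -sumrB; apply: eq_bigr => i _.
by rewrite mxE /well; field.
Qed.

Lemma two_well_compl P : two_well R (~: P) = - two_well R P.
Proof.
apply/rowP => i; rewrite !mxE finset.setCK inE.
have -> : pattern_norm (#|~: P|%:R : R) #|P|%:R = pattern_norm #|P|%:R #|~: P|%:R.
  by rewrite /pattern_norm; congr Num.sqrt; ring.
by case: (i \in P) => /=; rewrite mulNr ?opprK.
Qed.

Lemma size_class_compl k P : size_class M k P -> (k <= M)%N -> size_class M k (~: P).
Proof.
have := etrans (card_compl P) NM; rewrite /size_class; move: #|P| #|~: P| => p q; clear; lia.
Qed.

Lemma neg_ratio_le (B A Y D : R) : 0 < A -> 0 < D -> 0 <= D * B ^+ 2 - Y * A ->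
  - B ^+ 2 / (4 * A) <= - Y / (4 * D).
Proof.
move=> A0 D0 H; rewrite -subr_ge0.
rewrite (_ : _ - _ = (D * B ^+ 2 - Y * A) / (4 * A * D)); last by field; rewrite !lt0r_neq0.
by rewrite divr_ge0 // ltW // !mulr_gt0.
Qed.

(** The coordinate i moves linearly from its value in the smaller pattern to its
    value in the larger one, all others adjusting, and the resulting direction is
    rescaled to the lowest point of its ray. On the ray of a direction with sum of
    squares B and sum of fourth powers A, that lowest value is - B^2 / (4 A); along
    the path it is highest at a saddle. *)
Lemma majority_path k P i : (1 <= k)%N -> (3 * k < M)%N -> #|P| = (M + k)%N -> i \in P ->
  exists Gamma : R -> 'rV[R]_N, [/\ continuous Gamma, Gamma 0 = two_well R (P :\ i)%SET,
    Gamma 1 = two_well R P &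
    forall t, t \in `[0, 1] -> zero_sum (Gamma t) /\ potential 0 (Gamma t) <= saddle_energy R M k].
Proof.
move=> k1 kM cP iP.
have k1' : 1 <= k%:R :> R by rewrite ler1n.
have kM' : 3 * k%:R + 1 <= M%:R :> R by rewrite -natrM natr1 ler_nat.
pose p : R := M%:R + k%:R - 2; pose q : R := M%:R - k%:R - 1.
pose a := p + 1; pose b := q + 1; pose n := a + b + 1.
have a0 : 0 < a by rewrite /a /p; lra.
have b0 : 0 < b by rewrite /b /q; lra.
pose Q := (P :\ i)%SET.
have iQ : i \notin Q by rewrite !inE eqxx.
have cQ : #|Q|%:R = a.
  by have := cardsD1 i P; rewrite iP cP /= => /(congr1 (fun n => n%:R : R)); rewrite !natrD -/Q /a /p; lra.
have cQc : #|~: Q|%:R = b + 1.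
  have := etrans (card_compl Q) NM => /(congr1 (fun n => n%:R : R)).
  by rewrite !(natrD, natrM) cQ /a /b /p /q; lra.
have cPR : #|P|%:R = a + 1 by rewrite cP natrD /a /p; lra.
have cPc : #|~: P|%:R = b.
  have := etrans (card_compl P) NM; rewrite cP => /(congr1 (fun n => n%:R : R)).
  by rewrite !(natrD, natrM) /b /q; lra.
(* At t = 0 and t = 1 these are multiples of the two minima, with factors
   that the rescaling removes; the sum is 0 for all t. *)
pose f (j : 'I_N) t := if j == i then (n - 1) * t - a else if j \in Q then b + 1 - t else - (a + t).
pose ray t : 'rV[R]_N := \row_j f j t.
pose Bs t := \sum_j f j t ^+ 2; pose As t := \sum_j f j t ^+ 4.
have fsum (G : R -> R) t : \sum_j G (f j t) = G ((n - 1) * t - a) + a * G (b + 1 - t) + b * G (- (a + t)).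
  by rewrite /f (sum_targets G _ _ _ iQ) cQ cQc [b + 1 - 1]addrK.
have BE t : Bs t = n * ((n - 1) * t ^+ 2 - 2 * a * t + a * (b + 1)).
  by rewrite /Bs (fsum (fun r => r ^+ 2)) /n; ring.
have AE t : As t = ((n - 1) * t - a) ^+ 4 + a * (b + 1 - t) ^+ 4 + b * (a + t) ^+ 4.
  by rewrite /As (fsum (fun r => r ^+ 4)); ring.
have A0 t : 0 < As t.
  rewrite AE -addrA ltr_wpDl //; first by rewrite -[4%N]/(2 * 2)%N exprM sqr_ge0.
  have p4 (r : R) : 0 <= r ^+ 4 by rewrite -[4%N]/(2 * 2)%N exprM sqr_ge0.
  have [tb|tb] := ltrP t (b + 1).
    apply: ltr_pwDl; last by apply: mulr_ge0 => //; exact: ltW.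
    by apply: mulr_gt0 => //; apply: exprn_gt0; rewrite subr_gt0.
  apply: ltr_wpDl; first by apply: mulr_ge0 => //; exact: ltW.
  by apply: mulr_gt0 => //; apply: exprn_gt0; rewrite addr_gt0 // (lt_le_trans _ tb) // addr_gt0.
have B0 t : 0 <= Bs t by apply: sumr_ge0 => j _; exact: sqr_ge0.
pose s t := Num.sqrt (Bs t / As t).
have s2 t : s t ^+ 2 = Bs t / As t by rewrite sqr_sqrtr // divr_ge0 // ltW.
have sE t (u v : R) : 0 < u -> Bs t * (u ^+ 2 - u * v + v ^+ 2) = As t -> s t = (pattern_norm u v)^-1.
  move=> u0 E; have n0 := pattern_norm_gt0 v u0.
  rewrite /s (_ : Bs t / As t = ((pattern_norm u v)^-1) ^+ 2).
    by rewrite sqrtr_sqr ger0_norm // invr_ge0 ltW.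
  have : 0 < Bs t * (u ^+ 2 - u * v + v ^+ 2) by rewrite E.
  rewrite -E -pattern_norm_sqr pmulr_lgt0 ?exprn_gt0 // => B0'.
  by field; rewrite (lt0r_neq0 n0) lt0r_neq0.
have fc j : continuous (f j).
  rewrite /f; case: (j == i); last case: (j \in Q).
  - by apply: ctsB; [apply: ctsM; [exact: ctsC|exact: ctsI]|exact: ctsC].
  - by apply: ctsB; [exact: ctsC|exact: ctsI].
  - by apply: ctsN; apply: ctsD; [exact: ctsC|exact: ctsI].
have sc : continuous s.
  move=> t; apply: (@continuous_comp _ _ _ (fun t => Bs t / As t)); last exact: sqrt_continuous.
  apply: cvgM; first by apply: cts_sum => j _; apply: ctsX; exact: fc.
  by apply: cvgV; [rewrite lt0r_neq0|apply: cts_sum => j _; apply: ctsX; exact: fc].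
exists (fun t => \row_j (s t * f j t)); split.
- by apply: cts_row => j; apply: ctsM; [exact: sc|exact: fc].
- have -> : s 0 = (pattern_norm (#|Q|%:R : R) #|~: Q|%:R)^-1.
    apply: sE; first by rewrite cQ.
    by rewrite BE AE cQ cQc /n; ring.
  apply/rowP => j; rewrite !mxE cQ cQc /f -/Q mulrC; congr (_ / _).
  have [->|_] := eqVneq j i; first by rewrite (negPf iQ) mulr0 sub0r.
  by case: ifP => _; rewrite ?subr0 ?addr0.
- have -> : s 1 = (pattern_norm (#|P|%:R : R) #|~: P|%:R)^-1.
    apply: sE; first by rewrite cPR addr_gt0.
    by rewrite BE AE cPR cPc /n; ring.
  apply/rowP => j; rewrite !mxE cPR cPc /f mulrC; congr (_ / _).
  have [->|ji] := eqVneq j i; first by rewrite iP /n; ring.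
  by rewrite !inE ji /=; case: ifP => _; ring.
move=> t; rewrite in_itv /= => /andP[t0 t1].
have -> : \row_j (s t * f j t) = s t *: ray t by apply/rowP => j; rewrite !mxE.
split.
  rewrite /zero_sum /=; under eq_bigr do rewrite !mxE; rewrite -mulr_sumr (fsum id).
  by rewrite (_ : _ + _ + _ = 0) ?mulr0 // /n; ring.
rewrite potential0_scale.
have -> : \sum_j ray t ord0 j ^+ 4 = As t by apply: eq_bigr => j _; rewrite mxE.
have -> : \sum_j ray t ord0 j ^+ 2 = Bs t by apply: eq_bigr => j _; rewrite mxE.
rewrite -[4%N]/(2 * 2)%N exprM s2.
have nA := lt0r_neq0 (A0 t).
rewrite [leLHS](_ : _ = - Bs t ^+ 2 / (4 * As t)); last by field.
have D0 := @saddle_den_gt0 R N M NM N8 k.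
have DE : saddle_den R M k = p ^+ 2 - p * q + q ^+ 2 by rewrite /saddle_den /p /q; ring.
have EE : saddle_energy R M k = - (a * q ^+ 2 + (p - q) ^+ 2 + b * p ^+ 2) / (4 * saddle_den R M k).
  rewrite /saddle_energy; move: (lt0r_neq0 D0); rewrite /saddle_den /a /b /p /q => nD; field.
  exact: nD.
rewrite EE; apply: neg_ratio_le => //; rewrite BE AE DE.
apply: (@ray_poly_ge0 R (2 * k%:R - 1) (M%:R - 3 * k%:R)) => //.
- by lra.
- by lra.
- by rewrite /p; ring.
- by rewrite /q; ring.
Qed.

(** A minority of the right size becomes a majority under x |-> - x. *)
Lemma saddle_path k P : (1 <= k)%N -> (3 * k < M)%N -> size_class M k P ->
  exists (Gamma : R -> 'rV[R]_N) (Q : {set 'I_N}), [/\ size_class M k.-1 Q, continuous Gamma, Gamma 0 = two_well R P,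
    Gamma 1 = two_well R Q &
    forall t, t \in `[0, 1] -> zero_sum (Gamma t) /\ potential 0 (Gamma t) <= saddle_energy R M k].
Proof.
move=> k1 kM cP.
have rev (Gamma : R -> 'rV[R]_N) : continuous Gamma -> continuous (fun t => Gamma (1 - t)).
  move=> Gc t; apply: (@continuous_comp _ _ _ (fun t => 1 - t)); last exact: Gc.
  by apply: (@ctsB _ _ (fun=> 1) id); [exact: ctsC|exact: ctsI].
have rev01 t : t \in `[0, 1] -> 1 - t \in `[0, 1].
  by rewrite !in_itv /= subr_ge0 gerBl andbC.
have main P' : #|P'| = (M + k)%N -> exists (Gamma : R -> 'rV[R]_N) (Q : {set 'I_N}), [/\ size_class M k.-1 Q, continuous Gamma, Gamma 0 = two_well R P',
    Gamma 1 = two_well R Q &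
    forall t, t \in `[0, 1] -> zero_sum (Gamma t) /\ potential 0 (Gamma t) <= saddle_energy R M k].
  move=> cP'; have /card_gt0P[i iP] : (0 < #|P'|)%N by rewrite cP'; clear -k1; lia.
  have [Gamma [Gc G0 G1 Gt]] := majority_path k1 kM cP' iP.
  exists (fun t => Gamma (1 - t)), (P' :\ i)%SET; rewrite subr0 subrr; split.
  2: exact: rev.
  2: exact: G1.
  2: exact: G0.
  2: by move=> t /rev01; exact: Gt.
  have := cardsD1 i P'; rewrite iP cP' /size_class; move: #|(P' :\ i)%SET| => c; clear -k1; lia.
case/orP: (cP) => /eqP cPk; first exact: main.
have kM' : (k <= M)%N by clear -kM; lia.
have [|Gamma [Q [cQ Gc G0 G1 Gt]]] := main (~: P).
  by have := etrans (card_compl P) NM; move: cPk; move: #|P| #|~: P| => p q; clear; lia.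
exists (fun t => - Gamma t), (~: Q); split.
- by apply: size_class_compl => //; clear -kM'; lia.
- by move=> t; apply: cvgN; exact: Gc.
- by rewrite G0 two_well_compl opprK.
- by rewrite G1 two_well_compl.
move=> t /Gt[z0 le]; split; last by rewrite potential0_opp.
by move: z0; rewrite /zero_sum /= => z0; under eq_bigr do rewrite mxE; rewrite sumrN z0 oppr0.
Qed.

End SaddlePath.

(** * Strong convexity on the region of a sign pattern *)

Section WeakCoupling.
Variables (R : realType) (N : nat).
Hypothesis (N0 : (0 < N)%N).
Implicit Types (x y v : 'rV[R]_N) (P : {set 'I_N}) (g : R).

(** The entries of the gradient, up to a multiple of (1, ..., 1). *)
Definition force g x i : R := x ord0 i ^+ 3 - x ord0 i
  + g / 2 * (2 * x ord0 i - x ord0 (ordS i) - x ord0 (ord_pred i)).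

Lemma grad_along_force g v x : grad_along g v x = \sum_i force g x i * v ord0 i.
Proof.
rewrite /grad_along /force.
under [RHS]eq_bigr do rewrite mulrDl -mulrA.
rewrite big_split /= -mulr_sumr; congr (_ + _ * _).
have re (F : 'I_N -> R) : \sum_i F i = \sum_i F (ordS i) by rewrite (reindex_inj (@ordS_inj N)).
under eq_bigr do rewrite mulrBr; rewrite sumrB.
rewrite [RHS](eq_bigr (fun i => (x ord0 i - x ord0 (ord_pred i)) * v ord0 i + 
   (x ord0 i - x ord0 (ordS i)) * v ord0 i)); last by move=> i _; ring.
rewrite big_split /= [X in _ = X + _]re.
under [X in _ = X + _]eq_bigr do rewrite ordSK.
by congr (_ + _); rewrite -sumrN; apply: eq_bigr => i _; ring.
Qed.

Lemma stationary_force g x : stationary g x -> forall i j, force g x i = force g x j.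
Proof.
move=> /stationaryE[_ H] i j; have := H _ (swap_vec_zero_sum R i j).
by rewrite grad_along_force (sum_swap_vec (force g x)) => /eqP; rewrite subr_eq0 => /eqP.
Qed.

(** Maximum principle: at the largest coordinate u the coupling pulls down, at
    the smallest coordinate w it pulls up, so that u^3 - u <= w^3 - w and hence
    u^2 + u w + w^2 <= 1. *)
Lemma stationary_bound g x : 0 <= g -> stationary g x -> forall i, x ord0 i ^+ 2 <= 4 / 3.
Proof.
move=> g0 st; have F := stationary_force st; have [x0 _] := st.
pose i0 := Ordinal N0.
have [imax _ xmax] := @arg_maxP _ _ _ i0 predT (fun i => x ord0 i) isT.
have [imin _ xmin] := @arg_minP _ _ _ i0 predT (fun i => x ord0 i) isT.
pose u := x ord0 imax; pose w := x ord0 imin.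
have xu i : x ord0 i <= u by exact: xmax.
have xw i : w <= x ord0 i by exact: xmin.
have u0 : 0 <= u.
  rewrite leNgt; apply/negP => u0; have : \sum_i x ord0 i <= \sum_(i < N) u by exact: ler_sum.
  by rewrite x0 sumr_const card_ord pmulrn_lge0 // leNgt u0.
have w0 : w <= 0.
  rewrite leNgt; apply/negP => w0; have : \sum_(i < N) w <= \sum_i x ord0 i by exact: ler_sum.
  by rewrite x0 sumr_const card_ord pmulrn_lle0 // leNgt w0.
have uw : u ^+ 3 - u <= w ^+ 3 - w.
  have := F imax imin; rewrite /force -/u -/w.
  have h1 : 0 <= g / 2 * (2 * u - x ord0 (ordS imax) - x ord0 (ord_pred imax)).
    by rewrite mulr_ge0 ?divr_ge0 //; have := xu (ordS imax); have := xu (ord_pred imax); lra.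
  have h2 : g / 2 * (2 * w - x ord0 (ordS imin) - x ord0 (ord_pred imin)) <= 0.
    by rewrite mulr_ge0_le0 ?divr_ge0 //; have := xw (ordS imin); have := xw (ord_pred imin); lra.
  by move=> h; lra.
have bd : u ^+ 2 <= 4 / 3 /\ w ^+ 2 <= 4 / 3.
  have [uw0|uw0] := eqVneq u w.
    by have [-> ->] : u = 0 /\ w = 0 by [split; lra]; split; lra.
  have uw1 : 0 < u - w by rewrite lt_neqAle eq_sym subr_eq0 uw0 subr_ge0 (le_trans w0).
  have : u ^+ 2 + u * w + w ^+ 2 - 1 <= 0.
    rewrite -(pmulr_rle0 _ uw1) [X in X <= 0](_ : _ = (u ^+ 3 - u) - (w ^+ 3 - w)); last by ring.
    by rewrite subr_le0.
  move=> h; have := sqr_ge0 (u / 2 + w); have := sqr_ge0 (u + w / 2) => h1 h2; split; lra.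
move=> i; have := xu i; have := xw i; case: bd => h1 h2 h3 h4.
have [xi|xi] := lerP 0 (x ord0 i).
  by apply: le_trans h1; rewrite ler_pXn2r ?nnegrE.
by apply: le_trans h2; rewrite -(sqrrN (x ord0 i)) -(sqrrN w) ler_pXn2r ?nnegrE ?oppr_ge0 ?(ltW xi) // lerN2.
Qed.

Lemma sqr_le_norm2 (r : R) : r ^+ 2 <= 4 / 3 -> `|r| <= 2.
Proof.
move=> h; rewrite -(@ler_pXn2r _ 2) ?nnegrE // real_normK ?num_real //; lra.
Qed.

(** A threshold between the inflection point of the double well and the absolute
    values of all coordinates of the uncoupled local minima. Beyond it the
    potential is strongly convex, with a constant depending on N only. *)
Definition rho : R := Num.sqrt (1 / 3 + 1 / (6 * N%:R)).

Lemma NR_ge1 : 1 <= N%:R :> R. Proof. by rewrite ler1n. Qed.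

Lemma rho_sqr : rho ^+ 2 = 1 / 3 + 1 / (6 * N%:R).
Proof. by rewrite sqr_sqrtr // addr_ge0 ?divr_ge0 ?mulr_ge0. Qed.

Lemma rho_gt0 : 0 < rho.
Proof. by rewrite sqrtr_gt0 addr_gt0 ?divr_gt0 ?mulr_gt0 // ltr0n. Qed.

Definition convexity : R := 1 / (2 * N%:R).

Lemma convexity_gt0 : 0 < convexity.
Proof. by rewrite divr_gt0 ?mulr_gt0 ?ltr0n. Qed.

Lemma rho_convexity : 3 * rho ^+ 2 - 1 = convexity.
Proof. by rewrite rho_sqr /convexity; field; rewrite pnatr_eq0 -lt0n. Qed.

Lemma rho_lt1 : rho <= 1.
Proof.
rewrite -(@ler_pXn2r _ 2) ?nnegrE ?ler01 // ?(ltW rho_gt0) // expr1n rho_sqr.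
have : 1 / (6 * N%:R) <= 1 / 6 :> R.
  by rewrite ler_pM2l // lef_pV2 ?posrE ?mulr_gt0 ?ltr0n // ler_peMr ?NR_ge1.
lra.
Qed.

Definition region P x : Prop :=
  zero_sum x /\ forall i, if i \in P then rho <= x ord0 i else x ord0 i <= - rho.

Lemma region_same_sign P x y i : region P x -> region P y -> rho ^+ 2 <= x ord0 i * y ord0 i.
Proof.
move=> [_ /(_ i)] xi [_ /(_ i)]; have r0 := ltW rho_gt0.
case: (i \in P) xi => xi yi; rewrite expr2; first by rewrite ler_pM.
by rewrite -[leRHS]mulrNN; apply: ler_pM; lra.
Qed.

Lemma region_sqr P x i : region P x -> rho ^+ 2 <= x ord0 i ^+ 2.
Proof. by move=> xP; rewrite [leRHS]expr2; exact: (region_same_sign i xP xP). Qed.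

Lemma region_separated P x : region P x -> separated P x.
Proof.
move=> xP i; split; last first.
  case: xP => _ /(_ i); case: ifP => _ h; first exact: lt_le_trans rho_gt0 h.
  by apply: le_lt_trans h _; rewrite oppr_lt0 rho_gt0.
apply: lt_le_trans (region_sqr i xP); rewrite rho_sqr ltrDl divr_gt0 ?mulr_gt0 ?ltr0n //.
Qed.

Definition sqdist x y : R := \sum_i (y ord0 i - x ord0 i) ^+ 2.

Lemma sqdist_ge0 x y : 0 <= sqdist x y.
Proof. by apply: sumr_ge0 => i _; exact: sqr_ge0. Qed.

Lemma sqdistC x y : sqdist x y = sqdist y x.
Proof. by apply: eq_bigr => i _; rewrite -sqrrN opprB. Qed.

Lemma sqdist_coord x y i : (y ord0 i - x ord0 i) ^+ 2 <= sqdist x y.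
Proof.
by rewrite /sqdist (bigD1 i) //= lerDl; apply: sumr_ge0 => j _; exact: sqr_ge0.
Qed.

(** The coupling is convex. In each coordinate the second-order remainder of the
    well is a square times y^2 + 2 x y + 3 x^2 - 2, and beyond the threshold all
    three products are at least rho^2. *)
Lemma region_convex P g x y : 0 <= g -> region P x -> region P y ->
  potential g x + grad_along g (y - x) x + convexity / 2 * sqdist x y <= potential g y.
Proof.
move=> g0 xP yP; rewrite -subr_ge0.
have -> : potential g y - (potential g x + grad_along g (y - x) x + convexity / 2 * sqdist x y) =
  \sum_i 4^-1 * (y ord0 i - x ord0 i) ^+ 2 * (y ord0 i ^+ 2 + 2 * (x ord0 i * y ord0 i) + 3 * x ord0 i ^+ 2 - 2 - 2 * convexity)
  + g / 4 * \sum_i ((y ord0 (ordS i) - x ord0 (ordS i)) - (y ord0 i - x ord0 i)) ^+ 2.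
  rewrite /potential /grad_along /sqdist !mulr_sumr -!big_split -sumrB /=.
  by apply: eq_bigr => i _; rewrite !mxE; field.
apply: addr_ge0; last first.
  by rewrite mulr_ge0 ?divr_ge0 // sumr_ge0 // => i _; exact: sqr_ge0.
apply: sumr_ge0 => i _; apply: mulr_ge0; first by rewrite mulr_ge0 ?sqr_ge0.
have := region_sqr i xP; have := region_sqr i yP; have := region_same_sign i xP yP.
by rewrite -rho_convexity; lra.
Qed.

Lemma zero_sumB x y : zero_sum x -> zero_sum y -> zero_sum (y - x).
Proof.
move=> x0 y0; rewrite /zero_sum /=; under eq_bigr do rewrite !mxE.
by rewrite sumrB x0 y0 subrr.
Qed.

Lemma stationary_region_min P g x y : 0 <= g -> region P x -> region P y -> stationary g x ->
  potential g x + convexity / 2 * sqdist x y <= potential g y.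
Proof.
move=> g0 xP yP /stationaryE[x0 H].
have := region_convex g0 xP yP; rewrite H ?addr0 //.
by apply: zero_sumB; [case: xP|case: yP].
Qed.

Lemma region_index0 P g x : 0 <= g -> region P x -> stationary g x -> local_minimum g x.
Proof.
move=> g0 xP st; split=> //; apply/morse_index0P => v _; rewrite /hess_form addr_ge0 //.
  apply: sumr_ge0 => i _; rewrite -mulrA -expr2 mulr_ge0 ?sqr_ge0 //.
  have := region_sqr i xP; have := rho_convexity; have := convexity_gt0; lra.
by rewrite mulr_ge0 ?divr_ge0 // sumr_ge0 // => i _; rewrite -expr2 sqr_ge0.
Qed.

Definition coupling x : R := \sum_i (x ord0 (ordS i) - x ord0 i) ^+ 2.

Lemma potentialE g x : potential g x = potential 0 x + g / 4 * coupling x.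
Proof. by rewrite /potential !mul0r addr0. Qed.

Lemma coupling_ge0 x : 0 <= coupling x.
Proof. by apply: sumr_ge0 => i _; exact: sqr_ge0. Qed.

Lemma coupling_le b x : (forall i, `|x ord0 i| <= b) -> coupling x <= 4 * N%:R * b ^+ 2.
Proof.
move=> xb; have : \sum_(i < N) (2 * b) ^+ 2 = 4 * N%:R * b ^+ 2.
  by rewrite sumr_const card_ord -mulr_natl; ring.
move=> <-; apply: ler_sum => i _.
have b0 : 0 <= b by apply: le_trans (xb i).
rewrite -(real_normK (num_real (x ord0 (ordS i) - x ord0 i))) ler_pXn2r ?nnegrE ?mulr_ge0 //.
by apply: le_trans (ler_normB _ _) _; have := xb i; have := xb (ordS i); lra.
Qed.

Lemma coupling_lipschitz b e x y : (forall i, `|x ord0 i| <= b) -> (forall i, `|y ord0 i| <= b) ->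
  (forall i, `|y ord0 i - x ord0 i| <= e) -> `|coupling y - coupling x| <= 8 * N%:R * b * e.
Proof.
move=> xb yb xye; rewrite /coupling -sumrB.
apply: le_trans (ler_norm_sum _ _ _) _.
have <- : \sum_(i < N) (2 * e) * (4 * b) = 8 * N%:R * b * e.
  by rewrite sumr_const card_ord -mulr_natl; ring.
apply: ler_sum => i _.
rewrite (_ : _ - _ = ((y ord0 (ordS i) - x ord0 (ordS i)) - (y ord0 i - x ord0 i)) *
   ((y ord0 (ordS i) - y ord0 i) + (x ord0 (ordS i) - x ord0 i))); last by ring.
rewrite normrM ler_pM //.
  by apply: le_trans (ler_normB _ _) _; have := xye i; have := xye (ordS i); lra.
apply: le_trans (ler_normD _ _) _.
have := le_trans (ler_normB (y ord0 (ordS i)) (y ord0 i)) (lerD (yb _) (yb _)).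
have := le_trans (ler_normB (x ord0 (ordS i)) (x ord0 i)) (lerD (xb _) (xb _)).
by lra.
Qed.

(** The stationary points which continue [two_well P] under weak coupling, described
    by the region instead of by a curve. *)
Definition branch g P x : Prop := region P x /\ stationary g x.

Lemma branch_bound g P x i : 0 <= g -> branch g P x -> `|x ord0 i| <= 2.
Proof. by move=> g0 [_ st]; apply: sqr_le_norm2; exact: stationary_bound g0 st i. Qed.

(** Each of x and y minimises its own potential on the region, with a quadratic
    gain at the other point. Adding both inequalities bounds the distance by the
    variation of the coupling energy. *)
Lemma branch_lipschitz P g h x y i : 0 <= g -> 0 <= h -> branch g P x -> branch h P y ->
  `|y ord0 i - x ord0 i| <= 8 * N%:R ^+ 2 * `|h - g|.
Proof.
move=> g0 h0 bx by_.
have [j _ jmax] := @arg_maxP _ _ _ i predT (fun i => `|y ord0 i - x ord0 i|) isT.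
apply: le_trans (jmax i isT) _.
set e := `|y ord0 j - x ord0 j|.
have e0 : 0 <= e by exact: normr_ge0.
have [e00|en0] := eqVneq e 0; first by rewrite e00 !mulr_ge0 ?exprn_ge0.
have ep : 0 < e by rewrite lt_neqAle eq_sym en0.
have h1 := stationary_region_min g0 bx.1 by_.1 bx.2.
have h2 := stationary_region_min h0 by_.1 bx.1 by_.2.
have ee : e ^+ 2 <= sqdist x y by rewrite real_normK ?num_real //; exact: sqdist_coord.
have cl := coupling_lipschitz (fun i => branch_bound i g0 bx) (fun i => branch_bound i h0 by_) (fun i => jmax i isT).
rewrite !(potentialE g, potentialE h) (sqdistC y x) in h1 h2.
have k1 : convexity * sqdist x y <= (g - h) / 4 * (coupling y - coupling x) by lra.
have k2 : (g - h) / 4 * (coupling y - coupling x) <= `|h - g| / 4 * (8 * N%:R * 2 * e).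
  apply: le_trans (ler_norm _) _; rewrite normrM ler_pM // ?normr_ge0 //.
  by rewrite normrM distrC ger0_norm.
have k3 : convexity * e ^+ 2 <= `|h - g| / 4 * (8 * N%:R * 2 * e).
  by apply: le_trans k2; apply: le_trans k1; rewrite ler_pM2l // convexity_gt0.
rewrite -(ler_pM2r ep) -(ler_pM2l convexity_gt0) -expr2.
apply: le_trans k3 _; rewrite /convexity le_eqVlt; apply/orP; left; apply/eqP.
by field; rewrite pnatr_eq0 -lt0n.
Qed.

Lemma branch_unique g P x y : 0 <= g -> branch g P x -> branch g P y -> x = y.
Proof.
move=> g0 bx by_; apply/rowP => i; apply/eqP; rewrite eq_sym -subr_eq0 -normr_le0.
by have := branch_lipschitz i g0 g0 bx by_; rewrite subrr normr0 mulr0.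
Qed.

End WeakCoupling.

(** * Continuation of the minima under weak coupling *)

Section Branches.
Variables (R : realType) (N : nat).
Hypothesis (N0 : (0 < N)%N).
Implicit Types (x y v : 'rV[R]_N) (P : {set 'I_N}) (g : R).

(** The distance that the uncoupled minima keep from the threshold, see
    [two_well_margin]. *)
Definition margin : R := 1 / (18 * N%:R).

Lemma margin_gt0 : 0 < margin.
Proof. by rewrite divr_gt0 ?mulr_gt0 ?ltr0n. Qed.

(** For counts p and q the condition p + 1 <= 2 q, an integer form of balance,
    keeps q / s beyond the inflection point by an amount of order 1 / N. *)
Lemma outer_margin (p q s : R) : 0 < p -> 0 < q -> p + 1 <= 2 * q -> p + q = N%:R ->
  0 < s -> s ^+ 2 = p ^+ 2 - p * q + q ^+ 2 -> rho R N + margin <= q / s.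
Proof.
move=> p0 q0 pq pqN s0 s2.
have n1 := NR_ge1 R N0; have n0 : 0 < N%:R :> R by rewrite ltr0n.
have r0 := rho_gt0 R N0; have m0 := margin_gt0.
have qs : 0 <= q / s by rewrite divr_ge0 // ltW.
rewrite -(@ler_pXn2r _ 2) ?nnegrE ?addr_ge0 ?(ltW r0) ?(ltW m0) //.
have r1 := rho_lt1 R N0.
apply: (@le_trans _ _ (1 / 3 + 1 / (3 * N%:R))).
  rewrite sqrrD (rho_sqr R N).
  have h1 : rho R N * margin <= margin by rewrite ler_piMl // ltW.
  have h2 : margin ^+ 2 <= margin / 18.
    rewrite expr2 ler_pM2l // /margin mul1r.
    by rewrite lef_pV2 ?posrE ?mulr_gt0 // ler_peMr.
  have -> : 1 / (6 * N%:R) = 3 * margin by rewrite /margin; field; rewrite lt0r_neq0.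
  have -> : 1 / (3 * N%:R) = 6 * margin by rewrite /margin; field; rewrite lt0r_neq0.
  by rewrite mulr2n; lra.
rewrite expr_div_n s2 -subr_ge0.
have D0 : 0 < p ^+ 2 - p * q + q ^+ 2 by rewrite -s2 exprn_gt0.
have -> : q ^+ 2 / (p ^+ 2 - p * q + q ^+ 2) - (1 / 3 + 1 / (3 * N%:R)) =
  ((2 * q - p - 1) * N%:R ^+ 2 + 3 * p * q) / (3 * N%:R * (p ^+ 2 - p * q + q ^+ 2)).
  rewrite -pqN in n0 *; field.
  by rewrite (lt0r_neq0 D0) (lt0r_neq0 n0).
apply: divr_ge0; last by apply: mulr_ge0; [rewrite mulr_ge0 // ltW|exact: ltW].
apply: addr_ge0; last by rewrite !mulr_ge0 // ltW.
by rewrite mulr_ge0 ?sqr_ge0 //; lra.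
Qed.

Lemma two_well_margin P i : balanced P ->
  if i \in P then rho R N + margin <= two_well R P ord0 i else two_well R P ord0 i <= - (rho R N + margin).
Proof.
move=> bP; have [p0 q0 pq qp] := balanced_card bP.
have pqN : #|P|%:R + #|~: P|%:R = N%:R :> R by rewrite -natrD card_compl.
have p0' : 0 < #|P|%:R :> R by rewrite ltr0n.
have q0' : 0 < #|~: P|%:R :> R by rewrite ltr0n.
have n0 := pattern_norm_gt0 (#|~: P|%:R : R) p0'.
have n2 := pattern_norm_sqr (#|P|%:R : R) #|~: P|%:R.
rewrite mxE; case: (i \in P).
  by apply: (outer_margin p0' q0' _ pqN n0 n2); rewrite natr1 -natrM ler_nat.
rewrite mulNr lerN2; apply: (outer_margin q0' p0' _ _ n0 _).
- by rewrite natr1 -natrM ler_nat.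
- by rewrite addrC.
by rewrite n2; ring.
Qed.

Lemma two_well_branch P : balanced P -> branch 0 P (two_well R P).
Proof.
move=> bP; have [tv _ _ _] := two_well_three_valued R bP; split; last exact: stationary_three_valued tv.
split; first exact: two_well_zero_sum.
move=> i; have := two_well_margin i bP; have := margin_gt0.
by case: ifP => _; lra.
Qed.

(** Under this smallness condition, points of the region that are at most as high
    as [two_well P] stay within the margin of it. *)
Definition weak g : Prop := 0 <= g /\ 16 * N%:R ^+ 2 * g < margin ^+ 2.

Lemma weak0 : weak 0.
Proof. by split=> //; rewrite mulr0 exprn_gt0 // margin_gt0. Qed.

Lemma weak_le g h : 0 <= h -> h <= g -> weak g -> weak h.
Proof.
move=> h0 hg [g0 gm]; split=> //; apply: le_lt_trans gm.
by rewrite ler_wpM2l // mulr_ge0 // exprn_ge0.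
Qed.

(** The coupling energy of [two_well P] is at most of order g, and strong
    convexity turns an energy difference into a distance. *)
Lemma low_region_near P g y i : balanced P -> weak g -> region P y ->
  potential g y <= potential g (two_well R P) -> `|y ord0 i - two_well R P ord0 i| < margin.
Proof.
move=> bP [g0 gm] yP le; have [tP st] := two_well_branch bP.
have n0 : 0 < N%:R :> R by rewrite ltr0n.
have h1 := stationary_region_min N0 (lexx 0) tP yP st.
have tb j : `|two_well R P ord0 j| <= 2 by apply: (branch_bound N0 j (lexx 0)); split; [exact: tP|].
have h2 := coupling_le tb; have h3 := coupling_ge0 y; have h4 := coupling_ge0 (two_well R P).
rewrite !(potentialE g) in le.
have h5 : g / 4 * coupling (two_well R P) <= g / 4 * (4 * N%:R * 2 ^+ 2).
  by rewrite ler_wpM2l // divr_ge0.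
have h6 : 0 <= g / 4 * coupling y by rewrite mulr_ge0 // divr_ge0.
have h7 : convexity R N / 2 * sqdist (two_well R P) y <= 4 * N%:R * g by lra.
have h8 : sqdist (two_well R P) y <= 16 * N%:R ^+ 2 * g.
  have c0 : 0 < convexity R N / 2 by rewrite divr_gt0 // convexity_gt0.
  rewrite -(ler_pM2l c0); apply: le_trans h7 _.
  by rewrite le_eqVlt; apply/orP; left; apply/eqP; rewrite /convexity; field; rewrite lt0r_neq0.
rewrite -(@ltr_pXn2r _ 2) ?nnegrE ?(ltW margin_gt0) // real_normK ?num_real //.
by apply: le_lt_trans gm; apply: le_trans h8; exact: sqdist_coord.
Qed.

Lemma branch_near P g y i : balanced P -> weak g -> branch g P y ->
  `|y ord0 i - two_well R P ord0 i| < margin.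
Proof.
move=> bP wg [yP st]; apply: (low_region_near _ bP wg yP).
have [tP _] := two_well_branch bP.
have [g0 _] := wg; have := stationary_region_min N0 g0 yP tP st.
move=> h; apply: le_trans h; rewrite lerDl mulr_ge0 ?sqdist_ge0 //.
by rewrite divr_ge0 // ltW // convexity_gt0.
Qed.

Lemma near_interior P y i : balanced P -> `|y ord0 i - two_well R P ord0 i| < margin ->
  if i \in P then rho R N < y ord0 i else y ord0 i < - rho R N.
Proof.
move=> bP; have := two_well_margin i bP; rewrite ltr_norml => h /andP[h1 h2].
by case: (i \in P) h => h; lra.
Qed.

(** A nonzero slope would dominate all higher terms of the quartic expansion on a
    small step against it. *)
Lemma interior_min_stationary g y (c : R) : 0 < c -> zero_sum y ->
  (forall z, zero_sum z -> (forall i, `|z ord0 i - y ord0 i| <= c) -> potential g y <= potential g z) ->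
  stationary g y.
Proof.
move=> c0 y0 ymin; apply/stationaryE; split=> // v v0.
set d := grad_along g v y.
pose A := `|hess_form g y v v / 2|; pose B := `|\sum_(i < N) y ord0 i * v ord0 i ^+ 3|.
pose C := `|\sum_(i < N) v ord0 i ^+ 4 / 4|; pose K := A + B + C + 1.
have A0 : 0 <= A by exact: normr_ge0.
have B0 : 0 <= B by exact: normr_ge0.
have C0 : 0 <= C by exact: normr_ge0.
have K0 : 0 < K by rewrite /K; lra.
pose W := 1 + \sum_i `|v ord0 i|.
have W0 : 0 < W by rewrite ltr_pwDl // sumr_ge0.
have vW i : `|v ord0 i| <= W.
  by rewrite /W (bigD1 i) //= addrCA lerDl addr_ge0 // sumr_ge0.
have key (h : R) : `|h| <= 1 -> `|h| <= c / W -> 0 <= h * d + h ^+ 2 * K.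
  move=> h1 hc.
  have z0 : zero_sum (y + h *: v).
    by rewrite /zero_sum /=; under eq_bigr do rewrite !mxE; rewrite big_split /= -mulr_sumr y0 v0 mulr0 addr0.
  have := ymin _ z0; rewrite potential_taylor -/d => H.
  have {}H : 0 <= h * d + h ^+ 2 * (hess_form g y v v / 2) + h ^+ 3 * (\sum_(i < N) y ord0 i * v ord0 i ^+ 3)
      + h ^+ 4 * (\sum_(i < N) v ord0 i ^+ 4 / 4).
    rewrite -(lerD2l (potential g y)) addr0 !addrA; apply: H => i.
    rewrite !mxE addrAC subrr add0r normrM.
    apply: le_trans (ler_pM (normr_ge0 _) (normr_ge0 _) hc (vW i)) _.
    by rewrite divfK // lt0r_neq0.
  apply: le_trans H _; rewrite -!addrA lerD2l /K.
  have hh : 0 <= h ^+ 2 by exact: sqr_ge0.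
  have e2 : h ^+ 2 * (hess_form g y v v / 2) <= h ^+ 2 * A by rewrite ler_wpM2l // ler_norm.
  have b3 (w : R) : h ^+ 3 * w <= h ^+ 2 * `|w|.
    rewrite exprSr -mulrA ler_wpM2l //; apply: le_trans (ler_norm _) _.
    by rewrite normrM ler_piMl.
  have b4 (w : R) : h ^+ 4 * w <= h ^+ 2 * `|w|.
    rewrite exprSr -mulrA; apply: le_trans (b3 _) _; rewrite ler_wpM2l //.
    by rewrite normrM ler_piMl.
  have e3 := b3 (\sum_(i < N) y ord0 i * v ord0 i ^+ 3); have e4 := b4 (\sum_(i < N) v ord0 i ^+ 4 / 4).
  rewrite -/B in e3; rewrite -/C in e4; rewrite !mulrDr mulr1; lra.
apply/eqP; apply: contraT => d0.
pose m := Num.min (Num.min 1 (c / W)) (`|d| / (2 * K)).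
have cW : 0 < c / W by rewrite divr_gt0.
have dK : 0 < `|d| / (2 * K) by rewrite divr_gt0 ?mulr_gt0 ?normr_gt0.
have m0 : 0 < m by rewrite !lt_min ltr01 cW.
have m1 : m <= 1 by rewrite !ge_min lexx.
have mc : m <= c / W by rewrite !ge_min lexx orbT.
have md : m <= `|d| / (2 * K) by rewrite !ge_min lexx !orbT.
have sg : Num.sg d * d = `|d| by rewrite -normrEsg.
have sg1 : `|Num.sg d| = 1 by rewrite normr_sg d0.
have := key (- (m * Num.sg d)).
rewrite normrN normrM sg1 mulr1 (gtr0_norm m0) => /(_ m1 mc).
rewrite sqrrN exprMn sqr_sg d0 mulr1 mulNr -mulrA sg leNgt => /negP[].
have h : m * (2 * K) <= `|d| by rewrite -ler_pdivlMr ?mulr_gt0.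
have h2 : m * (m * (2 * K)) <= m * `|d| by rewrite ler_pM2l.
have h3 : 0 < m * `|d| by rewrite mulr_gt0 ?normr_gt0.
by rewrite expr2 -mulrA; lra.
Qed.

Lemma cts_potential g : continuous (potential g : 'rV[R]_N -> R).
Proof.
rewrite /potential; apply: ctsD; last first.
  apply: ctsM; first exact: ctsC.
  by apply: cts_sum => i _; apply: ctsX; apply: ctsB; exact: cts_coord.
by apply: cts_sum => i _; apply: ctsB; (apply: ctsM; [exact: ctsC|apply: ctsX; exact: cts_coord]).
Qed.

Lemma closed_region P : closed (region P : set 'rV[R]_N).
Proof.
rewrite (_ : region P = [set x | \sum_i x ord0 i = 0] `&`
   [set x | forall i, 0 <= (if i \in P then x ord0 i - rho R N else - rho R N - x ord0 i)]).
  apply: closedI; first by apply: closed_fun_eq; apply: cts_sum => i _; exact: cts_coord.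
  apply: closed_forall => i; apply: closed_fun_ge.
  by case: (i \in P); apply: ctsB; by [exact: cts_coord|exact: ctsC].
apply/seteqP; split=> x [x0 xi]; split=> // i; move: (xi i); case: (i \in P); lra.
Qed.

(** Minimise over the region. By [low_region_near] the minimiser lies in the
    interior of the region, hence is stationary. *)
Lemma exists_branch P g : balanced P -> weak g -> exists y, branch g P y.
Proof.
move=> bP wg; have [tP st0] := two_well_branch bP.
have tb j : `|two_well R P ord0 j| <= 2 by apply: (branch_bound N0 j (lexx 0)); split; [exact: tP|].
pose K := region P `&` [set x : 'rV[R]_N | forall i, 0 <= 2 - `|x ord0 i|].
have Kt : K (two_well R P) by split=> //= i; rewrite subr_ge0.
have Kcl : closed K.
  apply: closedI; first exact: closed_region.
  apply: closed_forall => i; apply: closed_fun_ge; apply: ctsB; first exact: ctsC.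
  by apply: cts_abs; exact: cts_coord.
have Kb x i : K x -> `|x ord0 i| <= 2 by move=> [_ /(_ i)]; rewrite subr_ge0.
have [y [yP _] ymin] := box_closed_min (ex_intro _ _ Kt) Kcl Kb (@cts_potential g).
have near i := low_region_near i bP wg yP (ymin _ Kt).
have int i := near_interior bP (near i).
exists y; split=> //.
have tb' j : two_well R P ord0 j ^+ 2 <= 4 / 3 := stationary_bound N0 (lexx 0) st0 j.
have m1 : margin <= 1 / 18.
  by rewrite ler_pM2l // lef_pV2 ?posrE ?mulr_gt0 ?ltr0n // ler_peMr // (NR_ge1 R N0).
have tb2 j : `|two_well R P ord0 j| <= 5 / 4.
  rewrite -(@ler_pXn2r _ 2) ?nnegrE // real_normK ?num_real //; have := tb' j; lra.
have yb i : `|y ord0 i| <= 4 / 3.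
  have := near i; have := tb2 i; rewrite ler_norml ltr_norml ler_norml => /andP[h1 h2] /andP[h3 h4].
  by apply/andP; split; lra.
pose gap i := if i \in P then y ord0 i - rho R N else - rho R N - y ord0 i.
have gap0 i : 0 < gap i by have := int i; rewrite /gap; case: (i \in P); rewrite subr_gt0.
pose c := Num.min (1 / 3) (\big[Num.min/1]_i gap i).
have c0 : 0 < c by rewrite lt_min divr_gt0 //=; apply/bigmin_gtP; split.
apply: (interior_min_stationary c0); first by case: yP.
move=> z z0 zy; apply: ymin; split.
  split=> // i; have := zy i; have : c <= gap i by rewrite ge_min bigmin_le_cond ?orbT.
  by rewrite ler_norml /gap; case: (i \in P) => h1 /andP[h2 h3]; lra.
move=> i /=; rewrite subr_ge0; have := zy i; have := yb i; have : c <= 1 / 3 by rewrite ge_min lexx.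
rewrite !ler_norml => h1 /andP[h2 h3] /andP[h4 h5]; apply/andP; split; lra.
Qed.

Lemma lipschitz_cts (f : R -> R) (L : R) : 0 < L -> (forall s t, `|f s - f t| <= L * `|s - t|) -> continuous f.
Proof.
move=> L0 fL t; apply/cvgrPdist_lt => e e0.
near=> s.
have : `|t - s| < e / L by near: s; apply: cvgr_dist_lt => //; rewrite divr_gt0.
by rewrite ltr_pdivlMr // mulrC; apply: le_lt_trans.
Unshelve. all: by end_near. Qed.

Lemma clip_lipschitz (b s t : R) : 0 <= b ->
  `|Num.max 0 (Num.min s b) - Num.max 0 (Num.min t b)| <= `|s - t|.
Proof.
move=> b0; wlog st : s t / s <= t => [W|].
  by have [/W//|/W] := orP (le_total s t); rewrite distrC [`|t - s|]distrC.
have m1 : Num.min s b <= Num.min t b by rewrite le_min2.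
have m2 : Num.min t b - Num.min s b <= t - s.
  by case: (lerP s b) => h1; case: (lerP t b) => h2; lra.
rewrite -normrN opprB ger0_norm ?subr_ge0 ?le_max2 // -normrN opprB ger0_norm ?subr_ge0 //.
apply: le_trans m2; case: (lerP 0 (Num.min s b)) => h1; case: (lerP 0 (Num.min t b)) => h2; lra.
Qed.

(** The branches for all smaller couplings form a curve, which is Lipschitz by
    [branch_lipschitz]. *)
Lemma branch_continuation P g y : balanced P -> weak g -> branch g P y ->
  continuation g (two_well R P) y.
Proof.
move=> bP wg by_; have [g0 _] := wg.
(* Clipping the parameter extends the curve to the whole line, where its
   continuity does not involve a subspace topology. *)
pose clip (t : R) := Num.max 0 (Num.min t g).
have clip0 t : 0 <= clip t by rewrite le_max lexx.
have clipg t : clip t <= g by rewrite ge_max g0 ge_min lexx orbT.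
have wclip t : weak (clip t) by exact: weak_le wg.
pose c t := projT1 (cid (exists_branch bP (wclip t))).
have cb t : branch (clip t) P (c t) by rewrite /c; case: cid.
have clipE t : t \in `[0, g] -> clip t = t.
  by rewrite in_itv /= => /andP[t0 tg]; rewrite /clip (min_idPl tg) (max_idPr t0).
have clipL s t : `|clip s - clip t| <= `|s - t|.
  exact: clip_lipschitz.
exists c; split.
- apply: continuous_subspaceT.
  rewrite (_ : c = fun t => \row_i (c t ord0 i)); last by apply/funext => t; apply/rowP => i; rewrite mxE.
  apply: cts_row => i; apply: (@lipschitz_cts _ (8 * N%:R ^+ 2)); first by rewrite mulr_gt0 // exprn_gt0 // ltr0n.
  move=> s t; apply: le_trans (branch_lipschitz N0 i (clip0 t) (clip0 s) (cb t) (cb s)) _.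
  by rewrite ler_wpM2l // mulr_ge0 // exprn_ge0.
- have := cb 0; rewrite clipE ?in_itv /= ?lexx ?g0 // => h.
  exact: (branch_unique N0 (lexx 0) h (two_well_branch bP)).
- have := cb g; rewrite clipE ?in_itv /= ?lexx ?g0 // => h.
  exact: (branch_unique N0 g0 h by_).
by move=> t tI; have [_] := cb t; rewrite clipE.
Qed.

(** A curve of stationary points starting at [two_well P] cannot leave the region:
    where it first touches the boundary it would be a branch, and branches stay
    strictly inside. *)
Lemma continuation_branch P g y : balanced P -> weak g -> continuation g (two_well R P) y -> branch g P y.
Proof.
move=> bP wg [c [cc c0 cg st]]; have [g0 _] := wg.
have gI : g \in `[0, g] by rewrite in_itv /= g0 lexx.
split; last by rewrite -cg; exact: st.
split; first by rewrite -cg; case: (st g gI).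
pose F i t := if i \in P then c t ord0 i - rho R N else - rho R N - c t ord0 i.
have Fc i : {within `[0, g], continuous (F i)}.
  by rewrite /F; case: (i \in P); apply: ctsB; by [exact: coord_path|exact: ctsC].
have F0 i : 0 < F i 0.
  have := two_well_margin i bP; have := margin_gt0; rewrite /F c0; case: (i \in P); lra.
have [//|] := pselect (exists i, F i g <= 0); last first.
  move=> no i; have : 0 < F i g by rewrite ltNge; apply/negP => h; apply: no; exists i.
  by rewrite /F cg; case: (i \in P); lra.
move=> Fg; have [t tI [Ft [i0 Fi0]]] := first_exit g0 Fc F0 Fg.
have cP : region P (c t).
  split; first by case: (st t tI).
  by move=> i; have := Ft i; rewrite /F; case: (i \in P); lra.
have wt : weak t by move: tI; rewrite in_itv /= => /andP[t0 tg]; exact: weak_le wg.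
have := near_interior bP (branch_near i0 bP wt (conj cP (st t tI))).
by move: Fi0; rewrite /F; case: (i0 \in P) => h1; rewrite ltNge => /negP[]; lra.
Qed.

End Branches.

(** * Weak coupling creates no further minima *)

Section SmallCouplingMinima.
Variables (R : realType) (N M : nat).
Hypotheses (NM : N = (2 * M)%N) (N8 : (8 <= N)%N) (N3 : ~~ (3 %| N)%N).
Implicit Types (x y v : 'rV[R]_N) (P : {set 'I_N}) (g : R).

(** When x has a single coordinate at the middle root, at i, this is [middle_vec],
    but it does not depend on x. *)
Definition spike (i : 'I_N) : 'rV[R]_N := \row_j (if j == i then (N - 1)%:R else - 1).

Lemma spike_middle x r1 r2 r3 i : three_valued x r1 r2 r3 -> count_eq x r2 = 1%N ->
  x ord0 i = r2 -> spike i = middle_vec x r2.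
Proof.
move=> tv c2 xi; apply/rowP => j; rewrite !mxE c2.
suff -> : (x ord0 j == r2) = (j == i) by [].
have [->|ji] := eqVneq j i; first by rewrite xi eqxx.
apply/negbTE/eqP => xj.
suff : (1 < count_eq x r2)%N by rewrite c2.
by apply/card_gt1P; exists j, i; rewrite !inE xi xj eqxx.
Qed.

(** Nonnegativity of the Hessian along finitely many fixed directions already
    excludes coordinates at the middle root. This gives a closed condition that
    survives small perturbations. *)
Lemma test_directions_no_middle x r1 r2 r3 : three_valued x r1 r2 r3 ->
  (forall i j, 0 <= hess_form 0 x (swap_vec R i j) (swap_vec R i j)) ->
  (forall i, 0 <= hess_form 0 x (spike i) (spike i)) -> count_eq x r2 = 0%N.
Proof.
move=> tv Hs Hp; have [_ d2 _] := curvature_signs tv.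
have [|/count_gt1[i [j [/eqP xi /eqP xj ij]]]|m1] := ltngtP (count_eq x r2) 1.
- by case: (count_eq x r2).
- have := Hs i j; rewrite swap_vec_form // eqxx xi xj /= mul1r leNgt => /negP[]; lra.
have m12 : (1 <= count_eq x r2 <= 2)%N by rewrite m1.
have /card_gt0P[i] : (0 < count_eq x r2)%N by rewrite m1.
rewrite inE => /eqP xi.
have [_ _] := few_middle tv N8 m12.
by rewrite -(spike_middle tv m1 xi) ltNge Hp.
Qed.

Definition test_dir (a : 'I_N * 'I_N + 'I_N) : 'rV[R]_N :=
  match a with inl ij => swap_vec R ij.1 ij.2 | inr i => spike i end.

Lemma spike_zero_sum i : zero_sum (spike i).
Proof.
rewrite /zero_sum /=; under eq_bigr do rewrite mxE.
rewrite (bigD1 i) //= eqxx (eq_bigr (fun=> - 1)); last by move=> j /negPf ->.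
rewrite sumr_const cardC1 card_ord subn1 mulNrn -[1 *+ _]/(_%:R) subrr //.
Qed.

Lemma test_dir_zero_sum a : zero_sum (test_dir a).
Proof. by case: a => [[i j]|i]; [exact: swap_vec_zero_sum|exact: spike_zero_sum]. Qed.

Definition grad1 (r : R) : R := r ^+ 3 - r.

(** Continuous in x, and zero only at local minima of the uncoupled potential. *)
Definition defect x : R :=
  \sum_i \sum_j `|grad1 (x ord0 i) - grad1 (x ord0 j)| +
  \sum_a (`|hess_form 0 x (test_dir a) (test_dir a)| - hess_form 0 x (test_dir a) (test_dir a)).

Lemma cts_defect : continuous defect.
Proof.
have cg i : continuous (fun x : 'rV[R]_N => grad1 (x ord0 i)).
  by apply: ctsB; [apply: ctsX|]; exact: cts_coord.
have ch v : continuous (fun x => hess_form 0 x v v).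
  rewrite (_ : (fun x => _) = (fun x : 'rV[R]_N => \sum_i (3 * x ord0 i ^+ 2 - 1) * v ord0 i * v ord0 i)).
    apply: cts_sum => i _; apply: ctsM; last exact: ctsC.
    apply: ctsM; last exact: ctsC.
    apply: ctsB; last exact: ctsC.
    by apply: ctsM; [exact: ctsC|apply: ctsX; exact: cts_coord].
  by apply/funext => x; rewrite hess_form0E.
apply: ctsD; apply: cts_sum => a _.
  by apply: cts_sum => j _; apply: cts_abs; exact: ctsB.
by apply: ctsB; [apply: cts_abs|]; exact: ch.
Qed.

Lemma defect_ge0 x : 0 <= defect x.
Proof.
apply: addr_ge0; apply: sumr_ge0 => a _; last by rewrite subr_ge0 ler_norm.
by apply: sumr_ge0 => j _.
Qed.

Lemma defect_eq0 x : zero_sum x -> defect x = 0 -> exists2 P, balanced P & x = two_well R P.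
Proof.
move=> x0 /eqP; rewrite paddr_eq0; last 2 first.
- by apply: sumr_ge0 => i _; apply: sumr_ge0 => j _.
- by apply: sumr_ge0 => a _; rewrite subr_ge0 ler_norm.
move=> /andP[D1 D2].
have st : stationary 0 x.
  apply/stationary0P; split=> // i j.
  move: D1; rewrite psumr_eq0; last by move=> k _; apply: sumr_ge0.
  move=> /allP/(_ i (mem_index_enum i)) /=.
  rewrite psumr_eq0 // => /allP/(_ j (mem_index_enum j)) /=.
  by rewrite normr_eq0 subr_eq0 => /eqP.
have tf a : 0 <= hess_form 0 x (test_dir a) (test_dir a).
  move: D2; rewrite psumr_eq0; last by move=> b _; rewrite subr_ge0 ler_norm.
  move=> /allP/(_ a (mem_index_enum a)) /=; rewrite subr_eq0 => /eqP <-.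
  exact: normr_ge0.
have [r1 [r2 [r3 tv]]] := three_valued_stationary N3 st.
have c2 : count_eq x r2 = 0%N.
  apply: (test_directions_no_middle tv); first by move=> i j; exact: (tf (inl (i, j))).
  by move=> i; exact: (tf (inr i)).
have N0 : (0 < N)%N by exact: leq_trans N8.
by have [bP xE] := three_valued_two_well N0 tv c2; eexists; [exact: bP|].
Qed.

Definition defect_rate : R := 8 * N%:R ^+ 2 + \sum_a coupling (test_dir a).

(** The coupling changes the gradient and the Hessian by an amount of order g. *)
Lemma local_minimum_defect g x : 0 <= g -> local_minimum g x -> defect x <= g * defect_rate.
Proof.
have N0 : (0 < N)%N by exact: leq_trans N8.
move=> g0 [st /morse_index0P H]; rewrite /defect_rate mulrDr; apply: lerD.
  have -> : g * (8 * N%:R ^+ 2) = \sum_(i < N) \sum_(j < N) 8 * g.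
    by rewrite !(sumr_const, card_ord) -[RHS]mulr_natl -[8 * g *+ N]mulr_natl; ring.
  apply: ler_sum => i _; apply: ler_sum => j _.
  have := stationary_force st i j; rewrite /force -/(grad1 _) -/(grad1 _) => E.
  have xb k : `|x ord0 k| <= 2 by apply: sqr_le_norm2; exact: (stationary_bound N0 g0 st k).
  have cb k : `|2 * x ord0 k - x ord0 (ordS k) - x ord0 (ord_pred k)| <= 8.
    have := xb k; have := xb (ordS k); have := xb (ord_pred k); rewrite !ler_norml.
    by move=> /andP[h1 h2] /andP[h3 h4] /andP[h5 h6]; apply/andP; split; lra.
  move: (cb i) (cb j) E.
  set ci := 2 * x ord0 i - _ - _; set cj := 2 * x ord0 j - _ - _ => cbi cbj E.
  rewrite (_ : _ - _ = g / 2 * (cj - ci)); last by lra.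
  rewrite normrM ger0_norm ?divr_ge0 //.
  apply: (@le_trans _ _ (g / 2 * 16)); last by lra.
  rewrite ler_wpM2l ?divr_ge0 //; apply: le_trans (ler_normB _ _) _; lra.
rewrite mulr_sumr; apply: ler_sum => a _.
have := H _ (test_dir_zero_sum a).
have -> : hess_form g x (test_dir a) (test_dir a) =
    hess_form 0 x (test_dir a) (test_dir a) + g / 2 * coupling (test_dir a).
  rewrite /hess_form /coupling !mul0r addr0; congr (_ + _ * _).
have c0 := mulr_ge0 g0 (coupling_ge0 (test_dir a)).
set h := hess_form 0 x _ _ => hh.
by have [h0|h0] := lerP 0 h; rewrite ?(ger0_norm h0) ?(ltr0_norm h0); lra.
Qed.

(** The bounded zero-sum points outside the open regions of all balanced patterns
    form a compact set, on which the defect has a positive minimum. Local minima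
    under weak coupling have a smaller defect. *)
Lemma local_minimum_region : exists2 g1 : R, 0 < g1 & forall g x, 0 <= g -> g < g1 ->
  local_minimum g x -> exists2 P, balanced P & region P x.
Proof.
have N0 : (0 < N)%N by exact: leq_trans N8.
pose gap P (i : 'I_N) x := if i \in P then x ord0 i - rho R N else - rho R N - x ord0 i.
have gapc P i : continuous (gap P i).
  by rewrite /gap; case: (i \in P); apply: ctsB; by [exact: cts_coord|exact: ctsC].
(* For an unbalanced P the factor 0 makes the last condition void. *)
pose K := [set x : 'rV[R]_N | \sum_i x ord0 i = 0] `&`
  ([set x : 'rV[R]_N | forall i, 0 <= 2 - `|x ord0 i|] `&`
   [set x : 'rV[R]_N | forall P, 0 <= - ((balanced P)%:R * \big[Num.min/1]_i gap P i x)]).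
have Kcl : closed K.
  apply: closedI; first by apply: closed_fun_eq; apply: cts_sum => i _; exact: cts_coord.
  apply: closedI.
    apply: closed_forall => i; apply: closed_fun_ge; apply: ctsB; first exact: ctsC.
    by apply: cts_abs; exact: cts_coord.
  apply: closed_forall => P; apply: closed_fun_ge; apply: ctsN; apply: ctsM; first exact: ctsC.
  by apply: cts_bigmin => i; exact: gapc.
have Kb x i : K x -> `|x ord0 i| <= 2 by move=> [_ [/(_ i)]]; rewrite subr_ge0.
have inK g x : 0 <= g -> local_minimum g x -> ~ (exists2 P, balanced P & region P x) -> K x.
  move=> g0 [st _] no; split; first by case: st.
  split=> [i|P] /=; first by rewrite subr_ge0 sqr_le_norm2 // (stationary_bound N0 g0 st i).
  case bP: (balanced P); last by rewrite mul0r oppr0.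
  rewrite mul1r oppr_ge0 leNgt; apply/negP => /bigmin_gtP[_ gp]; apply: no; exists P => //.
  split; first by case: st.
  by move=> i; have := gp i isT; rewrite /gap; case: (i \in P); lra.
have rate0 : 0 <= defect_rate.
  by rewrite addr_ge0 ?mulr_ge0 ?exprn_ge0 // sumr_ge0 // => a _; exact: coupling_ge0.
have [K0|/set0P/negP] := pselect (K !=set0); last first.
  rewrite negbK => /eqP K0; exists 1 => // g x g0 _ lx; apply: contrapT => no.
  by have := inK g x g0 lx no; rewrite K0.
have [c Kc cmin] := box_closed_min K0 Kcl Kb cts_defect.
have dc : 0 < defect c.
  rewrite lt_neqAle defect_ge0 andbT eq_sym; apply/eqP => d0.
  case: Kc => c0 [_ /=]; have [P bP cE] := defect_eq0 c0 d0.
  move=> /(_ P); rewrite bP mul1r oppr_ge0 leNgt => /negP[].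
  apply/bigmin_gtP; split => // i _; rewrite cE.
  have := two_well_margin R N0 i bP; have := margin_gt0 R N0; rewrite /gap; case: (i \in P); lra.
have r1 : 0 < 1 + defect_rate by lra.
exists (defect c / (1 + defect_rate)); first exact: divr_gt0.
move=> g x g0; rewrite ltr_pdivlMr // => gd lx; apply: contrapT => no.
have := cmin _ (inK g x g0 lx no); rewrite leNgt => /negP[].
apply: le_lt_trans (local_minimum_defect g0 lx) _; apply: le_lt_trans gd.
by rewrite ler_wpM2l // lerDr.
Qed.

End SmallCouplingMinima.

(** * Bounds on communication heights *)

Section Heights.
Variables (R : realType) (N M : nat).
Hypotheses (NM : N = (2 * M)%N) (N8 : (8 <= N)%N) (N3 : ~~ (3 %| N)%N).
Implicit Types (x y z v : 'rV[R]_N) (P Q : {set 'I_N}) (g : R) (k l : nat).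

Let kmax := (N %/ 6)%N.
Let N0 : (0 < N)%N := leq_trans (isT : (0 < 8)%N) N8.

Lemma admissible_opp (Gamma : R -> 'rV[R]_N) : admissible Gamma -> admissible (fun t => - Gamma t).
Proof.
move=> [Gc G0]; split; first by move=> t; apply: cvgN; exact: Gc.
move=> t /G0; rewrite /zero_sum /= => z0.
by under eq_bigr do rewrite mxE; rewrite sumrN z0 oppr0.
Qed.

(** Collects the cases of [exit_balanced] and [exit_majority]. Leaving the balanced
    class requires a saddle in C_1, whence the maximum. *)
Lemma exit_class l P Q Gamma : (3 * l < M)%N -> size_class M l P -> Q != P ->
  admissible Gamma -> separated P (Gamma 0) -> separated Q (Gamma 1) ->
  exists2 t, t \in `[0, 1] & saddle_energy R M (maxn l 1) <= potential 0 (Gamma t) /\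
    ((1 <= l)%N -> potential 0 (Gamma t) = saddle_energy R M l -> exit_saddle M l (Gamma t)).
Proof.
move=> lM cP QP Ga sP sQ; case: l lM cP => [|l] lM cP.
  have cPM : #|P| = M by case/orP: cP => /eqP; rewrite addn0.
  by have [t tI le] := exit_balanced NM N8 cPM QP Ga sP sQ; exists t.
have -> : maxn l.+1 1 = l.+1 by apply/maxn_idPl.
case/orP: cP => /eqP cP.
  have [t tI [le H]] := exit_majority NM N8 (ltn0Sn l) lM cP QP Ga sP sQ.
  by exists t.
have cPc : #|~: P| = (M + l.+1)%N.
  by have := etrans (card_compl P) NM; move: cP; move: #|P| #|~: P| => p q; clear; lia.
have QPc : ~: Q != ~: P by apply: contra QP => /eqP /finset.setC_inj ->.
have [t tI [le H]] := exit_majority NM N8 (ltn0Sn l) lM cPc QPc (admissible_opp Ga) (separated_opp sP) (separated_opp sQ).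
exists t => //; rewrite potential0_opp in le H; split=> // _ E.
by rewrite -[Gamma t]opprK; apply: exit_saddle_opp => //; exact: H.
Qed.

Definition family g k : set 'rV[R]_N := [set y | exists2 P, size_class M k P & branch g P y].

Lemma family_B0 k : (k <= kmax)%N -> B0 M k = family 0 k.
Proof.
move=> kN; apply/seteqP; split=> x.
  move=> /(B0P NM N8 N3 _ kN)[P cP ->]; exists P => //.
  exact: (two_well_branch R N0 (size_class_balanced NM N8 N3 kN cP)).
move=> [P cP bx]; apply/(B0P NM N8 N3 _ kN); exists P => //.
have bP := size_class_balanced NM N8 N3 kN cP.
exact: (branch_unique N0 (lexx 0) bx (two_well_branch R N0 bP)).
Qed.

Lemma family_B g k : weak N g -> (k <= kmax)%N -> B M g k = family g k.
Proof.
move=> wg kN; apply/seteqP; split=> y.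
  move=> [x /(B0P NM N8 N3 _ kN)[P cP ->] cont]; exists P => //.
  exact: (continuation_branch N0 (size_class_balanced NM N8 N3 kN cP) wg cont).
move=> [P cP by_]; have bP := size_class_balanced NM N8 N3 kN cP.
exists (two_well R P); first by apply/(B0P NM N8 N3 _ kN); exists P.
exact: (branch_continuation N0 bP wg by_).
Qed.

Lemma exists_pattern c : (c <= N)%N -> exists P : {set 'I_N}, #|P| = c.
Proof.
move=> cN; exists [set i : 'I_N | (i < c)%N]%SET.
rewrite -sum1_card (eq_bigl (fun i : 'I_N => (i < c)%N)); last by move=> i; rewrite inE.
by rewrite (big_ord_narrow cN) sum1_card card_ord.
Qed.

(** Lower bound: the coupling is nonnegative and [two_well P] minimises the
    uncoupled potential on the region. Upper bound: y minimises the coupled one. *)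
Lemma branch_energy g P y k : weak N g -> (k <= kmax)%N -> size_class M k P -> branch g P y ->
  well_energy R M k <= potential g y /\ potential g y <= well_energy R M k + 4 * N%:R * g.
Proof.
move=> [g0 _] kN cP [yP st]; have bP := size_class_balanced NM N8 N3 kN cP.
have [tP st0] := two_well_branch R N0 bP.
have c0 := ltW (convexity_gt0 R N0).
rewrite -(size_class_energy R NM N8 N3 kN cP); split.
  rewrite (potentialE g); have h := stationary_region_min N0 (lexx 0) tP yP st0.
  have h1 : 0 <= convexity R N / 2 * sqdist (two_well R P) y by rewrite mulr_ge0 ?sqdist_ge0 ?divr_ge0.
  have h2 : 0 <= g / 4 * coupling y by rewrite mulr_ge0 ?coupling_ge0 ?divr_ge0.
  lra.
have h := stationary_region_min N0 g0 yP tP st.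
have h1 : 0 <= convexity R N / 2 * sqdist y (two_well R P) by rewrite mulr_ge0 ?sqdist_ge0 ?divr_ge0.
have tb j : `|two_well R P ord0 j| <= 2 by apply: (branch_bound N0 j (lexx 0)); split; [exact: tP|].
have h2 : g / 4 * coupling (two_well R P) <= g / 4 * (4 * N%:R * 2 ^+ 2).
  by rewrite ler_wpM2l ?divr_ge0 ?coupling_le.
rewrite [potential g (two_well R P)]potentialE in h.
lra.
Qed.

Local Open Scope ereal_scope.

Lemma path_height_ge g x (Gamma : R -> 'rV[R]_N) (t r : R) : (t \in `[0, 1])%R ->
  (r <= potential g (Gamma t))%R -> (r - potential g x)%:E <= path_height g x Gamma.
Proof.
move=> tI le; rewrite /path_height EFinB leeB //.
apply: (@le_trans _ _ (potential g (Gamma t))%:E); first by rewrite lee_fin.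
by apply: ereal_sup_ubound; exists t.
Qed.

Lemma path_height_le g x (Gamma : R -> 'rV[R]_N) (r : R) :
  (forall t, t \in `[0, 1] -> potential g (Gamma t) <= r)%R ->
  path_height g x Gamma <= (r - potential g x)%:E.
Proof.
move=> H; rewrite /path_height EFinB leeB //.
by apply: ge_ereal_sup => _ [t tI <-]; rewrite lee_fin H.
Qed.

Lemma comm_height_le g x A (Gamma : R -> 'rV[R]_N) : path_from_to x A Gamma ->
  comm_height g x A <= path_height g x Gamma.
Proof. by move=> H; apply: ereal_inf_lbound; exists Gamma. Qed.

(** The coupling is nonnegative, so that the uncoupled lower bound on the
    saddle level is still valid for every path. *)
Lemma low_height g l y A P : weak N g -> (l <= kmax)%N -> size_class M l P -> branch g P y ->
  (forall z, A z -> exists2 Q, Q != P & branch g Q z) ->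
  (saddle_energy R M (maxn l 1) - well_energy R M l - 4 * N%:R * g)%:E <= comm_height g y A.
Proof.
move=> wg lN cP by_ HA; have [g0 _] := wg.
apply: le_ereal_inf_tmp => _ [Gamma [Gc G0 G00 /HA[Q QP bz]] <-].
have Ga : admissible Gamma by split.
have sP : separated P (Gamma 0%R) by rewrite G00; apply: (region_separated N0 by_.1).
have sQ : separated Q (Gamma 1%R) by exact: (region_separated N0 bz.1).
have lM : (3 * l < M)%N by rewrite -(kmax_lt NM N8 N3).
have [t tI [le _]] := exit_class lM cP QP Ga sP sQ.
have [_ e2] := branch_energy wg lN cP by_.
have le' : (saddle_energy R M (maxn l 1) <= potential g (Gamma t))%R.
  by apply: le_trans le _; rewrite (potentialE g) lerDl mulr_ge0 ?coupling_ge0 ?divr_ge0.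
apply: le_trans (path_height_ge y tI le'); rewrite lee_fin; lra.
Qed.

Local Close Scope ereal_scope.

Lemma well_lipschitz (b u w : R) : `|u| <= b -> `|w| <= b -> `|well u - well w| <= (b ^+ 3 + b) * `|u - w|.
Proof.
move=> ub wb; have b0 : 0 <= b by apply: le_trans ub.
have -> : well u - well w = ((u + w) * (u ^+ 2 + w ^+ 2) / 4 - (u + w) / 2) * (u - w) by rewrite /well; field.
rewrite normrM ler_wpM2r //; apply: le_trans (ler_normB _ _) _.
have uw : `|u + w| <= 2 * b by apply: le_trans (ler_normD _ _) _; lra.
apply: lerD; last by rewrite normrM [`|2^-1|]ger0_norm //; lra.
rewrite !normrM [`|4^-1|]ger0_norm //.
have sq (r : R) : `|r| <= b -> r ^+ 2 <= b ^+ 2.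
  by move=> rb; rewrite -(real_normK (num_real r)) ler_pXn2r ?nnegrE.
have q : `|u ^+ 2 + w ^+ 2| <= 2 * b ^+ 2.
  by rewrite ger0_norm ?addr_ge0 ?sqr_ge0 //; have := sq _ ub; have := sq _ wb; lra.
have := ler_pM (normr_ge0 _) (normr_ge0 _) uw q.
by rewrite (_ : 2 * b * (2 * b ^+ 2) = 4 * b ^+ 3); [lra|ring].
Qed.

(** A crude bound on sublevel sets, to make the uncoupled path bounded. *)
Lemma sublevel_bound x : potential 0 x <= N%:R -> forall i, `|x ord0 i| <= N%:R + 2.
Proof.
move=> le i; rewrite leNgt; apply/negP => xi.
have n1 : 1 <= N%:R :> R by rewrite ler1n.
have well_ge (r : R) : - 4^-1 <= well r.
  by have := sqr_ge0 (r ^+ 2 - 1); rewrite /well; lra.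
have s9 : (N%:R + 2) ^+ 2 < x ord0 i ^+ 2.
  by rewrite -(real_normK (num_real (x ord0 i))) ltr_pXn2r ?nnegrE ?addr_ge0.
have : N%:R < potential 0 x; last by rewrite ltNge le.
rewrite potential0E (bigD1 i) //=.
have rest : - 4^-1 * N%:R <= \sum_(j < N | j != i) well (x ord0 j).
  apply: (@le_trans _ _ (\sum_(j < N | j != i) - 4^-1)).
    rewrite sumr_const cardC1 card_ord -[_ *+ N.-1]mulr_natr ler_wnM2l ?oppr_le0 ?invr_ge0 //.
    by rewrite ler_nat leq_pred.
  by apply: ler_sum => j _; exact: well_ge.
rewrite /well; have -> : x ord0 i ^+ 4 = (x ord0 i ^+ 2) ^+ 2 by rewrite -exprM.
move: s9; move: (x ord0 i ^+ 2) => s s9; nra.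
Qed.

(** The constant of the order-g error in [up_path]: the Lipschitz constant of the
    well times the displacement of the branches, and the coupling energy itself. *)
Definition path_rate : R := N%:R * ((N%:R + 3) ^+ 3 + (N%:R + 3)) * (8 * N%:R ^+ 2) + N%:R * (N%:R + 3) ^+ 2.

Lemma saddle_energy_bound k : saddle_energy R M k <= N%:R.
Proof.
have d0 := saddle_den_gt0 R NM N8 k; have m4 := M_ge4 R NM N8.
have NE : N%:R = 2 * M%:R :> R by rewrite [in LHS]NM natrM.
have : 0 <= (2 * M%:R - 3) ^+ 3 / saddle_den R M k.
  by apply: divr_ge0; [apply: exprn_ge0; lra|exact: ltW].
rewrite /saddle_energy NE; lra.
Qed.

(** The uncoupled path of [saddle_path] is translated by the displacements of its
    two end points, interpolated linearly along the path. *)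
Lemma up_path g k x : weak N g -> (1 <= k)%N -> (k <= kmax)%N -> family g k x ->
  exists2 Gamma, path_from_to x (family g k.-1) Gamma &
    forall t, t \in `[0, 1] -> potential g (Gamma t) <= saddle_energy R M k + path_rate * g.
Proof.
move=> wg k1 kN [P cP bx]; have [g0 _] := wg.
have kM : (3 * k < M)%N by rewrite -(kmax_lt NM N8 N3).
have [Gamma [Q [cQ Gc G0 G1 Gt]]] := saddle_path R NM N8 k1 kM cP.
have kN1 : (k.-1 <= kmax)%N by apply: leq_trans kN; exact: leq_pred.
have bP := size_class_balanced NM N8 N3 kN cP.
have bQ := size_class_balanced NM N8 N3 kN1 cQ.
have [z bz] := exists_branch N0 bQ wg.
pose dx i := x ord0 i - two_well R P ord0 i; pose dz i := z ord0 i - two_well R Q ord0 i.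
pose G t : 'rV[R]_N := \row_i (Gamma t ord0 i + (1 - t) * dx i + t * dz i).
have lip T y i : balanced T -> branch g T y -> `|y ord0 i - two_well R T ord0 i| <= 8 * N%:R ^+ 2 * g.
  move=> bT by_; have := branch_lipschitz N0 i (lexx 0) g0 (two_well_branch R N0 bT) by_.
  by rewrite subr0 (ger0_norm g0).
have mar T y i : balanced T -> branch g T y -> `|y ord0 i - two_well R T ord0 i| <= 1.
  move=> bT by_; apply/ltW; apply: lt_le_trans (branch_near N0 i bT wg by_) _.
  by rewrite /margin ler_pdivrMr ?mulr_gt0 ?ltr0n // mul1r -natrM ler1n; clear -N0; lia.
exists G.
  split.
  - apply: continuous_subspaceT; apply: cts_row => i.
    have gi : continuous (fun t => Gamma t ord0 i).
      have : continuous ((fun x : 'rV[R]_N => x ord0 i) \o Gamma).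
        by move=> t; apply: continuous_comp; [exact: Gc|exact: cts_coord].
      exact.
    apply: ctsD; [apply: ctsD => //|]; apply: ctsM; try exact: ctsC; last exact: ctsI.
    by apply: ctsB; [exact: ctsC|exact: ctsI].
  - move=> t tI; have [z0 _] := Gt t tI; rewrite /zero_sum /=.
    under eq_bigr do rewrite mxE; rewrite !big_split /= z0 -!mulr_sumr /dx /dz !sumrB.
    have -> : \sum_i x ord0 i = 0 by case: bx => [[]].
    have -> : \sum_i z ord0 i = 0 by case: bz => [[]].
    by rewrite (two_well_zero_sum R bP) (two_well_zero_sum R bQ) !subrr !mulr0 !addr0.
  - by apply/rowP => i; rewrite mxE G0 /dx subr0 mul1r mul0r addr0 addrC subrK.
  exists Q => //; rewrite (_ : G 1 = z) //.
  by apply/rowP => i; rewrite mxE G1 /dz subrr mul0r addr0 mul1r addrC subrK.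
move=> t tI; have [z0 le] := Gt t tI.
have Gb i : `|Gamma t ord0 i| <= N%:R + 2.
  by apply: sublevel_bound; apply: le_trans le (saddle_energy_bound k).
move: (tI); rewrite in_itv /= => /andP[t0 t1].
have comb (B1 B2 : R) i : `|dx i| <= B1 -> `|dz i| <= B1 -> `|(1 - t) * dx i + t * dz i| <= B1.
  move=> h1 h2; apply: le_trans (ler_normD _ _) _; rewrite !normrM (ger0_norm t0) ger0_norm ?subr_ge0 //.
  have : (1 - t) * `|dx i| <= (1 - t) * B1 by rewrite ler_wpM2l ?subr_ge0.
  have : t * `|dz i| <= t * B1 by rewrite ler_wpM2l.
  lra.
have GE i : G t ord0 i - Gamma t ord0 i = (1 - t) * dx i + t * dz i by rewrite mxE; ring.
have d1 i : `|G t ord0 i - Gamma t ord0 i| <= 1 by rewrite GE comb ?mar.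
have d2 i : `|G t ord0 i - Gamma t ord0 i| <= 8 * N%:R ^+ 2 * g by rewrite GE comb ?lip.
have Gb2 i : `|Gamma t ord0 i| <= N%:R + 3 by apply: le_trans (Gb i) _; lra.
have Gb3 i : `|G t ord0 i| <= N%:R + 3.
  rewrite -[G t ord0 i](subrK (Gamma t ord0 i)); apply: le_trans (ler_normD _ _) _.
  by have := d1 i; have := Gb i; lra.
rewrite (potentialE g).
have h1 : g / 4 * coupling (G t) <= g / 4 * (4 * N%:R * (N%:R + 3) ^+ 2).
  by rewrite ler_wpM2l ?divr_ge0 // coupling_le.
have h2 : potential 0 (G t) - potential 0 (Gamma t) <= N%:R * (((N%:R + 3) ^+ 3 + (N%:R + 3)) * (8 * N%:R ^+ 2 * g)).
  rewrite !potential0E -sumrB.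
  have -> : N%:R * (((N%:R + 3) ^+ 3 + (N%:R + 3)) * (8 * N%:R ^+ 2 * g)) =
     \sum_(i < N) (((N%:R + 3) ^+ 3 + (N%:R + 3)) * (8 * N%:R ^+ 2 * g)) by rewrite sumr_const card_ord -[RHS]mulr_natl.
  apply: ler_sum => i _; apply: le_trans (ler_norm _) _.
  apply: le_trans (well_lipschitz (Gb3 i) (Gb2 i)) _.
  by rewrite ler_wpM2l // addr_ge0 ?exprn_ge0 ?addr_ge0.
rewrite /path_rate; lra.
Qed.

Lemma up_height g k x A : weak N g -> (1 <= k)%N -> (k <= kmax)%N -> family g k x ->
  family g k.-1 `<=` A ->
  (comm_height g x A <= (barrier R M k + path_rate * g)%:E)%E.
Proof.
move=> wg k1 kN fx sA; have [Gamma [Gc G0 G00 G1] Gt] := up_path wg k1 kN fx.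
have pA : path_from_to x A Gamma by split=> //; exact: sA.
apply: le_trans (comm_height_le g pA) _.
apply: le_trans (path_height_le x Gt) _.
have [P cP bx] := fx; have [e1 _] := branch_energy wg kN cP bx.
by rewrite lee_fin /barrier; lra.
Qed.

End Heights.

(** * The metastable hierarchy *)

Section Hierarchy.
Variables (R : realType) (N M : nat).
Hypotheses (NM : N = (2 * M)%N) (N8 : (8 <= N)%N) (N3 : ~~ (3 %| N)%N).
Implicit Types (x y z v : 'rV[R]_N) (P Q : {set 'I_N}) (g : R) (k l : nat).

Let kmax := (N %/ 6)%N.
Let N0 : (0 < N)%N := leq_trans (isT : (0 < 8)%N) N8.

Lemma barrier_decreasing l k : (1 <= l)%N -> (l < k)%N -> (k <= kmax)%N ->
  barrier R M k < barrier R M l.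
Proof.
move=> l1; elim: k => // k IH; rewrite ltnS leq_eqVlt => /orP[/eqP <-|lk] kN.
  exact: (barrier_step R NM N8 N3).
apply: lt_trans (IH lk (ltnW kN)).
by apply: (barrier_step R NM N8 N3) => //; apply: leq_trans l1 (ltnW lk).
Qed.

Lemma well_energy_01 : well_energy R M 0 < well_energy R M 1.
Proof.
have m4 := M_ge4 R NM N8; have m0 : 0 < M%:R :> R by lra.
have m2 : 0 < M%:R ^+ 2 :> R by rewrite exprn_gt0.
rewrite /well_energy mulr0n mulr1n expr0n expr1n mulr0 addr0 mulr1.
rewrite ltr_pM2r ?invr_gt0 // ltrD2l ltrN2.
rewrite ltr_pM2l ?mulr_gt0 ?exprn_gt0 // ltf_pV2 ?posrE ?addr_gt0 //.
by rewrite ltrDl.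
Qed.

(** For l > 0 this is the decrease of the barriers. The class 0 is left over C_1
    too, but starts from a lower potential than the class 1. *)
Lemma exit_gap l k : (l < k)%N -> (k <= kmax)%N ->
  barrier R M k < saddle_energy R M (maxn l 1) - well_energy R M l.
Proof.
case: l => [|l] lk kN.
  have h0 := well_energy_01; rewrite max0n.
  have h1 : barrier R M k <= barrier R M 1.
    by case: (ltngtP k 1) lk => // [k1|->] _ //; apply/ltW; exact: barrier_decreasing.
  by move: h1; rewrite /barrier; lra.
have -> : maxn l.+1 1 = l.+1 by apply/maxn_idPl.
exact: barrier_decreasing.
Qed.

Lemma uniform_gap : exists2 theta : R, 0 < theta & forall l k, (l < k)%N -> (k <= kmax)%N ->
  barrier R M k + theta <= saddle_energy R M (maxn l 1) - well_energy R M l.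
Proof.
pose d (lk : 'I_kmax.+1 * 'I_kmax.+1) : R :=
  saddle_energy R M (maxn lk.1 1) - well_energy R M lk.1 - barrier R M lk.2.
exists (\big[Num.min/1]_(lk : 'I_kmax.+1 * 'I_kmax.+1 | (lk.1 < lk.2)%N) d lk).
  apply/bigmin_gtP; split=> // -[l k] /= lk; rewrite subr_gt0.
  by apply: exit_gap => //; rewrite -ltnS.
move=> l k lk kN; have lN : (l < kmax.+1)%N by rewrite ltnS (leq_trans (ltnW lk)).
have kN' : (k < kmax.+1)%N by [].
have : \big[Num.min/1]_(lk : 'I_kmax.+1 * 'I_kmax.+1 | (lk.1 < lk.2)%N) d lk <= d (Ordinal lN, Ordinal kN').
  by apply: bigmin_le_cond.
by rewrite /d /=; lra.
Qed.

Lemma family_partition g (Pf : nat -> set 'rV[R]_N) : weak N g ->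
  (forall x, local_minimum g x -> exists2 P, balanced P & region P x) ->
  (forall k, (k <= kmax)%N -> Pf k = family M g k) ->
  partition `I_kmax.+1 Pf (local_minimum g).
Proof.
move=> wg lmr PfE; have [g0 _] := wg; split.
- apply/seteqP; split=> x.
    move=> [k /= kN]; rewrite PfE // => -[P cP [xP st]]; exact: (region_index0 N0 g0 xP st).
  move=> lx; have [P bP xP] := lmr x lx; have [k kN cP] := balanced_size_class NM N8 N3 bP.
  by exists k => //=; rewrite PfE //; exists P => //; split=> //; case: lx.
- move=> k l kN lN [x []]; rewrite PfE // PfE // => -[P cP [xP _]] [Q cQ [xQ _]].
  apply: (size_class_inj cP).
  by rewrite (separated_inj (region_separated N0 xP) (region_separated N0 xQ)).
move=> k kN; rewrite PfE //.
have kM : (3 * k < M)%N by rewrite -(kmax_lt NM N8 N3).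
have [|P cP] := @exists_pattern N (M + k); first by rewrite NM; clear -kM; lia.
have sP : size_class M k P by rewrite /size_class cP eqxx.
have [y by_] := exists_branch N0 (size_class_balanced NM N8 N3 kN sP) wg.
by exists y; exists P.
Qed.

(** Half of the gap of the uncoupled hierarchy absorbs the errors of order g in
    [low_height] and [up_height]. *)
Lemma metastable_families (theta : R) g (Pf : nat -> set 'rV[R]_N) : 0 < theta ->
  (forall l k, (l < k)%N -> (k <= kmax)%N ->
    barrier R M k + theta <= saddle_energy R M (maxn l 1) - well_energy R M l) ->
  weak N g -> (path_rate R N + 4 * N%:R) * g <= theta / 2 ->
  (forall x, local_minimum g x -> exists2 P, balanced P & region P x) ->
  (forall k, (k <= kmax)%N -> Pf k = family M g k) ->
  metastable_order g kmax.+1 Pf.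
Proof.
move=> th0 thP wg gth lmr PfE; split; first exact: family_partition.
exists (theta / 2); first by rewrite divr_gt0.
move=> k /andP[k1 kN] x xk l lk; rewrite ltnS in kN.
have lN : (l <= kmax)%N by apply: leq_trans kN; exact: ltnW.
have kN1 : (k.-1 <= kmax)%N by apply: leq_trans kN; exact: leq_pred.
have sub : family M g k.-1 `<=` \bigcup_(i in `I_k) Pf i.
  by move=> z zk; exists k.-1; [rewrite /= prednK|rewrite PfE].
rewrite PfE // in xk.
apply: (le_trans (up_height NM N8 N3 wg k1 kN xk sub)).
pose r : R := saddle_energy R M (maxn l 1) - well_energy R M l - 4 * N%:R * g.
apply: (@le_trans _ _ (r%:E - (theta / 2)%:E)%E).
  by rewrite -EFinB lee_fin /r; have := thP l k lk kN; lra.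
rewrite leeB //; apply: le_ereal_inf_tmp => _ [y + <-]; rewrite PfE // => -[P cP by_].
apply: (low_height NM N8 N3 wg lN cP by_) => z [[i /= ik]].
have iN : (i <= kmax)%N by apply: leq_trans kN.
rewrite !PfE // => -[Q cQ bz] nzl; exists Q => //.
by apply: contra_notN nzl => /eqP QP; exists Q => //; rewrite QP.
Qed.

(** On leaving the pattern of x the path meets the upper bound on its height with
    equality, which happens only at a saddle in C_k. Any other saddle at the same
    height lies in C_k because saddle energies of different families differ. *)
Lemma minimal_path_saddle k x (Gamma : R -> 'rV[R]_N) : (1 <= k)%N -> (k <= kmax)%N ->
  B0 M k x -> minimal_path 0 x (B0 M k.-1) Gamma ->
  (exists t : R, [/\ t \in `[0, 1], at_comm_height 0 x (B0 M k.-1) (Gamma t) & C0 M k (Gamma t)])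
  /\ (forall t : R, t \in `[0, 1] -> at_comm_height 0 x (B0 M k.-1) (Gamma t) ->
        one_saddle 0 (Gamma t) -> C0 M k (Gamma t)).
Proof.
move=> k1 kN xk.
have kN1 : (k.-1 <= kmax)%N by apply: leq_trans kN; exact: leq_pred.
have kM : (3 * k < M)%N by rewrite -(kmax_lt NM N8 N3).
have xf : family M 0 k x by rewrite -(family_B0 R NM N8 N3 kN).
have /(B0P NM N8 N3 _ kN)[P cP xE] := xk.
have Vx : potential 0 x = well_energy R M k by rewrite xE; exact: (size_class_energy R NM N8 N3 kN cP).
move=> [[Gc G0 G00 G1] GE].
have up : (comm_height 0 x (B0 M k.-1) <= (barrier R M k)%:E)%E.
  have := up_height NM N8 N3 (weak0 R N0) k1 kN xf (fun z zA => zA).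
  by rewrite mulr0 addr0 -(family_B0 R NM N8 N3 kN1).
have Vle t : t \in `[0, 1] -> potential 0 (Gamma t) <= saddle_energy R M k.
  move=> tI; have := path_height_ge x tI (lexx (potential 0 (Gamma t))).
  by rewrite GE => /le_trans/(_ up); rewrite lee_fin /barrier Vx; lra.
have bP := size_class_balanced NM N8 N3 kN cP.
have sP : separated P (Gamma 0).
  by rewrite G00 xE; exact: (region_separated N0 (two_well_branch R N0 bP).1).
have [Q cQ bQ] : family M 0 k.-1 (Gamma 1) by rewrite -(family_B0 R NM N8 N3 kN1).
have sQ := region_separated N0 bQ.1.
have QP : Q != P.
  apply/eqP => QP; have := size_class_inj cP; rewrite QP in cQ; move=> /(_ _ cQ).
  by clear -k1; lia.
have [t tI [le H]] := exit_class NM N8 kM cP QP (conj Gc G0) sP sQ.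
rewrite (_ : maxn k 1 = k) in le; last exact/maxn_idPl.
have Vt : potential 0 (Gamma t) = saddle_energy R M k by apply/eqP; rewrite eq_le Vle.
have hE : comm_height 0 x (B0 M k.-1) = (barrier R M k)%:E.
  apply/eqP; rewrite eq_le up /= -GE.
  by have := path_height_ge x tI le; rewrite Vx.
have [r1 [r2 [r3 [tv c2 c3]]]] := H k1 Vt.
have kk : (1 <= k <= N %/ 6)%N by rewrite k1.
split.
  exists t; split=> //; last exact: (saddle_family NM N8 N3 tv kk c2 c3).
  by rewrite /at_comm_height hE Vt Vx.
move=> s sI; rewrite /at_comm_height hE Vx => -[Es] os.
have Vs : potential 0 (Gamma s) = saddle_energy R M k by move: Es; rewrite /barrier; lra.
have [k' [/andP[k'1 k'N] Ck' Vs']] := one_saddle_family NM N8 N3 os.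
by rewrite -(saddle_energy_inj NM N8 k'1 k1 (etrans (esym Vs') Vs)).
Qed.

(** A pattern consisting of one block has two interfaces, an alternating one
    has N >= 8, and each interface costs an energy of order g. Both patterns belong
    to the class 0. *)
Lemma patterns_differ g : weak N g -> 0 < g ->
  ~ (forall x y, family M g 0 x -> family M g 0 y -> potential g x = potential g y).
Proof.
move=> wg gp H; have [g0 _] := wg.
pose A := [set i : 'I_N | odd i]%SET; pose Bl := [set i : 'I_N | (i < M)%N]%SET.
have cB : #|Bl| = M.
  rewrite -sum1_card (eq_bigl (fun i : 'I_N => (i < M)%N)); last by move=> i; rewrite inE.
  have MN : (M <= N)%N by rewrite NM; clear; lia.
  by rewrite (big_ord_narrow MN) sum1_card card_ord.
have oS (i : 'I_N) : odd (ordS i) = ~~ odd i.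
  rewrite /= odd_mod ?NM ?oddM //.
have cA : #|A| = M.
  have AS : #|A| = #|~: A|.
    rewrite -(card_imset A (@ordS_inj N)); apply: eq_card => i.
    rewrite !inE; apply/imsetP/idP => [[j jA ->]|iA]; first by rewrite oS negbK; rewrite inE in jA.
    exists (ord_pred i); last by rewrite ord_predK.
    by rewrite inE -[odd _]negbK -oS ord_predK.
  have := etrans (card_compl A) NM; rewrite -AS; move: #|A| => c; clear; lia.
have sA : size_class M 0 A by rewrite /size_class cA addn0 eqxx.
have sB : size_class M 0 Bl by rewrite /size_class cB addn0 eqxx.
have bA := size_class_balanced NM N8 N3 (leq0n _) sA.
have bB := size_class_balanced NM N8 N3 (leq0n _) sB.
have [x bx] := exists_branch N0 bA wg; have [y by_] := exists_branch N0 bB wg.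
have E : potential g x = potential g y by apply: H; [exists A|exists Bl].
have pn : pattern_norm (M%:R : R) M%:R = M%:R.
  rewrite /pattern_norm (_ : _ - _ + _ = M%:R ^+ 2); last by ring.
  by rewrite sqrtr_sqr ger0_norm.
have m0 : M%:R != 0 :> R by have := M_ge4 R NM N8; move=> h; apply: lt0r_neq0; lra.
have cBc : #|~: Bl| = M by have := etrans (card_compl Bl) NM; rewrite cB mul2n -addnn => /addnI.
have twB i : two_well R Bl ord0 i = if (i < M)%N then 1 else - 1.
  by rewrite mxE cB cBc pn inE; case: ifP => _; rewrite ?mulNr divff.
have coupB : coupling (two_well R Bl) <= 8.
  pose i1 := inord M.-1 : 'I_N.-1.+1.
  have NE : N.-1.+1 = N by rewrite prednK.
  have M4 := M_ge4n NM N8.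
  have iM : (M.-1 < N)%N by rewrite NM; clear -M4; lia.
  have iN : (N.-1 < N)%N by rewrite prednK.
  pose j1 := Ordinal iM; pose j2 := Ordinal iN.
  have j12 : j2 != j1.
    rewrite -val_eqE /=; move: M4 NM; clear; lia.
  rewrite /coupling (bigD1 j1) //= (bigD1 j2) //= big1 ?addr0.
    have b (i : 'I_N) : (two_well R Bl ord0 (ordS i) - two_well R Bl ord0 i) ^+ 2 <= 4.
      by rewrite !twB; case: ifP => _; case: ifP => _; lra.
    by have := b j1; have := b j2; lra.
  move=> i /andP[i1' i2']; rewrite !twB.
  have -> : (ordS i < M)%N = (i < M)%N.
    have iE : (ordS i : nat) = i.+1.
      rewrite /= modn_small //; move: i2' (ltn_ord i); rewrite -val_eqE /=; move: N0; clear; lia.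
    move: i1'; rewrite iE -val_eqE /=; clear -M4; lia.
  by rewrite subrr expr0n.
have [tB stB] := two_well_branch R N0 bB.
have h1 : potential g y <= well_energy R M 0 + 2 * g.
  have h := stationary_region_min N0 g0 by_.1 tB by_.2.
  have c0 := ltW (convexity_gt0 R N0).
  have h2 : 0 <= convexity R N / 2 * sqdist y (two_well R Bl) by rewrite mulr_ge0 ?sqdist_ge0 ?divr_ge0.
  have h3 : g / 4 * coupling (two_well R Bl) <= g / 4 * 8 by rewrite ler_wpM2l ?divr_ge0.
  rewrite [potential g (two_well R Bl)]potentialE (size_class_energy R NM N8 N3 (leq0n _) sB) in h.
  lra.
have coupA : 32 / 3 <= coupling x.
  have -> : 32 / 3 = 8 * (4 / 3) :> R by field.
  apply: (@le_trans _ _ (\sum_(i < N) 4 / 3)).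
    by rewrite sumr_const card_ord -[leRHS]mulr_natl ler_wpM2r ?divr_ge0 // ler_nat.
  apply: ler_sum => i _.
  have rr := rho_sqr R N; have r0 := rho_gt0 R N0.
  have r13 : 1 / 3 <= rho R N ^+ 2 by rewrite rr lerDl divr_ge0 ?mulr_ge0.
  have [[_ xr] _] := bx; have := xr i; have := xr (ordS i).
  have AE j : (j \in A) = odd j by rewrite inE.
  rewrite !AE oS; case: (odd i) => /= h3 h2.
    have : (2 * rho R N) ^+ 2 <= (x ord0 i - x ord0 (ordS i)) ^+ 2.
      by rewrite -subr_ge0 subr_sqr; apply: mulr_ge0; lra.
    lra.
  have : (2 * rho R N) ^+ 2 <= (x ord0 (ordS i) - x ord0 i) ^+ 2.
    by rewrite -subr_ge0 subr_sqr; apply: mulr_ge0; lra.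
  lra.
have h2 : well_energy R M 0 + g / 4 * (32 / 3) <= potential g x.
  rewrite (potentialE g); apply: lerD; last by rewrite ler_wpM2l ?divr_ge0.
  rewrite -(size_class_energy R NM N8 N3 (leq0n _) sA).
  have [tA stA] := two_well_branch R N0 bA.
  have h := stationary_region_min N0 (lexx 0) tA bx.1 stA.
  have c0 := ltW (convexity_gt0 R N0).
  apply: le_trans h; rewrite lerDl mulr_ge0 ?sqdist_ge0 ?divr_ge0 //.
have : potential g y < potential g x by lra.
by rewrite E ltxx.
Qed.

End Hierarchy.

Theorem theorem4p4 (R : realType) (N M : nat) :
  N = (2 * M)%N -> (8 <= N)%N -> ~~ (3 %| N)%N ->
  let kmax := (N %/ 6)%N in
  [/\ (* the hierarchy without coupling *)
      metastable_order 0 kmax.+1 (@B0 R N M),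
      (* minimal paths reach the communication height on saddles, and the
         saddles on which they reach it all lie in C_k *)
      (forall k : nat, (1 <= k <= kmax)%N ->
       forall x : 'rV[R]_N, B0 M k x ->
       forall Gamma : R -> 'rV[R]_N,
       minimal_path 0 x (B0 M k.-1) Gamma ->
         (exists t : R, [/\ t \in `[0, 1],
            at_comm_height 0 x (B0 M k.-1) (Gamma t) & C0 M k (Gamma t)])
         /\ (forall t : R, t \in `[0, 1] ->
            at_comm_height 0 x (B0 M k.-1) (Gamma t) ->
            one_saddle 0 (Gamma t) -> C0 M k (Gamma t))),
      (* without coupling, the potential is constant on each B_k *)
      (forall k : nat, (k <= kmax)%N -> forall x y : 'rV[R]_N,
         B0 M k x -> B0 M k y -> potential 0 x = potential 0 y) &
      (* weak coupling *)
      exists2 gamma0 : R, 0 < gamma0 &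
        forall gamma : R, 0 < gamma < gamma0 ->
          metastable_order gamma kmax.+1 (@B R N M gamma)
          /\ ~ (forall k : nat, (k <= kmax)%N -> forall x y : 'rV[R]_N,
                 B M gamma k x -> B M gamma k y ->
                 potential gamma x = potential gamma y)].
Proof.
move=> NM N8 N3 kmax.
have N0 : (0 < N)%N by exact: leq_trans N8.
have [theta th0 thP] := uniform_gap R NM N8 N3.
have [g1 g10 lmr] := local_minimum_region R N8 N3.
split.
- apply: (metastable_families NM N8 N3 th0 thP (weak0 R N0)).
  + by rewrite mulr0 divr_ge0 // ltW.
  + by move=> x; apply: lmr.
  + by move=> k; exact: family_B0.
- by move=> k /andP[k1 kN] x xk Gamma; exact: minimal_path_saddle.
- move=> k kN x y /(B0P NM N8 N3 _ kN)[P cP ->] /(B0P NM N8 N3 _ kN)[Q cQ ->].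
  by rewrite (size_class_energy R NM N8 N3 kN cP) (size_class_energy R NM N8 N3 kN cQ).
have n0 : 0 < N%:R :> R by rewrite ltr0n.
have rate0 : 0 < path_rate R N + 4 * N%:R.
  by rewrite ltr_wpDl ?mulr_gt0 // /path_rate addr_ge0 ?mulr_ge0 ?addr_ge0 ?exprn_ge0 ?addr_ge0.
have m0 : 0 < margin R N by exact: margin_gt0.
have s0 : 0 < 16 * N%:R ^+ 2 :> R by rewrite mulr_gt0 ?exprn_gt0.
exists (Num.min g1 (Num.min (theta / 2 / (path_rate R N + 4 * N%:R)) (margin R N ^+ 2 / (16 * N%:R ^+ 2)))).
  by rewrite !lt_min g10 /= !divr_gt0 ?exprn_gt0.
move=> g /andP[gp]; rewrite !lt_min => /and3P[gg1 gth gm].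
have wg : weak N g.
  by split; [exact: ltW|rewrite mulrC -ltr_pdivlMr].
split.
  apply: (metastable_families NM N8 N3 th0 thP wg).
  - by rewrite mulrC -ler_pdivlMr // ltW.
  - by move=> x; apply: lmr => //; exact: ltW.
  - by move=> k; exact: family_B.
move=> H; apply: (patterns_differ NM N8 N3 wg gp) => x y xf yf.
by apply: (H 0%N) => //; rewrite (family_B NM N8 N3).
Qed.
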